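(* Let $S$ be a discrete valuation ring with field of quotients $L$, $G$ a finite subgroup of $\mathrm{Aut}(S)$, $R=S^G$, and assume that the residue field extension $\bar S/\bar R$ is separable. Let $f\in Z^2(G,S^* )$ and let $T=S^f*G$ be hereditary. Then the number of maximal $R$-orders containing $T$ in $L^f*G$ is equal to the order of the conductor $H_f$. In particular, for $f\in Z^2(G,S^* )$, the crossed product $T=S^f*G$ is a maximal $R$-order in $L^f*G$ if and only if it is hereditary and the conductor $H_f$ is trivial.
   Context: $M_S$ is the maximal ideal of $S$, $\bar S=S/M_S$, and $\bar R=R/(M_S\cap R)$. For $f\in Z^2(G,S^* )$, the crossed product $S^f*G=\bigoplus_{g\in G}SU_g$ is the free left $S$-module on symbols $U_g$ with multiplication $sU_g\,tU_h=s\,g(t)f(g,h)U_{gh}$ for $s,t\in S$, $g,h\in G$. It is an $R$-order in the central simple algebra $L^f*G$ (defined by the same formula over $L$, viewing $f$ in $Z^2(G,L^* )$). The inertia subgroup $G_I\lhd G$ is the kernel of the induced action of $G$ on $\bar S$. Let $\bar f\in Z^2(G,\bar S^* )$ be the image of $f$ under the natural map $Z^2(G,S^* )\to Z^2(G,\bar S^* )$. Conductor: for $f$ such that $S^f*G$ is hereditary, the conductor $H_f$ with respect to $f$ is the maximal subgroup $H$ of the inertia $G_I$ such that the class $[\bar f]\in H^2(G,\bar S^* )$ is inflated from $H^2(G/H,\bar S^* )$, i.e. lies in the image of the inflation map $H^2(G/H,\bar S^* )\to H^2(G,\bar S^* )$. (Here $H$ ranges over subgroups of $G_I$ that are normal in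 $G$; since $H$ acts trivially on $\bar S$, $\bar S^*$ is a $G/H$-module. When $S^f*G$ is hereditary, any subgroup of $G_I$ on which $\bar f$ is cohomologically trivial is contained in a cyclic normal subgroup of $G$, so it is automatically normal in $G$.) The 2-cocycles are normalized. *)

(* Defs.v *)
From HB Require Import structures.
From mathcomp Require Import all_boot all_order all_algebra all_fingroup all_field.
From mathcomp Require Import generic_quotient ring_quotient fraction.
From mathcomp Require Import mathcomp_extra boolp classical_sets cardinality.

Set Implicit Arguments.
Unset Strict Implicit.
Unset Printing Implicit Defensive.

Import GRing.Theory.

Local Open Scope ring_scope.
Local Open Scope quotient_scope.

(* A discrete valuation ring is a local principal ideal domain which is not a
   field; local means that the non-units are closed under addition. *)
HB.mixin Record isDVR S of GRing.IntegralDomain S := {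
  dvr_local : forall x y : S,
    x \isn't a GRing.unit -> y \isn't a GRing.unit ->
    x + y \isn't a GRing.unit;
  dvr_principal : forall I : S -> Prop,
    I 0 -> (forall x y, I x -> I y -> I (x + y)) ->
    (forall b x, I x -> I (b * x)) ->
    exists p, forall x, I x <-> exists b, x = b * p;
  dvr_nfield : exists x : S, x != 0 /\ x \isn't a GRing.unit
}.

#[short(type="dvrType")]
HB.structure Definition DVR := {S of isDVR S & GRing.IntegralDomain S}.

Section ResidueField.
Variable S : dvrType.

Definition max_ideal : {pred S} := [pred x | x \isn't a GRing.unit].

Lemma max_idealE x : (x \in max_ideal) = (x \isn't a GRing.unit).
Proof. by []. Qed.

Lemma max_ideal_closed : idealr_closed max_ideal.
Proof.
split; rewrite ?max_idealE ?unitr0 ?negbK ?unitr1 // => a u v uI vI.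
rewrite max_idealE; apply: dvr_local => //.
by rewrite unitrM negb_and [X in _ || X]uI orbT.
Qed.

HB.instance Definition _ := isIdealr.Build S max_ideal max_ideal_closed.

Definition residue := {ideal_quot max_ideal}.

HB.instance Definition _ := GRing.ComNzRing.on residue.

Definition residue_map (x : S) : residue := \pi_residue x.

Lemma residue_map_eq x y :
  (residue_map x == residue_map y) = (x - y \isn't a GRing.unit).
Proof. by rewrite /residue_map piE. Qed.

Lemma residue_map_is_zmod_morphism : zmod_morphism residue_map.
Proof. by move=> x y; rewrite /residue_map rmorphB. Qed.
HB.instance Definition _ := GRing.isZmodMorphism.Build S residue residue_map
  residue_map_is_zmod_morphism.

Lemma residue_map_is_monoid_morphism : monoid_morphism residue_map.
Proof. by rewrite /residue_map; split=> [|x y]; rewrite ?rmorph1 ?rmorphM. Qed.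
HB.instance Definition _ := GRing.isMonoidMorphism.Build S residue residue_map
  residue_map_is_monoid_morphism.

Lemma residue_mapK (y : residue) : residue_map (repr y) = y.
Proof. exact: reprK. Qed.

Lemma residue_map_eq0 x : (residue_map x == 0) = (x \isn't a GRing.unit).
Proof. by rewrite -(rmorph0 residue_map) residue_map_eq subr0. Qed.

Definition residue_inv (y : residue) : residue :=
  if y == 0 then 0 else residue_map (repr y)^-1.

Lemma residue_mulVf (y : residue) : y != 0 -> residue_inv y * y = 1.
Proof.
move=> y0; rewrite /residue_inv (negPf y0) -[in X in _ * X](residue_mapK y).
rewrite -rmorphM mulVr ?rmorph1 //.
by move: y0; rewrite -[X in X != 0]residue_mapK residue_map_eq0 negbK.
Qed.

Lemma residue_inv0 : residue_inv 0 = 0.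
Proof. by rewrite /residue_inv eqxx. Qed.

HB.instance Definition _ :=
  GRing.ComNzRing_isField.Build residue residue_mulVf residue_inv0.

End ResidueField.

(* A finite subgroup G of Aut(A) is a finite group [gT] with a faithful action by
   ring endomorphisms (automorphisms, by the two axioms); faithfulness is not
   part of the record since the induced action on a residue field need not be
   faithful. *)
Record ring_action (gT : finGroupType) (A : pzRingType) := RingAction {
  ract :> gT -> {rmorphism A -> A};
  ract1 : ract 1%g =1 id;
  ractM : forall g h, ract (g * h)%g =1 ract g \o ract h
}.

(* Twisting by a plain function on [A] (rather than a [ring_action]) lets the
   two definitions below apply to G/H acting on the residue field. *)
Definition is_cocycle (gT : finGroupType) (A : unitRingType)
    (a : gT -> A -> A) (f : gT -> gT -> A) : Prop :=
  [/\ forall g h, f g h \is a GRing.unit,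
      forall g, f 1%g g = 1 /\ f g 1%g = 1 &
      forall g h k, a g (f h k) * f g (h * k)%g = f g h * f (g * h)%g k].

Definition cohomologous (gT : finGroupType) (A : unitRingType)
    (a : gT -> A -> A) (f1 f2 : gT -> gT -> A) : Prop :=
  exists c : gT -> A, (forall g, c g \is a GRing.unit) /\
    (forall g h, f1 g h = c g * a g (c h) * (c (g * h)%g)^-1 * f2 g h).

Record cocycle (gT : finGroupType) (A : comUnitRingType)
    (a : ring_action gT A) := Cocycle {
  cocycle_val :> gT -> gT -> A;
  cocycleP : is_cocycle (fun g => a g) cocycle_val
}.

Section CrossedProduct.
Variables (gT : finGroupType) (A : comUnitRingType) (a : ring_action gT A).
(* [x : crossed] stands for the sum over g of [x g] U_g; the multiplication
   rule of the symbols is [crossed_UM] below. *)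
Definition crossed (f : cocycle a) : Type := {ffun gT -> A}.
HB.instance Definition _ f := GRing.Zmodule.on (crossed f).

Variable f : cocycle a.
Implicit Types x y z : crossed f.

Definition crossed_U (g : gT) (s : A) : crossed f :=
  [ffun h => if h == g then s else 0].

Definition crossed_mul x y : crossed f :=
  [ffun k => \sum_g x g * a g (y (g^-1 * k)%g) * f g (g^-1 * k)%g].

Lemma crossed_UM g h s t :
  crossed_mul (crossed_U g s) (crossed_U h t)
  = crossed_U (g * h)%g (s * a g t * f g h).
Proof.
apply/ffunP=> k; rewrite !ffunE (bigD1 g) //= big1 ?addr0.
  rewrite !ffunE eqxx (canF_eq (mulKVg g)); case: eqP => [->|_].
    by rewrite mulKg.
  by rewrite rmorph0 mulr0 mul0r.
by move=> i /negPf ig; rewrite !ffunE ig !mul0r.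
Qed.

Lemma crossed_mulA : associative crossed_mul.
Proof.
have [_ _ fP] := cocycleP f.
move=> x y z; apply/ffunP=> k; rewrite !ffunE.
under eq_bigr => g _ do rewrite ffunE rmorph_sum mulr_sumr mulr_suml.
under [RHS]eq_bigr => u _ do rewrite ffunE !mulr_suml.
rewrite [RHS]exchange_big; apply: eq_bigr => g _ /=.
rewrite [RHS](reindex_inj (mulgI g)); apply: eq_bigr => h _ /=.
rewrite !mulKg invMg -!mulgA !rmorphM ractM /=.
set t := (h^-1 * (g^-1 * k))%g.
have -> : (g^-1 * k = h * t)%g by rewrite /t mulKVg.
by rewrite -!mulrA fP [f g h * (_ * _)]mulrCA.
Qed.

Definition crossed_one : crossed f := crossed_U 1%g 1.

Lemma crossed_mul1 : left_id crossed_one crossed_mul.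
Proof.
have [_ f1 _] := cocycleP f.
move=> x; apply/ffunP=> k; rewrite !ffunE (bigD1 1%g) //= big1 ?addr0.
  by rewrite ffunE eqxx invg1 mul1g (f1 k).1 mulr1 ract1 mul1r.
by move=> g /negPf g1; rewrite ffunE g1 !mul0r.
Qed.

Lemma crossed_mulr1 : right_id crossed_one crossed_mul.
Proof.
have [_ f1 _] := cocycleP f.
move=> x; apply/ffunP=> k; rewrite !ffunE (bigD1 k) //= big1 ?addr0.
  by rewrite ffunE mulVg eqxx (f1 k).2 mulr1 rmorph1 mulr1.
move=> g gk; rewrite ffunE; case: eqP => [e|_]; last by rewrite rmorph0 mulr0 mul0r.
by case/eqP: gk; rewrite -(mulKVg g k) e mulg1.
Qed.

Lemma crossed_mulDl : left_distributive crossed_mul +%R.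
Proof.
move=> x y z; apply/ffunP=> k; rewrite !ffunE -big_split /=.
by apply: eq_bigr => g _; rewrite ffunE !mulrDl.
Qed.

Lemma crossed_mulDr : right_distributive crossed_mul +%R.
Proof.
move=> x y z; apply/ffunP=> k; rewrite !ffunE -big_split /=.
by apply: eq_bigr => g _; rewrite ffunE rmorphD mulrDr mulrDl.
Qed.

Lemma crossed_one_neq0 : crossed_one != 0.
Proof.
by apply/eqP=> /ffunP/(_ 1%g); rewrite !ffunE eqxx; apply/eqP/oner_neq0.
Qed.

HB.instance Definition _ := GRing.Zmodule_isNzRing.Build (crossed f)
  crossed_mulA crossed_mul1 crossed_mulr1 crossed_mulDl crossed_mulDr
  crossed_one_neq0.

End CrossedProduct.

Section ResidueAction.
Variables (gT : finGroupType) (S : dvrType) (a : ring_action gT S).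

Definition residue_act_fun (g : gT) (y : residue S) : residue S :=
  residue_map (a g (repr y)).

Lemma residue_act_funE g x :
  residue_act_fun g (residue_map x) = residue_map (a g x).
Proof.
apply/eqP; rewrite residue_map_eq -rmorphB.
have : repr (residue_map x) - x \isn't a GRing.unit.
  by rewrite -residue_map_eq residue_mapK.
apply: contra => /(rmorph_unit (a g^-1%g)).
by rewrite -[a _ (a _ _)]/((a g^-1%g \o a g) _) -ractM mulVg ract1.
Qed.

Lemma residue_act_is_zmod_morphism g : zmod_morphism (residue_act_fun g).
Proof.
move=> x y; rewrite -[x]residue_mapK -[y]residue_mapK -rmorphB.
by rewrite !residue_act_funE !rmorphB.
Qed.
HB.instance Definition _ g := GRing.isZmodMorphism.Build
  (residue S) (residue S) (residue_act_fun g) (residue_act_is_zmod_morphism g).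

Lemma residue_act_is_monoid_morphism g : monoid_morphism (residue_act_fun g).
Proof.
split=> [|x y]; first by rewrite -(rmorph1 (@residue_map S))
  residue_act_funE !rmorph1.
rewrite -[x]residue_mapK -[y]residue_mapK -rmorphM.
by rewrite !residue_act_funE !rmorphM.
Qed.
HB.instance Definition _ g := GRing.isMonoidMorphism.Build
  (residue S) (residue S) (residue_act_fun g)
  (residue_act_is_monoid_morphism g).

Lemma residue_act1 : residue_act_fun 1%g =1 id.
Proof.
by move=> y; rewrite -[y]residue_mapK residue_act_funE ract1.
Qed.

Lemma residue_actM g h :
  residue_act_fun (g * h)%g =1 residue_act_fun g \o residue_act_fun h.
Proof.
by move=> y; rewrite -[y]residue_mapK /= !residue_act_funE ractM.
Qed.

Definition residue_act : ring_action gT (residue S) :=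
  @RingAction gT (residue S) (fun g => residue_act_fun g)
    residue_act1 residue_actM.

End ResidueAction.

Section FractionAction.
Variables (gT : finGroupType) (S : idomainType) (a : ring_action gT S).

Local Notation L := {fraction S}.
Local Notation "x %:F" := (@FracField.tofrac S x).

Definition fraction_act_fun (g : gT) (x : L) : L :=
  (a g \n_(repr x))%:F / (a g \d_(repr x))%:F.

Lemma fraction_reprE (x : L) : x = (\n_(repr x))%:F / (\d_(repr x))%:F.
Proof.
have d0 : (\d_(repr x))%:F != 0 by rewrite tofrac_eq0 denom_ratioP.
apply: (mulIf d0); rewrite mulfVK //.
set r := repr x; have -> : x = \pi_L r by rewrite reprK.
unlock FracField.tofrac; rewrite -[LHS]FracField.pi_mul.
apply/eqmodP; rewrite /= FracField.equivfE /FracField.mulf.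
by rewrite !numden_Ratio ?mulr1 ?oner_neq0 ?denom_ratioP // mulrC.
Qed.

Lemma ract_neq0 g x : x != 0 -> a g x != 0.
Proof.
apply: contraNneq => e; rewrite -[x](ract1 a) -(mulVg g) ractM /= e.
by rewrite rmorph0.
Qed.

Lemma fraction_act_funE g n d : d != 0 ->
  fraction_act_fun g (n%:F / d%:F) = (a g n)%:F / (a g d)%:F.
Proof.
move=> d0; rewrite /fraction_act_fun.
set x := n%:F / d%:F; have := fraction_reprE x.
have := denom_ratioP (repr x); move: (\n_(repr x)) (\d_(repr x)) => m e e0.
rewrite /x => /eqP; rewrite eqr_div ?tofrac_eq0 // -!tofracM tofrac_eq => /eqP E.
apply/eqP; rewrite eqr_div ?tofrac_eq0 ?ract_neq0 // -!tofracM tofrac_eq.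
by rewrite -!rmorphM E.
Qed.

Lemma tofrac_divB (n d m e : S) : d != 0 -> e != 0 ->
  n%:F / d%:F - m%:F / e%:F = (n * e - m * d)%:F / (d * e)%:F.
Proof.
move=> d0 e0; rewrite -mulNr addf_div ?tofrac_eq0 //.
by rewrite mulNr -!tofracM -tofracB.
Qed.

Lemma fraction_act_is_zmod_morphism g : zmod_morphism (fraction_act_fun g).
Proof.
move=> x y; rewrite (fraction_reprE x) (fraction_reprE y).
have := denom_ratioP (repr x); have := denom_ratioP (repr y).
move: (\n_(repr x)) (\d_(repr x)) (\n_(repr y)) (\d_(repr y)) => n d m e e0 d0.
rewrite tofrac_divB // !fraction_act_funE ?mulf_neq0 //.
by rewrite tofrac_divB ?ract_neq0 // rmorphB !rmorphM.
Qed.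
HB.instance Definition _ g := GRing.isZmodMorphism.Build
  L L (fraction_act_fun g) (fraction_act_is_zmod_morphism g).

Lemma fraction_act_tofrac g x : fraction_act_fun g x%:F = (a g x)%:F.
Proof.
have := @fraction_act_funE g x 1 (oner_neq0 _).
by rewrite !rmorph1 !divr1.
Qed.

Lemma fraction_act_is_monoid_morphism g : monoid_morphism (fraction_act_fun g).
Proof.
split=> [|x y]; first by rewrite -tofrac1 fraction_act_tofrac rmorph1.
rewrite (fraction_reprE x) (fraction_reprE y).
have := denom_ratioP (repr x); have := denom_ratioP (repr y).
move: (\n_(repr x)) (\d_(repr x)) (\n_(repr y)) (\d_(repr y)) => n d m e e0 d0.
rewrite mulf_div -!tofracM !fraction_act_funE ?mulf_neq0 //.
by rewrite mulf_div -!tofracM -!rmorphM.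
Qed.
HB.instance Definition _ g := GRing.isMonoidMorphism.Build
  L L (fraction_act_fun g) (fraction_act_is_monoid_morphism g).

Lemma fraction_act1 : fraction_act_fun 1%g =1 id.
Proof. by move=> x; rewrite /fraction_act_fun !ract1 -fraction_reprE. Qed.

Lemma fraction_actM g h :
  fraction_act_fun (g * h)%g =1 fraction_act_fun g \o fraction_act_fun h.
Proof.
move=> x; rewrite /= [fraction_act_fun h x]/fraction_act_fun.
by rewrite fraction_act_funE ?ract_neq0 ?denom_ratioP // /fraction_act_fun !ractM.
Qed.

Definition fraction_act : ring_action gT L :=
  @RingAction gT L (fun g => fraction_act_fun g) fraction_act1 fraction_actM.

Variable f : cocycle a.

Lemma fraction_cocycleP :
  is_cocycle (fun g => fraction_act g) (fun g h => (f g h)%:F).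
Proof.
have [fu f1 fM] := cocycleP f; split=> [g h|g|g h k].
- exact: rmorph_unit.
- by rewrite (f1 g).1 (f1 g).2 tofrac1.
- by rewrite /= fraction_act_tofrac -!tofracM fM.
Qed.

Definition fraction_cocycle : cocycle fraction_act := Cocycle fraction_cocycleP.

End FractionAction.

(* A left ideal of T is presented as a left T-module with an injective linear
   map to T; right T-modules are left modules over the converse ring T^c. *)
Definition projective (T : nzRingType) (P : lmodType T) : Prop :=
  forall (M N : lmodType T) (p : {linear M -> N}) (q : {linear P -> N}),
    (forall y, exists x, p x = y) ->
    exists r : {linear P -> M}, forall x, p (r x) = q x.

Definition left_hereditary (T : nzRingType) : Prop :=
  forall (I : lmodType T) (i : {linear I -> T^o}), injective i -> projective I.

Definition hereditary (T : nzRingType) : Prop :=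
  left_hereditary T /\ left_hereditary T^c.

Section Orders.
Variables (gT : finGroupType) (S : idomainType) (a : ring_action gT S).
Variable f : cocycle a.

Local Notation L := {fraction S}.
Local Notation "x %:F" := (@FracField.tofrac S x).

Definition fixed_ring : set S := [set r | forall g, a g r = r].

Definition crossed_fraction := crossed (fraction_cocycle f).
HB.instance Definition _ := GRing.NzRing.on crossed_fraction.

(* The embedding of L in L^f*G as the multiples of U_1; on R and on its field
   of fractions it is the structure map of the algebra. *)
Definition crossed_scalar (c : L) : crossed_fraction :=
  crossed_U (fraction_cocycle f) 1%g c.

(* A subring (with the same 1) which is a finitely generated R-module and
   spans L^f*G over the field of fractions of R. *)
Definition is_order (M : set crossed_fraction) : Prop :=
  [/\ GRing.subring_closed [in M],
      exists (n : nat) (e : 'I_n -> crossed_fraction), forall x,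
        M x <-> exists c : 'I_n -> S, (forall i, fixed_ring (c i)) /\
          x = \sum_i crossed_scalar (c i)%:F * e i &
      forall x, exists (n : nat) (r s : 'I_n -> S)
          (m : 'I_n -> crossed_fraction),
        (forall i, [/\ fixed_ring (r i), fixed_ring (s i), s i != 0 & M (m i)])
        /\ x = \sum_i crossed_scalar ((r i)%:F / (s i)%:F) * m i].

Definition is_maximal_order (M : set crossed_fraction) : Prop :=
  is_order M /\ forall N, is_order N -> (M `<=` N)%classic -> N = M.

(* The image of S^f*G in L^f*G. *)
Definition crossed_order : set crossed_fraction :=
  [set x | exists y : crossed f, forall g, x g = (y g)%:F].

Definition maximal_orders_over : set (set crossed_fraction) :=
  [set M | is_maximal_order M /\ (crossed_order `<=` M)%classic].

End Orders.

Arguments crossed_order {gT S a} f _.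
Arguments maximal_orders_over {gT S a} f _.

Section Residue.
Variables (gT : finGroupType) (S : dvrType) (a : ring_action gT S).

Definition residue_fixed : set (residue S) :=
  [set y | exists2 r, fixed_ring a r & y = residue_map r].

(* Every element is algebraic with separable minimal polynomial. *)
Definition residue_separable : Prop :=
  forall y : residue S, exists p : {poly residue S},
    [/\ p \is monic, p \is a polyOver [in residue_fixed], root p y,
        forall q, q \is a polyOver [in residue_fixed] -> root q y -> p %| q &
        separable_poly p].

Definition inertia : {set gT} :=
  [set g | `[< forall y, residue_act a g y = y >]].

(* If H lies in the inertia group, a coset of H acts on the residue field
   through any of its elements, in particular through its representative. *)
Definition coset_act (H : {group gT}) (q : coset_of H) :
    residue S -> residue S :=
  residue_act a (fingroup.repr q).

Variable f : cocycle a.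

Definition residue_cocycle (g h : gT) : residue S := residue_map (f g h).

Definition inflated_from (H : {group gT}) : Prop :=
  exists f' : coset_of H -> coset_of H -> residue S,
    is_cocycle (@coset_act H) f' /\
    cohomologous (fun g => residue_act a g) residue_cocycle
      (fun g h => f' (coset H g) (coset H h)).

(* The whole group G is [[set: gT]]; for H normal in G the type [coset_of H] is
   all of G/H. Maximality is with respect to inclusion; the trivial group always
   qualifies, so maximal ones exist. *)
Definition is_conductor (H : {group gT}) : Prop :=
  [max H | [&& H \subset inertia, H <| [set: gT] & `[< inflated_from H >]]]%g.

End Residue.

(* Main.v *)
(** Let W be the wild inertia group: the elements of the inertia group fixing a
    uniformizer pi modulo pi^2; it is a p-group.  Over W the residue twisted
    group ring has an augmentation into a purely inseparable extension, whose
    kernel is the set of non-units.  A non-unit of S^W is divisible by pi^|W|, so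
    comparing determinants of right multiplications shows that if T is hereditary
    (or maximal), then this kernel vanishes: the residue ring of W is a field.
    A minimal-support argument then shows that the residue ring B = T / pi T has
    no proper ideal stable under conjugation by pi, so B is a product of simple
    rings permuted cyclically by pi.  With I_j the preimage in T of the j-th
    simple factor, the maximal orders over T are the unions over s of
    {x : x I_j^s <= T}, one for each j, and Fourier analysis of the idempotents
    over the tame character identifies the number of factors with the order of
    the conductor.  Conversely, when the residue ring of W is a field, S^f*W is a
    noncommutative discrete valuation ring, and averaging over G / W shows that
    T is hereditary. *)

From HB Require Import structures.
From mathcomp Require Import boolp classical_sets cardinality.
From mathcomp Require Import all_boot all_algebra all_fingroup all_solvable.
From mathcomp Require Import all_field all_character.
From mathcomp Require Import generic_quotient ring_quotient fraction.
Require Import Defs.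

Set Implicit Arguments.
Unset Strict Implicit.
Unset Printing Implicit Defensive.

Import GRing.Theory.

Local Open Scope ring_scope.

(** Separability of the residue extension enters through one fact: every residue is purely
    inseparable over the residues of S^W, hence is itself such a residue. So S is totally ramified
    over S^W, and trace-one elements for G / W can be chosen in S^W. Determinants of right
    multiplication on S^f*W lie in S^W, which turns this into a statement about T. Heredity is used
    on left ideals T pi + T y with two generators. Maximality is treated separately, since it is not
    known beforehand to imply heredity: if the augmentation has a kernel, a nonzero z annihilated by
    that kernel gives pi^-1 z, which lies outside T but in the right order of the ideal generated by
    pi and lifts of the kernel. As S is not complete, the idempotents of B need not lift to T.
    Orders above T are therefore controlled by their leading coefficients at each power of pi^-1:
    these form ideals of B, and conjugation by pi links the ideals of successive depths. *)

Definition is_ideal (B : nzRingType) (X : B -> Prop) : Prop :=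
  [/\ X 0, forall x y, X x -> X y -> X (x + y),
      forall b x, X x -> X (b * x) & forall b x, X x -> X (x * b)].

(** * Orders over a ring with semisimple residue ring *)

Section Overrings.
Variables (A B : nzRingType) (T : A -> Prop) (p q : A) (rho : A -> B).
Variables (sigma : B -> B) (r : nat) (e : nat -> B).
Hypotheses (T1 : T 1) (TB : forall x y, T x -> T y -> T (x - y)).
Hypothesis TM : forall x y, T x -> T y -> T (x * y).
Hypotheses (Tp : T p) (pq : p * q = 1) (qp : q * p = 1).
Hypothesis TJ : forall x, T x -> T (q * x * p).
Hypothesis rho1 : rho 1 = 1.
Hypothesis rhoB : forall x y, T x -> T y -> rho (x - y) = rho x - rho y.
Hypothesis rhoM : forall x y, T x -> T y -> rho (x * y) = rho x * rho y.
Hypothesis rho_onto : forall b, exists2 x, T x & rho x = b.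
Hypothesis rho_ker : forall x, T x -> rho x = 0 <-> T (q * x).
Hypothesis rhoJ : forall x, T x -> rho (q * x * p) = sigma (rho x).
Hypothesis T_bound : forall x, exists n, T (p ^+ n * x).
Hypothesis e_sum : \sum_(i < r) e i = 1.
Hypothesis e_idem : forall i, (i < r)%N -> e i * e i = e i.
Hypothesis e_neq0 : forall i, (i < r)%N -> e i != 0.
Hypothesis e_central : forall i b, (i < r)%N -> b * e i = e i * b.
Hypothesis e_trans : forall i j, (i < r)%N -> (j < r)%N ->
  exists2 k, (k < r)%N & iter k sigma (e i) = e j.
Hypothesis e_simple : forall X x j, is_ideal X -> (j < r)%N -> X x ->
  x * e j != 0 -> X (e j).

(** The common denominator [p ^+ n] stands in for finite generation over the fixed ring;
    [is_order_overP] shows that the two agree for orders above [T]. *)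
Definition overring (N : A -> Prop) : Prop :=
  [/\ forall x, T x -> N x, forall x y, N x -> N y -> N (x - y),
      forall x y, N x -> N y -> N (x * y)
    & exists n, forall x, N x -> T (p ^+ n * x)].

Definition max_overring (N : A -> Prop) : Prop :=
  overring N /\ forall N', overring N' -> (forall x, N x -> N' x) ->
  forall x, N' x -> N x.

(* [x I_j^s <= T], where [I_j] is the preimage in [T] of the ideal [B e_j]. *)
Fixpoint power_colon (j s : nat) (x : A) : Prop :=
  if s is s'.+1 then
    forall y, T y -> rho y * e j = rho y -> power_colon j s' (x * y)
  else T x.

Definition colon_order (j : nat) (x : A) : Prop := exists s, power_colon j s x.

Let T0 : T 0. Proof. by rewrite -(subrr 1); apply: TB. Qed.
Let TN x : T x -> T (- x). Proof. by move=> Tx; rewrite -[- x]add0r; apply: TB. Qed.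
Let TD x y : T x -> T y -> T (x + y).
Proof. by move=> Tx Ty; rewrite -[y]opprK; apply: TB => //; apply: TN. Qed.
Let rho0 : rho 0 = 0. Proof. by rewrite -(subrr 1) rhoB // subrr. Qed.
Let rhoN x : T x -> rho (- x) = - rho x.
Proof. by move=> Tx; rewrite -[- x]add0r rhoB // rho0 add0r. Qed.
Let rhoD x y : T x -> T y -> rho (x + y) = rho x + rho y.
Proof.
by move=> Tx Ty; rewrite -[y in LHS]opprK rhoB ?rhoN ?opprK //; apply: TN.
Qed.
Let TX n : T (p ^+ n).
Proof. by elim: n => [|n IH]; rewrite ?expr0 // exprS; apply: TM. Qed.

Lemma power_colonB j s x y :
  power_colon j s x -> power_colon j s y -> power_colon j s (x - y).
Proof.
elim: s x y => [|s IH] x y /=; first exact: TB.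
by move=> Kx Ky z Tz ez; rewrite mulrBl; apply: IH; [apply: Kx | apply: Ky].
Qed.

(** The ideal I_j is two-sided, so an element of [T] carries it into itself; this makes the union of
    the colon sets closed under products. *)
Lemma power_colonM j s t x y :
  power_colon j s x -> power_colon j t y -> power_colon j (s + t) (x * y).
Proof.
move=> Kx; elim: t y => [|t IH] y /=.
  rewrite addn0; elim: s x Kx y => [|s IH] x Kx y Ty /=; first exact: TM.
  move=> z Tz ez; rewrite -mulrA; apply: Kx; first exact: TM.
  by rewrite rhoM // -mulrA ez.
by move=> Ky; rewrite addnS => z Tz ez; rewrite -mulrA; apply: IH; apply: Ky.
Qed.

Lemma power_colonS j s x : power_colon j s x -> power_colon j s.+1 x.
Proof.
elim: s x => [|s IH] x Kx y Ty ey; first exact: TM.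
by apply: IH; apply: Kx.
Qed.

Lemma power_colonW j s t x : (s <= t)%N -> power_colon j s x -> power_colon j t x.
Proof.
move/subnK<-; elim: (t - s)%N => [|m IH] Kx; first by rewrite add0n.
by rewrite addSn; apply: power_colonS; apply: IH.
Qed.

Lemma colon_orderT j x : T x -> colon_order j x.
Proof. by exists 0%N. Qed.

Lemma colon_orderB j x y : colon_order j x -> colon_order j y -> colon_order j (x - y).
Proof.
move=> [s Kx] [t Ky]; exists (maxn s t).
by apply: power_colonB; [move: Kx | move: Ky]; apply: power_colonW;
  rewrite ?leq_maxl ?leq_maxr.
Qed.

Lemma colon_orderM j x y : colon_order j x -> colon_order j y -> colon_order j (x * y).
Proof. by move=> [s Kx] [t Ky]; exists (s + t)%N; apply: power_colonM. Qed.

(** Since [e j] is idempotent, all positive powers of I_j have the same image in [B], and powers of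
    a single lift [u] of [e j] detect it. *)
Lemma colon_order_leading j y : (j < r)%N -> T y ->
  colon_order j (q * y) <-> rho y * e j = 0.
Proof.
move=> jr Ty; split; last first.
  move=> yej; exists 1%N => z Tz ez; rewrite /= -mulrA.
  apply/rho_ker; first exact: TM.
  by rewrite rhoM // -ez e_central // mulrA yej mul0r.
move=> [s Ks]; have [u Tu rhou] := rho_onto (e j).
have eu : rho u * e j = rho u by rewrite rhou e_idem.
(* The exponent is [s.+1] rather than [s] because only positive powers of [u] have residue [e j]. *)
have : T (q * (y * u ^+ s.+1)).
  move/power_colonS: Ks; elim: (s.+1) (y) => [|m IH] z /= Kz.
    by rewrite expr0 mulr1.
  by rewrite exprS [z * _]mulrA; apply: IH; rewrite mulrA; apply: Kz.
have TU n : T (u ^+ n) by elim: n => [|n IHn]; rewrite ?expr0 // exprS; apply: TM.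
move/rho_ker; rewrite rhoM // => /(_ (TM Ty (TU _))) => H.
have rhoU n : rho (u ^+ n.+1) = e j.
  elim: n => [|n IHn]; first by rewrite expr1.
  by rewrite exprS rhoM // IHn rhou e_idem.
by rewrite -(rhoU s).
Qed.

Let qX n : q ^+ n * p ^+ n = 1.
Proof.
elim: n => [|n IH]; first by rewrite !expr0 mul1r.
by rewrite exprSr exprS mulrA -[_ * q * p]mulrA qp mulr1.
Qed.
Let pX n : p ^+ n * q ^+ n = 1.
Proof.
elim: n => [|n IH]; first by rewrite !expr0 mul1r.
by rewrite exprSr exprS mulrA -[_ * p * q]mulrA pq mulr1.
Qed.

(** Leading coefficients at depth [n]. Stability under left multiplication rests on moving [t]
    across [q ^+ n]: conjugation by [p] maps [T] into itself. *)
Lemma leading_ideal (N : A -> Prop) n :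
  (forall x, T x -> N x) -> (forall x y, N x -> N y -> N (x - y)) ->
  (forall x y, N x -> N y -> N (x * y)) ->
  is_ideal (fun b => exists y, [/\ T y, N (q ^+ n * y) & rho y = b]).
Proof.
move=> TN' NB NM.
have N0 : N 0 by apply: (TN').
have ND x y : N x -> N y -> N (x + y).
  move=> Nx Ny; rewrite -[y]opprK; apply: (NB) => //.
  by rewrite -[- y]add0r; apply: (NB).
split.
- by exists 0; rewrite mulr0.
- move=> _ _ [x [Tx Nx <-]] [y [Ty Ny <-]]; exists (x + y).
  by rewrite mulrDr rhoD //; split=> //; [apply: TD | apply: ND].
- move=> b _ [x [Tx Nx <-]]; have [t Tt <-] := rho_onto b.
  exists (t * x); rewrite rhoM //; split=> //; first exact: TM.
  have [t' Tt' t'E] : exists2 t', T t' & q ^+ n * t = t' * q ^+ n.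
    exists (q ^+ n * t * p ^+ n); last by rewrite -mulrA pX mulr1.
    elim: n {Nx} => [|n IH]; first by rewrite !expr0 mulr1 mul1r.
    by have := TJ IH; rewrite exprS exprSr !mulrA.
  by rewrite mulrA t'E -mulrA; apply: (NM) => //; apply: (TN').
- move=> b _ [x [Tx Nx <-]]; have [t Tt <-] := rho_onto b.
  exists (x * t); rewrite rhoM // mulrA; split=> //; first exact: TM.
  by apply: (NM) => //; apply: (TN').
Qed.

(** If [x] had depth more than [r], some [e i] would be a leading coefficient at that depth.
    Multiplication by [p] lowers the depth by one and keeps the coefficient ([XS]), or applies
    [sigma] to it ([XJ]). Fewer than [r] applications of [sigma] carry [e i] to [e j], so [e j]
    occurs at depth one, which [colon_order_leading] excludes. *)
Lemma colon_order_bound j x : (j < r)%N -> colon_order j x -> T (p ^+ r * x).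
Proof.
move=> jr Mx; have [n Tn] := T_bound x.
have [m Tm mmin] : exists2 m, T (p ^+ m * x) & forall m', T (p ^+ m' * x) -> (m <= m')%N.
  have ex : exists n, `[< T (p ^+ n * x) >] by exists n; apply/asboolP.
  exists (ex_minn ex); first by case: ex_minnP => m /asboolP.
  by case: ex_minnP => m _ mmin m' Tm'; apply: mmin; apply/asboolP.
case: (leqP m r) => [mr|rm].
  by rewrite -(subnK mr) exprD -mulrA; apply: TM.
case: m => [//|m] in Tm mmin rm *.
set z := p ^+ m.+1 * x in Tm.
have rz : rho z != 0.
  apply/eqP => /rho_ker-/(_ Tm); rewrite /z exprS !mulrA qp mul1r => /mmin.
  by rewrite ltnn.
have xE : x = q ^+ m.+1 * z by rewrite mulrA qX mul1r.
pose X l (b : B) := exists y, [/\ T y, colon_order j (q ^+ l * y) & rho y = b].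
have Xid l : is_ideal (X l).
  by apply: leading_ideal; [apply: colon_orderT|apply: colon_orderB|apply: colon_orderM].
have Xz : X m.+1 (rho z) by exists z; rewrite -xE.
have [i ir zi] : exists2 i, (i < r)%N & rho z * e i != 0.
  apply: contrapT => H; case/eqP: rz.
  rewrite -[rho z]mulr1 -e_sum mulr_sumr big1 // => i _.
  by apply: contrapT => /eqP ei; apply: H; exists i.
have Xi := e_simple (Xid _) ir Xz zi.
have XS l b : X l.+1 b -> X l b.
  move=> [y [Ty My <-]]; exists y; split=> //.
  have -> : q ^+ l * y = p * (q ^+ l.+1 * y) by rewrite exprS !mulrA pq mul1r.
  by apply: colon_orderM => //; apply: colon_orderT.
have XJ l b : X l.+1 b -> X l (sigma b).
  move=> [y [Ty My <-]]; exists (q * y * p); split; [exact: TJ| |exact: rhoJ].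
  have -> : q ^+ l * (q * y * p) = q ^+ l.+1 * y * p by rewrite exprSr !mulrA.
  by apply: colon_orderM => //; apply: colon_orderT.
have [k kr ek] := e_trans ir jr.
have XW l l' b : (l <= l')%N -> X l' b -> X l b.
  move/subnK<-; elim: (l' - l)%N => [|d IH]; first by rewrite add0n.
  by rewrite addSn => /XS.
have : X 1%N (e j).
  have : X (k.+1)%N (e i) by apply: XW Xi; rewrite (leq_trans kr) // ltnW.
  rewrite -ek -[k.+1]addn1; move: {ek kr}k (e i); elim=> [|k IH] b; first by rewrite add0n.
  by rewrite addSn iterSr => /XJ /IH.
move=> [y [Ty]]; rewrite expr1 => /(colon_order_leading jr Ty) ye yE.
by case/eqP: (e_neq0 jr); rewrite -(e_idem jr) -{1}yE.
Qed.

Lemma colon_order_overring j : (j < r)%N -> overring (colon_order j).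
Proof.
move=> jr; split; [exact: colon_orderT|exact: colon_orderB|exact: colon_orderM|].
by exists r => x; apply: colon_order_bound.
Qed.

(** If every [e j] were a leading coefficient at depth one, so would be their sum 1; then [q] and
    all its powers would lie in [N], against the bound. *)
Lemma overring_avoids N : overring N ->
  exists2 j, (j < r)%N & forall y, T y -> N (q * y) -> rho y * e j = 0.
Proof.
move=> [TN' NB NM [n Nn]]; apply: contrapT => H.
pose X (b : B) := exists y, [/\ T y, N (q ^+ 1 * y) & rho y = b].
have Xid : is_ideal X by apply: leading_ideal.
have [X0 XD _ _] := Xid.
have Xe j : (j < r)%N -> X (e j).
  move=> jr; apply: contrapT => Xj; apply: H; exists j => // y Ty Ny.
  apply/eqP/negPn/negP => yej; apply: Xj.
  by apply: (e_simple Xid jr _ yej); exists y; rewrite expr1.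
have [y [Ty Ny y1]] : X 1.
  by rewrite -e_sum; apply: big_ind => // i _; apply: Xe.
have Nq : N q.
  have -> : q = q ^+ 1 * y - q * (y - 1) by rewrite expr1 mulrBr subKr mulr1.
  apply: (NB) => //; apply: (TN'); apply/rho_ker; first exact: TB.
  by rewrite rhoB // y1 rho1 subrr.
have NX m : N (q ^+ m).
  by elim: m => [|m IH]; [apply: (TN')|rewrite exprS; apply: (NM)].
have /Nn : N (q ^+ n.+1) by [].
rewrite exprSr mulrA pX mul1r -[q]mulr1 => /rho_ker-/(_ T1)/eqP.
by rewrite rho1 oner_eq0.
Qed.

(** Each right multiplication by I_j lowers the depth by one: the leading coefficient is then fixed
    by [e j] on the right, and by hypothesis it is killed by [e j]. So the exponent bounding [N]
    also serves as the exponent of I_j. *)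
Lemma overring_sub_colon_order N j : (j < r)%N -> overring N ->
  (forall y, T y -> N (q * y) -> rho y * e j = 0) ->
  forall x, N x -> colon_order j x.
Proof.
move=> jr [TN' NB NM [n Nn]] Nj x Nx; exists n.
have Tx := Nn x Nx; elim: n {Nn} x Nx Tx => [|n IH] x Nx Tx.
  by move: Tx; rewrite expr0 mul1r.
move=> y Ty ey; apply: IH; first by apply: (NM) => //; apply: (TN').
have Tz : T (p ^+ n.+1 * x * y) by apply: TM.
have zE : p ^+ n * (x * y) = q * (p ^+ n.+1 * x * y).
  by rewrite exprS !mulrA qp mul1r.
rewrite zE; apply/rho_ker => //.
have -> : rho (p ^+ n.+1 * x * y) = rho (p ^+ n.+1 * x * y) * e j.
  by rewrite rhoM // -mulrA ey.
apply: Nj => //; rewrite -zE; apply: (NM); first exact: TN'.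
by apply: (NM) => //; apply: (TN').
Qed.

(** For [i] different from [j], the element [q * u] with [u] lifting [e j] lies in the order of [i]
    but not in that of [j]. *)
Lemma colon_order_inj i j : (i < r)%N -> (j < r)%N ->
  (forall x, colon_order i x -> colon_order j x) ->
  (forall k, (k < r)%N -> k != i -> e i * e k = 0) -> i = j.
Proof.
move=> ir jr sub orth; apply/eqP; case: eqVneq => // ij.
have [u Tu uE] := rho_onto (e j).
have : colon_order i (q * u).
  by apply/colon_order_leading => //; rewrite uE e_central // orth // eq_sym.
move/sub/(colon_order_leading jr Tu); rewrite uE e_idem // => /eqP.
by rewrite (negPf (e_neq0 jr)).
Qed.

Hypothesis e_orth : forall i j, (i < r)%N -> (j < r)%N -> i != j -> e i * e j = 0.

Lemma max_overringP N : overring N ->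
  max_overring N <-> exists2 j, (j < r)%N & forall x, N x <-> colon_order j x.
Proof.
move=> ovN; split=> [[_ maxN]|[j jr Nj]].
  have [j jr Nj] := overring_avoids ovN; exists j => // x.
  have sub := overring_sub_colon_order jr ovN Nj; split; first exact: sub.
  exact: maxN (colon_order_overring jr) sub x.
split=> // N' ovN' NN' x N'x; apply/Nj.
have [i ir N'i] := overring_avoids ovN'.
have sub := overring_sub_colon_order ir ovN' N'i.
rewrite (_ : j = i); first exact: sub.
apply: colon_order_inj => // [y /Nj /NN' /sub //|k kr kj].
by apply: e_orth; rewrite // eq_sym.
Qed.

End Overrings.

(** Several indices may carry the same homomorphism, so only the total coefficient of each
    homomorphism is forced to vanish. This form is needed on the residue field, where all cosets
    inside the inertia group act alike. *)
Lemma dedekind_independence (M : pzSemiRingType) (F : idomainType) (I : finType)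
    (s : I -> M -> F) (c : I -> F) (i : I) :
  (forall i, s i 1 = 1) -> (forall i x y, s i (x * y) = s i x * s i y) ->
  (forall x, \sum_j c j * s j x = 0) ->
  \sum_(j | `[< s j =1 s i >]) c j = 0.
Proof.
move=> s1 sM; have [n] := ubnP #|[set j | c j != 0]|.
elim: n c => // n IH c; rewrite ltnS => cn csum.
have [[j cj [y sjy]]|H] :=
  pselect (exists2 j, c j != 0 & exists y, s j y != s i y); last first.
  have := csum 1; rewrite (bigID (fun j => `[< s j =1 s i >])) /= addrC big1 ?add0r.
    by move=> E; rewrite -[RHS]E; apply: eq_bigr => j _; rewrite s1 mulr1.
  move=> j /asboolP sji; have [->|cj] := eqVneq (c j) 0; first by rewrite mul0r.
  case: H; exists j => //; apply: contrapT => H; apply: sji => x.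
  by apply: contrapT => /eqP sx; apply: H; exists x.
(* This weight kills the index [j] and multiplies all coefficients in the class of [i] by one
   nonzero factor. *)
pose c' k := c k * (s k y - s j y).
have c'i : \sum_(k | `[< s k =1 s i >]) c' k = 0.
  apply: IH => [|x].
    apply: leq_trans cn; apply: proper_card; apply/properP; split.
      by apply/fintype.subsetP => k; rewrite !inE /c' mulf_eq0 negb_or => /andP[].
    by exists j; rewrite !inE // /c' subrr mulr0 eqxx.
  transitivity (\sum_k c k * s k (y * x) - s j y * \sum_k c k * s k x).
    rewrite mulr_sumr -sumrB; apply: eq_bigr => k _.
    by rewrite /c' sM mulrBr mulrBl mulrA [s j y * _]mulrCA mulrA.
  by rewrite !csum mulr0 subr0.
have : (s i y - s j y) * \sum_(k | `[< s k =1 s i >]) c k = 0.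
  rewrite -[RHS]c'i mulr_sumr; apply: eq_bigr => k /asboolP E.
  by rewrite /c' E mulrC.
by move/eqP; rewrite mulf_eq0 subr_eq0 eq_sym (negPf sjy) /= => /eqP.
Qed.

(** * The valuation of a discrete valuation ring *)

Section Valuation.
Variable S : dvrType.

Lemma uniformizerP : exists p : S, p != 0 /\
  forall x, (x \isn't a GRing.unit) <-> exists b, x = b * p.
Proof.
have [p pP] := @dvr_principal S (fun x => x \isn't a GRing.unit)
  (negbT (unitr0 S)) (@dvr_local S)
  (fun b x xU => etrans (congr1 negb (unitrM b x)) (etrans (negb_and _ _)
     (etrans (congr1 (orb _) xU) (orbT _)))).
exists p; split=> //.
have [x [x0 /pP [b xE]]] := @dvr_nfield S.
by apply: contraNneq x0 => p0; rewrite xE p0 mulr0.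
Qed.

Definition unif : S := sval (cid uniformizerP).

Lemma unif_neq0 : unif != 0.
Proof. by rewrite /unif; case: cid => p []. Qed.

Lemma nunitP x : (x \isn't a GRing.unit) <-> exists b, x = b * unif.
Proof. by rewrite /unif; case: cid => p [_ H] /=. Qed.

Lemma unif_nunit : unif \isn't a GRing.unit.
Proof. by apply/nunitP; exists 1; rewrite mul1r. Qed.

Lemma unitrD_nunit (x y : S) : x \is a GRing.unit -> y \isn't a GRing.unit ->
  x + y \is a GRing.unit.
Proof.
move=> xU yU; apply: contraTT xU => H; rewrite -[x](addrK y).
by apply: dvr_local => //; rewrite unitrN.
Qed.

Definition dvd (n : nat) (x : S) : Prop := exists b, x = b * unif ^+ n.

Lemma dvd0 n : dvd n 0. Proof. by exists 0; rewrite mul0r. Qed.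
Lemma dvdD n x y : dvd n x -> dvd n y -> dvd n (x + y).
Proof. by move=> [b ->] [c ->]; exists (b + c); rewrite mulrDl. Qed.
Lemma dvdN n x : dvd n x -> dvd n (- x).
Proof. by move=> [b ->]; exists (- b); rewrite mulNr. Qed.
Lemma dvdMl n x y : dvd n x -> dvd n (y * x).
Proof. by move=> [b ->]; exists (y * b); rewrite mulrA. Qed.
Lemma dvdMr n x y : dvd n x -> dvd n (x * y).
Proof. by rewrite mulrC; apply: dvdMl. Qed.
Lemma dvdM m n x y : dvd m x -> dvd n y -> dvd (m + n) (x * y).
Proof. by move=> [b ->] [c ->]; exists (b * c); rewrite exprD mulrACA. Qed.
Lemma dvdW m n x : (m <= n)%N -> dvd n x -> dvd m x.
Proof. by move/subnK<- => -[b ->]; exists (b * unif ^+ (n - m)); rewrite exprD mulrA. Qed.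
Lemma dvd1P x : dvd 1 x <-> x \isn't a GRing.unit.
Proof. by rewrite nunitP /dvd expr1. Qed.

(** The intersection of the powers of the maximal ideal is principal. Dividing its generator by the
    uniformizer stays inside the intersection, so the generator is a multiple of itself by a
    non-unit and vanishes. *)
Lemma unif_sep x : (forall n, dvd n x) -> x = 0.
Proof.
have [p pP] := @dvr_principal S (fun x => forall n, dvd n x)
  (fun n => dvd0 n) (fun x y Hx Hy n => dvdD (Hx n) (Hy n))
  (fun b x H n => dvdMl b (H n)).
have /pP Hp : exists b, p = b * p by exists 1; rewrite mul1r.
have [p' p'E] := (pP p).1 Hp.
have [b bE] := Hp 1%N; rewrite expr1 in bE.
have /pP [c cE] : forall n, dvd n b.
  move=> n; have [d dE] := Hp n.+1; exists d.
  by apply: (mulIf unif_neq0); rewrite -bE dE exprSr mulrA.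
have p0 : p = 0.
  have : p * (1 - c * unif) = 0.
    by rewrite mulrBr mulr1 mulrCA mulrA -cE -bE subrr.
  move/eqP; rewrite mulf_eq0 => /orP[/eqP //|/eqP E].
  have : 1 - c * unif \is a GRing.unit.
    by apply: unitrD_nunit; rewrite ?unitr1 // unitrN; apply/nunitP; exists c.
  by rewrite E unitr0.
by move=> /pP [d ->]; rewrite p0 mulr0.
Qed.

Lemma unif_decomp x : x != 0 ->
  exists n, exists2 u, u \is a GRing.unit & x = u * unif ^+ n.
Proof.
move=> x0; have [m Hm] : exists m, ~ dvd m x.
  by apply: contrapT => H; case/eqP: x0; apply: unif_sep => n;
    apply: contrapT => Hn; apply: H; exists n.
elim: m x x0 Hm => [|m IH] x x0 Hm.
  by case: Hm; exists x; rewrite expr0 mulr1.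
have [xU|/nunitP [y yE]] := boolP (x \is a GRing.unit).
  by exists 0%N; exists x; rewrite ?expr0 ?mulr1.
have y0 : y != 0 by apply: contraNneq x0 => y0; rewrite yE y0 mul0r.
have [|n [u uU uE]] := IH y y0.
  by apply: contra_not Hm => -[b bE]; exists b; rewrite yE bE exprSr mulrA.
by exists n.+1; exists u => //; rewrite yE uE exprSr mulrA.
Qed.

Lemma dvdX n u m : u \is a GRing.unit -> dvd m (u * unif ^+ n) <-> (m <= n)%N.
Proof.
move=> uU; split=> [[b]|mn]; last by apply: (dvdW mn); exists u.
case: leqP => // nm; rewrite -(subnK (ltnW nm)) exprD mulrA.
move/(mulIf (expf_neq0 _ unif_neq0)) => uE.
move: uU; rewrite uE unitrM unitrX_pos ?subn_gt0 //.
by rewrite (negPf unif_nunit) andbF.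
Qed.

End Valuation.

(** * Crossed products *)

Section CrossedRing.
Variables (gT : finGroupType) (A : comUnitRingType) (a : ring_action gT A).
Variable f : cocycle a.
Implicit Types (x y z : crossed f) (g h k : gT) (s t : A).

Local Notation U := (crossed_U f).

Lemma cocycle_unit g h : f g h \is a GRing.unit.
Proof. by have [] := cocycleP f. Qed.

Lemma cocycle1l g : f 1%g g = 1.
Proof. by have [_ /(_ g)[]] := cocycleP f. Qed.

Lemma cocycle1r g : f g 1%g = 1.
Proof. by have [_ /(_ g)[]] := cocycleP f. Qed.

Lemma cocycleE g h k : a g (f h k) * f g (h * k)%g = f g h * f (g * h)%g k.
Proof. by have [_ _] := cocycleP f. Qed.

Lemma ractME g h s : a (g * h)%g s = a g (a h s).
Proof. exact: ractM. Qed.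

Lemma ractVK g : cancel (a g) (a g^-1%g).
Proof. by move=> s; rewrite -[LHS]/((a g^-1%g \o a g) s) -ractM mulVg ract1. Qed.

Lemma ractKV g : cancel (a g^-1%g) (a g).
Proof. by move=> s; rewrite -[LHS]/((a g \o a g^-1%g) s) -ractM mulgV ract1. Qed.

Lemma crossed_mulE x y k :
  (x * y) k = \sum_g x g * a g (y (g^-1 * k)%g) * f g (g^-1 * k)%g.
Proof. by rewrite ffunE. Qed.

Lemma crossed_addE x y k : (x + y) k = x k + y k.
Proof. by rewrite ffunE. Qed.

Lemma crossed_oppE x k : (- x) k = - x k.
Proof. by rewrite ffunE. Qed.

Lemma crossed_subE x y k : (x - y) k = x k - y k.
Proof. by rewrite crossed_addE crossed_oppE. Qed.

Lemma crossed_0E k : (0 : crossed f) k = 0.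
Proof. by rewrite ffunE. Qed.

Lemma crossed_sumE (I : Type) (r : seq I) (P : pred I) (F : I -> crossed f) k :
  (\sum_(i <- r | P i) F i) k = \sum_(i <- r | P i) F i k.
Proof.
by elim/big_ind2: _ => [|x s y t <- <-|//]; rewrite ?crossed_0E ?crossed_addE.
Qed.

Lemma crossed_UE g s h : U g s h = if h == g then s else 0.
Proof. by rewrite ffunE. Qed.

Lemma crossed_1E h : (1 : crossed f) h = if h == 1%g then 1 else 0.
Proof. exact: crossed_UE. Qed.

Lemma crossed_UU g h s t : U g s * U h t = U (g * h)%g (s * a g t * f g h).
Proof. exact: crossed_UM. Qed.

Lemma crossed_U_mulE g s x k :
  (U g s * x) k = s * a g (x (g^-1 * k)%g) * f g (g^-1 * k)%g.
Proof.
rewrite crossed_mulE (bigD1 g) //= big1 ?addr0 => [|h /negPf hg].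
  by rewrite crossed_UE eqxx.
by rewrite crossed_UE hg !mul0r.
Qed.

Lemma crossed_mul_UE x h t k :
  (x * U h t) k = x (k * h^-1)%g * a (k * h^-1)%g t * f (k * h^-1)%g h.
Proof.
rewrite crossed_mulE (bigD1 (k * h^-1)%g) //= big1 ?addr0 => [|g gh].
  by rewrite invMg invgK mulgKV crossed_UE eqxx.
rewrite crossed_UE; case: eqP => [E|_]; last by rewrite rmorph0 mulr0 mul0r.
by case/eqP: gh; rewrite -E invMg invgK mulKVg.
Qed.

Lemma crossed_U1_mulE s x k : (U 1%g s * x) k = s * x k.
Proof. by rewrite crossed_U_mulE invg1 mul1g cocycle1l mulr1 ract1. Qed.

Lemma crossed_mul_U1E x t k : (x * U 1%g t) k = x k * a k t.
Proof. by rewrite crossed_mul_UE invg1 mulg1 cocycle1r mulr1. Qed.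

Lemma crossed_U_sum x : x = \sum_g U g (x g).
Proof.
apply/ffunP => k; rewrite crossed_sumE (bigD1 k) //= big1 ?addr0 => [|g gk].
  by rewrite crossed_UE eqxx.
by rewrite crossed_UE eq_sym (negPf gk).
Qed.

Lemma crossed_U0 g : U g 0 = 0.
Proof. by apply/ffunP => k; rewrite crossed_UE crossed_0E if_same. Qed.

Lemma crossed_UD g s t : U g (s + t) = U g s + U g t.
Proof.
apply/ffunP => k; rewrite crossed_addE !crossed_UE.
by case: eqP; rewrite ?addr0.
Qed.

Definition Uinv g : crossed f := U g^-1%g (f g^-1%g g)^-1.

Lemma mulUinv g : U g 1 * Uinv g = 1.
Proof.
rewrite crossed_UU mulgV mul1r rmorphV ?cocycle_unit //.
have := cocycleE g g^-1%g g; rewrite mulgV mulVg cocycle1l cocycle1r !mulr1 => ->.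
by rewrite mulVr ?cocycle_unit.
Qed.

Lemma mulUinvV g : Uinv g * U g 1 = 1.
Proof. by rewrite crossed_UU mulVg rmorph1 mulr1 mulVr ?cocycle_unit. Qed.

Lemma crossed_U1K s t : U 1%g s * U 1%g t = U 1%g (s * t).
Proof. by rewrite crossed_UU mulg1 ract1 cocycle1l mulr1. Qed.

Lemma crossed_U_scale g s : U g s = U 1%g s * U g 1.
Proof. by rewrite crossed_UU mul1g rmorph1 mulr1 cocycle1l mulr1. Qed.

Section Support.
Variable W : {group gT}.

Definition supported x : Prop := forall g, g \notin W -> x g = 0.

Lemma supported0 : supported 0.
Proof. by move=> g _; rewrite crossed_0E. Qed.

Lemma supportedU g s : g \in W -> supported (U g s).
Proof. by move=> gW h; rewrite crossed_UE; case: eqP => // ->; rewrite gW. Qed.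

Lemma supported1 : supported 1.
Proof. exact: supportedU. Qed.

Lemma supportedD x y : supported x -> supported y -> supported (x + y).
Proof. by move=> sx sy g gW; rewrite crossed_addE sx ?sy ?addr0. Qed.

Lemma supportedN x : supported x -> supported (- x).
Proof. by move=> sx g gW; rewrite crossed_oppE sx ?oppr0. Qed.

Lemma supportedB x y : supported x -> supported y -> supported (x - y).
Proof. by move=> sx sy; apply/supportedD/supportedN. Qed.

Lemma supportedM x y : supported x -> supported y -> supported (x * y).
Proof.
move=> sx sy k kW; rewrite crossed_mulE big1 // => g _.
have [gW|gW] := boolP (g \in W); last by rewrite sx // !mul0r.
by rewrite sy ?rmorph0 ?mulr0 ?mul0r // groupMl ?groupV.
Qed.

Lemma supportedX x n : supported x -> supported (x ^+ n).
Proof.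
move=> sx; elim: n => [|n IH]; first exact: supported1.
by rewrite exprS; apply: supportedM.
Qed.

(** This projection is linear on both sides over the crossed product of [W] ([restrictMl],
    [restrictMr]), so identities in the large ring can be read in the small one. *)
Definition restrict x : crossed f := [ffun g => if g \in W then x g else 0].

Lemma restrictE x g : restrict x g = if g \in W then x g else 0.
Proof. by rewrite ffunE. Qed.

Lemma supported_restrict x : supported (restrict x).
Proof. by move=> g /negPf gW; rewrite restrictE gW. Qed.

Lemma restrict_id x : supported x -> restrict x = x.
Proof. by move=> sx; apply/ffunP => g; rewrite restrictE; case: ifPn => // /sx. Qed.

Lemma restrictD x y : restrict (x + y) = restrict x + restrict y.
Proof.
apply/ffunP => g; rewrite crossed_addE !restrictE crossed_addE.
by case: ifP; rewrite ?addr0.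
Qed.

Lemma restrict0 : restrict 0 = 0.
Proof. exact: restrict_id supported0. Qed.

Lemma restrictMr x y : supported y -> restrict (x * y) = restrict x * y.
Proof.
move=> sy; apply/ffunP => k; rewrite restrictE !crossed_mulE.
case: ifPn => kW; last (rewrite big1 // => g _).
  apply: eq_bigr => g _; rewrite restrictE; case: ifPn => // gW.
  by rewrite sy ?rmorph0 ?mulr0 ?mul0r // groupMr // groupV.
rewrite restrictE; case: ifPn => gW; last by rewrite !mul0r.
by rewrite sy ?rmorph0 ?mulr0 ?mul0r // groupMl ?groupV.
Qed.

Lemma restrictMl x y : supported x -> restrict (x * y) = x * restrict y.
Proof.
move=> sx; apply/ffunP => k; rewrite restrictE !crossed_mulE.
case: ifPn => kW; last (rewrite big1 // => g _).
  apply: eq_bigr => g _; have [gW|gW] := boolP (g \in W).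
    by rewrite restrictE groupMl ?groupV // kW.
  by rewrite sx ?mul0r.
have [gW|gW] := boolP (g \in W); last by rewrite sx ?mul0r.
by rewrite restrictE groupMl ?groupV // (negPf kW) rmorph0 mulr0 mul0r.
Qed.

Lemma restrictJ g x : (W <| [set: gT])%g ->
  restrict (U g 1 * x * Uinv g) = U g 1 * restrict x * Uinv g.
Proof.
move=> nW; apply/ffunP => k; rewrite restrictE !crossed_mul_UE !crossed_U_mulE.
rewrite restrictE !invgK.
have -> : ((g^-1 * (k * g))%g \in W) = (k \in W).
  by rewrite -conjgE memJ_norm // (fintype.subsetP (normal_norm nW)) // inE.
by case: ifP => // _; rewrite rmorph0 mulr0 !mul0r.
Qed.

Local Notation n := #|W|.

(** The matrix of right multiplication on the crossed product of [W]. Right multiplication is used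
    because it is linear over [A] acting on the left, whereas left multiplication is only
    semilinear. *)
Definition rmul_mx x : 'M[A]_n :=
  \matrix_(i, j) (a (enum_val i) (x ((enum_val i)^-1 * enum_val j)%g) *
                  f (enum_val i) ((enum_val i)^-1 * enum_val j)%g).

Definition coef_row x : 'rV[A]_n := \row_j x (enum_val j).

Lemma coef_rowM x y : supported x ->
  coef_row (x * y) = coef_row x *m rmul_mx y.
Proof.
move=> sx; apply/rowP => j; rewrite !mxE crossed_mulE (bigID (mem W)) /=.
rewrite [X in _ + X]big1 ?addr0 => [|g gW]; last by rewrite sx ?mul0r.
rewrite big_enum_val; apply: eq_bigr => i _.
by rewrite !mxE mulrA.
Qed.

Lemma coef_row_inj x y : supported x -> supported y ->
  coef_row x = coef_row y -> x = y.
Proof.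
move=> sx sy E; apply/ffunP => g; have [gW|gW] := boolP (g \in W); last by rewrite sx ?sy.
by move/rowP/(_ (enum_rank_in gW g)): E; rewrite !mxE enum_rankK_in.
Qed.

Lemma coef_row_onto (v : 'rV[A]_n) : exists2 x, supported x & coef_row x = v.
Proof.
exists [ffun g => \sum_i v 0 i *+ (g == enum_val i)].
  move=> g gW; rewrite ffunE big1 // => i _.
  by case: eqP => // E; rewrite E enum_valP in gW.
apply/rowP => j; rewrite !mxE ffunE (bigD1 j) //= eqxx mulr1n big1 ?addr0 // => i ij.
by rewrite (inj_eq enum_val_inj) eq_sym (negPf ij).
Qed.

Lemma row_rmul_mx x i : row i (rmul_mx x) = coef_row (U (enum_val i) 1 * x).
Proof. by apply/rowP => j; rewrite !mxE crossed_U_mulE mul1r. Qed.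

Lemma rmul_mxM x y : supported x -> rmul_mx (x * y) = rmul_mx x *m rmul_mx y.
Proof.
move=> sx; apply/row_matrixP => i; rewrite row_mul !row_rmul_mx mulrA coef_rowM //.
by apply: supportedM => //; apply: supportedU; apply: enum_valP.
Qed.

Lemma rmul_mx1 : rmul_mx 1 = 1%:M.
Proof.
apply/matrixP => i j; rewrite !mxE crossed_1E -eq_mulVg1 (inj_eq enum_val_inj).
case: eqP => [->|].
  by rewrite mulVg rmorph1 cocycle1r mulr1.
by rewrite rmorph0 mul0r.
Qed.

Lemma supported_inv x : supported x -> rmul_mx x \in unitmx ->
  exists y, [/\ supported y, x * y = 1 & y * x = 1].
Proof.
move=> sx xU.
have [y sy yE] := coef_row_onto (coef_row 1 *m invmx (rmul_mx x)).
have yx : y * x = 1.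
  apply: coef_row_inj; [exact: supportedM|exact: supported1|].
  by rewrite coef_rowM // yE -mulmxA mulVmx ?mulmx1.
exists y; split=> //; apply: coef_row_inj; [exact: supportedM|exact: supported1|].
have: coef_row (x * y * x) = coef_row (1 * x) by rewrite -mulrA yx mulr1 mul1r.
rewrite [LHS]coef_rowM ?[RHS]coef_rowM; [|exact: supported1|exact: supportedM].
by move/(congr1 (mulmx^~ (invmx (rmul_mx x)))); rewrite -!mulmxA mulmxV ?mulmx1.
Qed.

Lemma unitmx_rmul x y : supported x -> supported y -> x * y = 1 ->
  rmul_mx x \in unitmx.
Proof.
move=> sx sy xy; have := rmul_mxM y sx; rewrite xy rmul_mx1.
by move/esym/mulmx1_unit => [].
Qed.

(** Left multiplication by [U k 1] commutes with right multiplication by [x] and is semilinear along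
    [a k]; in coordinates it is the monomial matrix given by [D] and [s]. Hence the determinant is
    invariant under [W]. *)
Lemma map_rmul_mx x k : k \in W ->
  exists2 D : 'M[A]_n, D \in unitmx &
  exists s : 'S_n, map_mx (a k) (rmul_mx x) *m D = D *m row_perm s (col_perm s (rmul_mx x)).
Proof.
move=> kW; pose rk (i : 'I_n) : 'I_n := enum_rank_in (group1 W) (k * enum_val i)%g.
have rkE i : enum_val (rk i) = (k * enum_val i)%g.
  by rewrite enum_rankK_in // groupM // enum_valP.
have rk_inj : injective rk.
  by move=> i j /(congr1 enum_val); rewrite !rkE => /mulgI/enum_val_inj.
exists (diag_mx (\row_i f k (enum_val i))).
  by rewrite unitmxE det_diag rpred_prod // => i _; rewrite mxE cocycle_unit.
exists (perm rk_inj); apply/matrixP => i j.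
rewrite mul_mx_diag mul_diag_mx !mxE !permE !rkE rmorphM.
set u := enum_val i; set v := enum_val j.
have -> : ((k * u)^-1 * (k * v) = u^-1 * v)%g by rewrite invMg -!mulgA mulKg.
rewrite ractM /= [RHS]mulrCA -cocycleE mulKVg.
by rewrite mulrA.
Qed.

Lemma ract_det_rmul x k : k \in W -> a k (\det (rmul_mx x)) = \det (rmul_mx x).
Proof.
move=> kW; have [D DU [s E]] := map_rmul_mx x kW.
move/(congr1 determinant): E; rewrite !det_mulmx det_map_mx mulrC.
rewrite row_permE col_permE !det_mulmx !det_perm odd_permV.
rewrite [_ * (-1) ^+ s]mulrC [(-1) ^+ s * (_ * _)]mulrA -expr2 sqrr_sign mul1r.
by apply: mulrI; rewrite -unitmxE.
Qed.

End Support.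

End CrossedRing.

Section CrossedMap.
Variables (gT : finGroupType) (A A' : comUnitRingType).
Variables (a : ring_action gT A) (a' : ring_action gT A').
Variables (f : cocycle a) (f' : cocycle a') (phi : {rmorphism A -> A'}).
Hypothesis phi_act : forall g s, phi (a g s) = a' g (phi s).
Hypothesis phi_f : forall g h, phi (f g h) = f' g h.

Definition crossed_map (x : crossed f) : crossed f' := [ffun g => phi (x g)].

Lemma crossed_mapE x g : crossed_map x g = phi (x g).
Proof. by rewrite ffunE. Qed.

Lemma crossed_mapB x y : crossed_map (x - y) = crossed_map x - crossed_map y.
Proof. by apply/ffunP => g; rewrite crossed_subE !crossed_mapE crossed_subE rmorphB. Qed.

Lemma crossed_mapD x y : crossed_map (x + y) = crossed_map x + crossed_map y.
Proof. by apply/ffunP => g; rewrite crossed_addE !crossed_mapE crossed_addE rmorphD. Qed.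

Lemma crossed_map0 : crossed_map 0 = 0.
Proof. by rewrite -(subrr 0) crossed_mapB subrr. Qed.

Lemma crossed_mapU g s : crossed_map (crossed_U f g s) = crossed_U f' g (phi s).
Proof.
by apply/ffunP => h; rewrite crossed_mapE !crossed_UE (fun_if phi) rmorph0.
Qed.

Lemma crossed_map1 : crossed_map 1 = 1.
Proof. by rewrite [LHS]crossed_mapU rmorph1. Qed.

Lemma crossed_mapM x y : crossed_map (x * y) = crossed_map x * crossed_map y.
Proof.
apply/ffunP => k; rewrite crossed_mapE !crossed_mulE rmorph_sum.
by apply: eq_bigr => g _; rewrite !rmorphM phi_act phi_f !crossed_mapE.
Qed.

Lemma supported_crossed_map (W : {group gT}) x :
  supported W x -> supported W (crossed_map x).
Proof. by move=> sx g gW; rewrite crossed_mapE sx ?rmorph0. Qed.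

Lemma crossed_map_restrict (W : {group gT}) x :
  crossed_map (restrict W x) = restrict W (crossed_map x).
Proof.
by apply/ffunP => g; rewrite crossed_mapE !restrictE crossed_mapE (fun_if phi) rmorph0.
Qed.

Lemma map_rmul_crossed_map (W : {group gT}) x :
  rmul_mx W (crossed_map x) = map_mx phi (rmul_mx W x).
Proof.
by apply/matrixP => i j; rewrite !mxE rmorphM phi_act phi_f crossed_mapE.
Qed.

End CrossedMap.

(** * Wild inertia *)

Section Ramification.
Variables (S : dvrType) (gT : finGroupType) (a : ring_action gT S).
Implicit Types (g h : gT) (s t : S).

Local Notation k := (residue S).
Local Notation res := (@residue_map S).
Local Notation ak := (residue_act a).
Local Notation p := (unif S).

Lemma res_act g s : ak g (res s) = res (a g s).
Proof. exact: residue_act_funE. Qed.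

Lemma res_onto (y : k) : exists s, res s = y.
Proof. by exists (repr y); apply: residue_mapK. Qed.

Lemma res_eq0 s : res s = 0 <-> dvd 1 s.
Proof. by rewrite dvd1P -residue_map_eq0; split => /eqP. Qed.

Lemma res_eq s t : res s = res t <-> dvd 1 (s - t).
Proof.
rewrite -res_eq0 rmorphB; split=> [E|/eqP]; last by rewrite subr_eq0 => /eqP.
by apply/eqP; rewrite subr_eq0; apply/eqP.
Qed.

Lemma res_neq0 s : (res s != 0) = (s \is a GRing.unit).
Proof. by rewrite residue_map_eq0 negbK. Qed.

Lemma ract_unit g s : (a g s \is a GRing.unit) = (s \is a GRing.unit).
Proof.
apply/idP/idP; last exact: rmorph_unit.
by move=> /(rmorph_unit (a g^-1%g)); rewrite ractVK.
Qed.

Lemma ract_unifP g : exists c, a g p = c * p.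
Proof. by apply/nunitP; rewrite ract_unit unif_nunit. Qed.

Definition uratio g : S := sval (cid (ract_unifP g)).
(** A crossed homomorphism on the whole group; on the inertia group it is a genuine character, with
    kernel [wild]. *)
Definition tame_char g : k := res (uratio g).
Local Notation chi := tame_char.

Lemma ract_unif g : a g p = uratio g * p.
Proof. by rewrite /uratio; case: cid. Qed.

Lemma uratioM g h : uratio (g * h)%g = uratio g * a g (uratio h).
Proof.
apply: (mulIf (unif_neq0 S)); rewrite -ract_unif ractME ract_unif rmorphM.
by rewrite ract_unif mulrCA mulrA.
Qed.

Lemma uratio1 : uratio 1%g = 1.
Proof. by apply: (mulIf (unif_neq0 S)); rewrite -ract_unif ract1 mul1r. Qed.

Lemma uratio_unit g : uratio g \is a GRing.unit.
Proof.
have := uratioM g g^-1%g; rewrite mulgV uratio1 => /esym E.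
by apply/unitrPr; exists (a g (uratio g^-1%g)).
Qed.

Lemma chi_neq0 g : chi g != 0. Proof. by rewrite res_neq0 uratio_unit. Qed.

Lemma chiM g h : chi (g * h)%g = chi g * ak g (chi h).
Proof. by rewrite /chi uratioM rmorphM res_act. Qed.

Lemma chi1 : chi 1%g = 1. Proof. by rewrite /chi uratio1 rmorph1. Qed.

Lemma dvd_act g n s : dvd n s -> dvd n (a g s).
Proof.
move=> [b ->]; rewrite rmorphM rmorphXn /= ract_unif exprMn mulrA.
by eexists.
Qed.

Lemma inertiaP g : reflect (forall y, ak g y = y) (g \in inertia a).
Proof. by rewrite inE; apply: asboolP. Qed.

Lemma inertia_group_set : group_set (inertia a).
Proof.
apply/group_setP; split=> [|g h /inertiaP gI /inertiaP hI]; apply/inertiaP => y.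
  exact: ract1.
by rewrite ractME hI gI.
Qed.
Canonical inertia_group := Group inertia_group_set.

Lemma inertiaJ g h : g \in inertia a -> (h * g * h^-1)%g \in inertia a.
Proof.
by move=> /inertiaP gI; apply/inertiaP => y; rewrite !ractME gI ractKV.
Qed.

Lemma chiM_inertia g h : g \in inertia a -> chi (g * h)%g = chi g * chi h.
Proof. by move=> /inertiaP gI; rewrite chiM gI. Qed.

Lemma chiX_inertia g n : g \in inertia a -> chi (g ^+ n)%g = chi g ^+ n.
Proof.
move=> gI; elim: n => [|n IH]; first by rewrite expg0 chi1.
by rewrite expgS chiM_inertia // IH exprS.
Qed.

Lemma chiJ g h : g \in inertia a -> chi (h * g * h^-1)%g = ak h (chi g).
Proof.
move=> /inertiaP gI; rewrite !chiM !ractME gI mulrAC -chiM mulgV chi1.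
by rewrite mul1r.
Qed.

Definition wild : {set gT} := [set g in inertia a | chi g == 1].

Lemma wildP g : reflect (g \in inertia a /\ chi g = 1) (g \in wild).
Proof.
by rewrite [g \in wild]inE; apply: (iffP andP) => -[gI /eqP].
Qed.

Lemma wild_group_set : group_set wild.
Proof.
apply/group_setP; split=> [|g h /wildP[gI g1] /wildP[hI h1]]; apply/wildP.
  by rewrite group1 chi1.
by rewrite groupM // chiM_inertia // g1 h1 mulr1.
Qed.
Canonical wild_group := Group wild_group_set.

Lemma wildJ g h : g \in wild -> (h * g * h^-1)%g \in wild.
Proof.
by move=> /wildP[gI g1]; apply/wildP; rewrite inertiaJ // chiJ // g1 rmorph1.
Qed.

Lemma wild_normal : (wild <| [set: gT])%g.
Proof.
rewrite /normal subsetT; apply/fintype.subsetP => h _; rewrite inE.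
apply/fintype.subsetP => _ /imsetP[g gW ->].
by have := wildJ h^-1 gW; rewrite invgK conjgE mulgA.
Qed.

Lemma wild_inertia g : g \in wild -> g \in inertia a.
Proof. by case/wildP. Qed.

Hypothesis a_faithful : forall g, a g =1 id -> g = 1%g.

(** Take [g] in [W] of order [l]. If [g] moves everything by multiples of [p ^+ n], then modulo
    [p ^+ n.+1] the displacement by [g ^+ i] is [i] times that by [g]; at [i = l] it is zero. Were
    [l] invertible, [g] would act trivially modulo every power of [p]. *)
Lemma wild_prime_char l : prime l -> (l %| #|wild|)%N -> l%:R = 0 :> k.
Proof.
move=> lp /(Cauchy lp) [g gW ord].
apply/eqP; apply: contraT => l0.
have [gI g1] := wildP _ gW.
suff H n s : dvd n (a g s - s).
  have g1' : g = 1%g by apply: a_faithful => s; apply/eqP; rewrite -subr_eq0;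
    apply/eqP/unif_sep => n; apply: H.
  by move: lp; rewrite -ord g1' order1.
elim: n s => [|n IH] s; first by exists (a g s - s); rewrite expr0 mulr1.
(* The case [n = 0] comes directly from inertia; [dd] needs [n] positive to make [a g z - z]
   divisible by [p]. *)
have [->|n0] := posnP n.
  by apply/res_eq; rewrite -res_act; have /inertiaP := gI.
have dd t : dvd n t -> dvd n.+1 (a g t - t).
  move=> [z ->]; rewrite rmorphM rmorphXn /= ract_unif exprMn.
  have -> : a g z * (uratio g ^+ n * p ^+ n) - z * p ^+ n =
     ((a g z - z) * uratio g ^+ n + z * (uratio g ^+ n - 1)) * p ^+ n.
    by rewrite !mulrBl mulrBr mulr1 addrA subrK mulrBl mulrA.
  rewrite -[n.+1]add1n; apply: dvdM; last by exists 1; rewrite mul1r.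
  apply: dvdD; first by apply: dvdMr; apply: dvdW (IH z).
  apply: dvdMl; rewrite -res_eq0 rmorphB rmorph1 rmorphXn /=.
  by rewrite -/(chi g) g1 expr1n subrr.
have step i : dvd n.+1 (a (g ^+ i)%g s - s - (a g s - s) *+ i).
  elim: i => [|i IHi]; first by rewrite expg0 ract1 subrr mulr0n subr0; apply: dvd0.
  set d := a g s - s in IHi *.
  have dn : dvd n d by apply: IH.
  have di : dvd n.+1 (a (g ^+ i)%g d - d).
    elim: i {IHi} => [|i IHi]; first by rewrite expg0 ract1 subrr; apply: dvd0.
    rewrite expgS ractME.
    have -> : a g (a (g ^+ i)%g d) - d = a g (a (g ^+ i)%g d - d) + (a g d - d).
      by rewrite rmorphB addrA subrK.
    by apply: dvdD; [apply: dvd_act | apply: dd].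
  have -> : a (g ^+ i.+1)%g s - s - d *+ i.+1 =
      (a (g ^+ i)%g s - s - d *+ i) + (a (g ^+ i)%g d - d).
    rewrite expgSr ractME.
    have -> : a g s = d + s by rewrite subrK.
    rewrite rmorphD mulrSr; move: (a _ d) (a _ s) => u v.
    rewrite opprD !addrA; congr (_ - _).
    by rewrite -!addrA addrC -!addrA.
  exact: dvdD.
have := step l; rewrite -ord expg_order ract1 subrr sub0r => /dvdN.
rewrite opprK ord -mulr_natr => -[b bE].
have lU : l%:R \is a @GRing.unit S by rewrite -res_neq0 rmorph_nat.
by exists (b * l%:R^-1); rewrite mulrAC -bE mulrK.
Qed.

Lemma wild_pnat : ([pchar k].-nat #|wild|)%N.
Proof.
apply/pnatP => // l lp lW; rewrite !inE lp /=; apply/eqP.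
exact: wild_prime_char.
Qed.

End Ramification.

(** * Twisted group algebras of p-groups in characteristic p *)

Section TrivialAction.
Variables (gT : finGroupType) (k : fieldType) (b : ring_action gT k).
Variables (f : cocycle b) (W : {group gT}).
Hypothesis bW : forall g, g \in W -> b g =1 id.
Hypothesis Wchar : ([pchar k].-nat #|W|)%N.
Implicit Types (x y : crossed f) (g h : gT) (s : k).

Local Notation q := #|W|.
Local Notation U := (crossed_U f).

Lemma exp0q : 0 ^+ q = 0 :> k.
Proof. by rewrite expr0n gtn_eqF ?cardG_gt0. Qed.

Lemma expq_sum (I : finType) (P : pred I) (F : I -> k) :
  (\sum_(i | P i) F i) ^+ q = \sum_(i | P i) F i ^+ q.
Proof.
apply: (big_morph (fun x : k => x ^+ q)) => [x y|]; first exact: exprDn_pchar.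
exact: exp0q.
Qed.

Definition wtau g : k := \prod_(h in W) f g h.

(** Multiplying the cocycle identity over its last argument shows that the [q]-th power of [f] on
    [W] is the coboundary of [wtau]: the order of [W] kills its second cohomology. *)
Lemma wtauM g h : g \in W -> h \in W ->
  f g h ^+ q * wtau (g * h)%g = wtau g * wtau h.
Proof.
move=> gW hW; have -> : f g h ^+ q = \prod_(l in W) f g h by rewrite prodr_const.
rewrite -big_split /= [RHS]mulrC.
have -> : wtau g = \prod_(l in W) f g (h * l)%g.
  rewrite /wtau (reindex_inj (mulgI h)) /=.
  by apply: eq_bigl => l; rewrite groupMl.
by rewrite -big_split /=; apply: eq_bigr => l lW; rewrite -cocycleE bW.
Qed.

Lemma wtau_neq0 g : wtau g != 0.
Proof.
by apply/prodf_neq0 => h _; rewrite -unitfE cocycle_unit.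
Qed.

Lemma wtau1 : wtau 1%g = 1.
Proof. by rewrite /wtau big1 // => h _; rewrite cocycle1l. Qed.

(* [U_g |-> tau(g)^(1/q)] splits the cocycle on [W] over the perfect closure;
   this is the [q]-th power of the resulting augmentation map. *)
Definition aug x : k := \sum_(g in W) x g ^+ q * wtau g.

Lemma augD x y : aug (x + y) = aug x + aug y.
Proof.
rewrite /aug -big_split /=; apply: eq_bigr => g _.
by rewrite crossed_addE exprDn_pchar // mulrDl.
Qed.

Lemma aug0 : aug 0 = 0.
Proof.
rewrite /aug big1 // => g _; rewrite crossed_0E exp0q.
exact: mul0r.
Qed.

Lemma augN x : aug (- x) = - aug x.
Proof. by apply/eqP; rewrite -addr_eq0 -augD addNr aug0. Qed.

Lemma augB x y : aug (x - y) = aug x - aug y.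
Proof. by rewrite augD augN. Qed.

Lemma augU g s : g \in W -> aug (U g s) = s ^+ q * wtau g.
Proof.
move=> gW; rewrite /aug (bigD1 g) //= crossed_UE eqxx big1 ?addr0 // => h /andP[_ hg].
by rewrite crossed_UE (negPf hg) exp0q mul0r.
Qed.

Lemma aug1 : aug 1 = 1.
Proof. by rewrite augU // wtau1 expr1n mulr1. Qed.

Lemma augM x y : supported W x -> supported W y -> aug (x * y) = aug x * aug y.
Proof.
move=> sx sy; rewrite /aug mulr_suml.
transitivity (\sum_(l in W) \sum_(g in W)
   x g ^+ q * y (g^-1 * l)%g ^+ q * (f g (g^-1 * l)%g ^+ q * wtau l)).
  apply: eq_bigr => l lW; rewrite crossed_mulE (bigID (mem W)) /=.
  rewrite [X in _ + X]big1 ?addr0 => [|g gW]; last by rewrite sx ?mul0r.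
  rewrite expq_sum mulr_suml; apply: eq_bigr => g gW.
  by rewrite bW // !exprMn !mulrA.
rewrite exchange_big; apply: eq_bigr => g gW /=.
rewrite (reindex_inj (mulgI g)) mulr_sumr /=.
apply: eq_big => [l|l]; first by rewrite groupMl.
rewrite groupMl // => lW; rewrite mulKg wtauM //.
by rewrite -!mulrA; congr (_ * _); rewrite mulrCA.
Qed.

Lemma wtrans_repr : mx_repr W (fun h => \matrix_(i < q, j < q)
   ((enum_val j == (h^-1 * enum_val i)%g) %:R : k)).
Proof.
split=> [|g h gW hW]; apply/matrixP => i j; rewrite !mxE.
  by rewrite invg1 mul1g (inj_eq enum_val_inj) eq_sym.
pose l := enum_rank_in (group1 W) (g^-1 * enum_val i)%g.
have lE : enum_val l = (g^-1 * enum_val i)%g.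
  by rewrite enum_rankK_in // groupM ?groupV // enum_valP.
rewrite (bigD1 l) //= !mxE lE eqxx mul1r big1 ?addr0 => [|m ml].
  by rewrite invMg mulgA.
by rewrite !mxE -lE (inj_eq enum_val_inj) (negPf ml) mul0r.
Qed.

(** Raising a relation [v *m rmul_mx W x = 0] to the [q]-th power, entry by entry, turns it into a
    relation in the untwisted group algebra. There the kernel is stable under [W], hence contains a
    nonzero constant vector, and on constant vectors the matrix acts through [aug x]. *)
Lemma aug_unit x : supported W x -> aug x != 0 -> rmul_mx W x \in unitmx.
Proof.
move=> sx; apply: contraNT => nU.
have [v v0 vM] : exists2 v : 'rV_q, v != 0 & v *m rmul_mx W x = 0.
  have : kermx (rmul_mx W x) != 0.
    by rewrite kermx_eq0; move: nU; rewrite -row_free_unit.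
  case/rowV0Pn => v vK v0; exists v => //; exact/sub_kermxP.
(* The matrix, in the untwisted group algebra, of the element with coefficients [x g ^+ q * wtau g];
   the factor [wtau] absorbs the cocycle. *)
pose N : 'M[k]_q := \matrix_(i, j)
  (x ((enum_val i)^-1 * enum_val j)%g ^+ q * wtau ((enum_val i)^-1 * enum_val j)%g).
have W1 (i j : 'I_q) : ((enum_val i)^-1 * enum_val j)%g \in W.
  by rewrite groupM ?groupV ?enum_valP.
pose w : 'rV_q := \row_i (v 0 i ^+ q * wtau (enum_val i)).
have w0 : w != 0.
  apply: contraNneq v0 => w0; apply/eqP/rowP => i; rewrite mxE.
  move/rowP/(_ i): w0; rewrite !mxE => /eqP.
  by rewrite mulf_eq0 (negPf (wtau_neq0 _)) orbF expf_eq0 => /andP[_ /eqP].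
have wN : w *m N = 0.
  apply/rowP => j; rewrite !mxE.
  transitivity ((\sum_i v 0 i * rmul_mx W x i j) ^+ q * wtau (enum_val j)).
    rewrite expq_sum mulr_suml; apply: eq_bigr => i _.
    rewrite !mxE bW ?enum_valP // !exprMn -!mulrA; congr (_ * _).
    rewrite mulrCA; congr (_ * _); rewrite -wtauM ?mulKVg //; exact: enum_valP.
  move/rowP/(_ j): vM; rewrite !mxE => ->.
  by rewrite exp0q mul0r.
pose rG := MxRepresentation wtrans_repr.
have cN : centgmx rG N.
  apply/centgmxP => g gW; apply/matrixP => i j; rewrite !mxE.
  pose l := enum_rank_in (group1 W) (g^-1 * enum_val i)%g.
  have lE : enum_val l = (g^-1 * enum_val i)%g.
    by rewrite enum_rankK_in // groupM ?groupV // enum_valP.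
  pose m := enum_rank_in (group1 W) (g * enum_val j)%g.
  have mE : enum_val m = (g * enum_val j)%g.
    by rewrite enum_rankK_in // groupM // enum_valP.
  rewrite [RHS](bigD1 l) //= !mxE lE eqxx mul1r [X in _ + X]big1 ?addr0 => [|u ul].
    rewrite (bigD1 m) //= !mxE mE mulKg eqxx mulr1 big1 ?addr0 => [|u um].
      by rewrite invMg invgK mulgA.
    rewrite !mxE; case: eqP => [E|_]; last by rewrite mulr0.
    by case/eqP: um; apply: enum_val_inj; rewrite mE E mulKVg.
  by rewrite !mxE -lE (inj_eq enum_val_inj) (negPf ul) mul0r.
have [u u0 [uK uF]] : exists2 u : 'rV_q, u != 0 &
    u *m N = 0 /\ forall g, g \in W -> u *m rG g = u.
  have K0 : (0 < \rank (kermx N))%N.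
    rewrite lt0n mxrank_eq0; apply: contraNneq w0 => K0.
    by have : (w <= kermx N)%MS; [apply/sub_kermxP | rewrite K0 submx0].
  have modK := kermx_centg_module cN.
  have : (kermx N :&: rfix_mx rG W)%MS != 0.
    (* The fixed-point theorem for p-groups needs a prime divisor of [q]; for trivial [W] every
       vector is fixed. *)
    have [q1|q1] := leqP q 1.
      have WT : W :=: 1%g by apply/eqP; rewrite trivg_card_le1.
      apply/rowV0Pn; exists w => //; rewrite sub_capmx; apply/andP; split; first exact/sub_kermxP.
      apply/rfix_mxP => g gW; have -> : g = 1%g by apply/set1gP; rewrite -[[1 gT]%g]WT.
      by rewrite (repr_mx1 rG) mulmx1.
    have pp := pdiv_prime q1; have pW := pdiv_dvd q.
    have pk : pdiv q \in [pchar k] by apply: (pnatPpi Wchar); rewrite pi_pdiv.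
    have pWg : ((pdiv q).-group W)%g.
      rewrite /pgroup; apply: sub_in_pnat Wchar => l _ lk.
      by rewrite -(pcharf_eq pk).
    have := rfix_pgroup_pchar pk (submod_repr modK) K0 pWg (subxx _).
    apply: contraNneq => E; rewrite -mxrank_eq0 (rfix_submod modK) // E.
    by rewrite linear0 mxrank0.
  case/rowV0Pn => u; rewrite sub_capmx => /andP[/sub_kermxP uK /rfix_mxP uF] u0.
  by exists u.
have uconst i j : u 0 i = u 0 j.
  have gW : (enum_val i * (enum_val j)^-1)%g \in W by rewrite groupM ?groupV ?enum_valP.
  have /rowP/(_ j) := uF _ gW; rewrite !mxE (bigD1 i) //= !mxE big1 => [<-|m mi].
    by rewrite invMg invgK mulgKV eqxx mulr1 addr0.
  rewrite !mxE; case: eqP => [E|_]; last by rewrite mulr0.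
  case/eqP: mi; apply: enum_val_inj; apply: (mulgI (enum_val i)^-1%g).
  rewrite mulVg; apply: (mulgI (enum_val j)); rewrite mulg1 mulgA {2}E.
  by rewrite invMg invgK.
pose i0 := enum_rank_in (group1 W) 1%g.
have i0E : enum_val i0 = 1%g by rewrite enum_rankK_in.
have ui0 : u 0 i0 != 0.
  by apply: contraNneq u0 => E; apply/eqP/rowP => i; rewrite mxE (uconst i i0).
have /rowP/(_ i0) := uK; rewrite !mxE.
have -> : \sum_j u 0 j * N j i0 = u 0 i0 * aug x.
  rewrite mulr_sumr (reindex_inj invg_inj) /=.
  rewrite [RHS](eq_bigl [in W]) => [|g]; last by rewrite groupV.
  rewrite [RHS]big_enum_val; apply: eq_bigr => j _.
  by rewrite (uconst j i0) mxE i0E mulg1.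
by move/eqP; rewrite mulf_eq0 (negPf ui0).
Qed.

End TrivialAction.

(** The minimal polynomial [d] of [y] over [F] divides both [('X - y%:P) ^+ q] and the separable
    [u], so it is ['X - y%:P]. As [F] is only a predicate, [d] is taken monic of least degree, and
    its divisibility properties are obtained by cancelling leading terms. *)
Lemma separable_purely_insep (k : fieldType) (F : k -> Prop) (y : k) (q : nat)
    (u : {poly k}) :
  F 1 -> (forall s t, F s -> F t -> F (s - t)) ->
  (forall s t, F s -> F t -> F (s * t)) -> (forall s, F s -> F s^-1) ->
  ([pchar k].-nat q)%N -> F (y ^+ q) ->
  u != 0 -> (forall i, F u`_i) -> root u y -> separable_poly u -> F y.
Proof.
move=> F1 FB FM FV qp Fyq u0 Fu uy usep.
have F0 : F 0 by rewrite -(subrr 1); apply: FB.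
have FN s : F s -> F (- s) by move=> Fs; rewrite -sub0r; apply: FB.
pose D (v : {poly k}) := (forall i, F v`_i) /\ root v y.
have exn : exists n, `[< exists v, [/\ D v, v != 0 & size v = n] >].
  by exists (size u); apply/asboolP; exists u.
have [d [[Fd dy] dmon dmin]] : exists d, [/\ D d, d \is monic &
    forall v, D v -> v != 0 -> (size d <= size v)%N].
  case: (ex_minnP exn) => n /asboolP[v [[Fv vy] v0 <-]] nmin.
  have lv0 : lead_coef v != 0 by rewrite lead_coef_eq0.
  exists ((lead_coef v)^-1 *: v); split.
  - split; last by rewrite rootZ // invr_eq0.
    by move=> i; rewrite coefZ; apply: FM => //; apply: FV; rewrite lead_coefE.
  - by rewrite monicE lead_coefZ mulVf.
  - move=> w Dw w0; rewrite size_scale ?invr_eq0 //; apply: nmin.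
    by apply/asboolP; exists w.
have d0 := monic_neq0 dmon.
have dvd v : D v -> d %| v.
  have [n] := ubnP (size v); elim: n v => // n IH v; rewrite ltnS => vn [Fv vy].
  have [->|v0] := eqVneq v 0; first exact: dvdp0.
  have sdv : (size d <= size v)%N by apply: dmin.
  pose w := lead_coef v *: 'X^(size v - size d) * d.
  have -> : v = (v - w) + w by rewrite subrK.
  have dw : d %| w by rewrite dvdp_mull.
  apply: dvdp_add => //; apply: IH.
    have sv : (0 < size v)%N by rewrite size_poly_gt0.
    have sd : (0 < size d)%N by rewrite size_poly_gt0.
    have sw : size w = size v.
      rewrite /w -scalerAl size_scale ?lead_coef_eq0 // size_monicM ?monicXn //.
      by rewrite size_polyXn addSn /= subnK.
    apply: leq_trans vn; rewrite -(prednK sv) ltnS.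
    apply/leq_sizeP => j; rewrite leq_eqVlt => /orP[/eqP <-|jv].
      rewrite coefB -lead_coefE -sw -lead_coefE /w -scalerAl lead_coefZ.
      by rewrite lead_coef_Mmonic // lead_coefXn mulr1 subrr.
    have jv' : (size v <= j)%N by rewrite -(prednK sv).
    by rewrite coefB !nth_default ?sw ?subrr.
  split; last by rewrite /root hornerD hornerN hornerM (eqP dy) (eqP vy) mulr0 subrr.
  move=> i; rewrite coefB; apply: FB => //; rewrite /w -scalerAl coefZ coefXnM.
  by apply: FM; [rewrite lead_coefE | case: ifP].
have du : d %| u by apply: dvd.
have : d %| ('X - y%:P) ^+ q.
  have -> : ('X - y%:P) ^+ q = 'X^q - (y ^+ q)%:P :> {poly k}.
    rewrite exprDn_pchar; last by rewrite (eq_pnat _ (pchar_lalg _)).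
    congr (_ + _); apply/eqP; rewrite -addr_eq0 polyC_exp -exprDn_pchar.
      rewrite addNr expr0n gtn_eqF ?mulr0n ?eqxx //; by case/andP: qp.
    by rewrite (eq_pnat _ (pchar_lalg _)).
  apply: dvd; split; last by rewrite /root !hornerE subrr.
  move=> i; rewrite coefB coefXn coefC; apply: FB; first by case: eqP.
  by case: ifP.
case/dvdp_exp_XsubCP => m mq dE.
have {dE} dE : d = ('X - y%:P) ^+ m.
  by apply/eqP; rewrite -eqp_monic ?monic_exp ?monicXsubC.
have m1 : m = 1%N.
  case: m dE {mq} => [|[//|m]] dE.
    by move: dy; rewrite dE expr0 /root hornerE oner_eq0.
  have := separable_nosquare usep (u := 'X - y%:P) (k := m.+2) isT.
  by rewrite size_XsubC -dE du => /(_ isT).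
have := FN _ (Fd 0%N); rewrite dE m1 expr1 coefB coefX coefC /= sub0r.
by rewrite opprK.
Qed.

Lemma common_denom (S : idomainType) (I : finType) (v : I -> {fraction S}) :
  exists2 d : S, d != 0 &
  forall i, exists s : S, FracField.tofrac d * v i = FracField.tofrac s.
Proof.
pose D i := \d_(repr (v i)).
exists (\prod_i D i) => [|i].
  by apply/prodf_neq0 => i _; apply: denom_ratioP.
exists ((\prod_(j | j != i) D j) * \n_(repr (v i))).
have dn : FracField.tofrac (D i) != 0 by rewrite tofrac_eq0 denom_ratioP.
rewrite (bigD1 i) //= !tofracM [LHS]mulrC mulrA {1}[v i]fraction_reprE.
by rewrite divfK // mulrC.
Qed.

(** * The invariants of the wild inertia group *)

Section WildFixed.
Variables (S : dvrType) (gT : finGroupType) (a : ring_action gT S).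
Hypothesis a_faithful : forall g, a g =1 id -> g = 1%g.
Hypothesis res_sep : residue_separable a.

Local Notation res := (@residue_map S).
Local Notation W := (wild_group a).
Local Notation p := (unif S).

Definition wild_fixed (s : S) : Prop := forall g, g \in W -> a g s = s.

(** The product of the [W]-conjugates of a lift is invariant and reduces to [y ^+ #|W|], since [W]
    acts trivially on residues. So [y] is purely inseparable over the residues of invariants, while
    it is separable over the smaller set of residues of the fixed ring. *)
Lemma wild_fixed_res y : exists2 s, wild_fixed s & res s = y.
Proof.
pose F y := exists2 s, wild_fixed s & res s = y.
have [u [umon uF uy _ usep]] := res_sep y.
apply: (@separable_purely_insep _ F y #|W| u) => //.
- by exists 1; rewrite ?rmorph1 // => g _; rewrite rmorph1.
- move=> _ _ [s sW <-] [t tW <-]; exists (s - t); rewrite ?rmorphB // => g gW.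
  by rewrite rmorphB sW ?tW.
- move=> _ _ [s sW <-] [t tW <-]; exists (s * t); rewrite ?rmorphM // => g gW.
  by rewrite rmorphM sW ?tW.
- move=> _ [s sW <-]; have [sU|sU] := boolP (s \is a GRing.unit).
    by exists s^-1; rewrite ?rmorphV // => g gW; rewrite rmorphV // sW.
  move: sU; rewrite -res_neq0 negbK => /eqP ->; exists 0; rewrite ?rmorph0 ?invr0 //.
  by move=> g _; rewrite rmorph0.
- exact: wild_pnat.
- have [s <-] := res_onto y; exists (\prod_(g in W) a g s).
    move=> h hW; rewrite rmorph_prod [RHS](reindex_inj (mulgI h)) /=.
    by apply: eq_big => [g|g _]; rewrite ?groupMl // ractME.
  rewrite rmorph_prod -prodr_const; apply: eq_bigr => g /wild_inertia/inertiaP gI.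
  by transitivity (residue_act a g (res s)); [rewrite res_act|rewrite gI].
- exact: monic_neq0.
- move=> i; have [iu|ui] := ltnP i (size u); last first.
    exists 0; rewrite ?rmorph0 ?nth_default //.
    by move=> g _; rewrite rmorph0.
  move: uF; rewrite qualifE => /(all_nthP 0)/(_ i iu) /asboolP[r rR ->].
  by exists r.
Qed.

Lemma wild_expansion m x : exists2 r : nat -> S, (forall i, wild_fixed (r i)) &
  dvd m (x - \sum_(i < m) r i * p ^+ i).
Proof.
elim: m => [|m [r rW [b bE]]].
  exists (fun=> 0); first by move=> i g _; rewrite rmorph0.
  by exists (x - \sum_(i < 0) 0 * p ^+ i); rewrite expr0 mulr1.
have [s sW sb] := wild_fixed_res (res b).
exists (fun i => if i == m then s else r i); first by move=> i; case: eqP.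
rewrite big_ord_recr /= eqxx opprD addrA.
under eq_bigr => i _ do rewrite ltn_eqF //.
rewrite bE -mulrBl -[m.+1]add1n; apply: dvdM; last by exists 1; rewrite mul1r.
by apply/res_eq.
Qed.

(** Suppose [c] has valuation [e] below the order of [W]. Linear algebra gives a nonzero combination
    [Phi] of the elements of [W] that vanishes at the first [e] powers of [p]. By [wild_expansion]
    these powers generate [S] over the invariants modulo [c], so every value of [Phi] is [c] times
    another value. Thus [Phi] is zero, against independence of automorphisms. *)
Lemma wild_fixed_dvd c : wild_fixed c -> c \isn't a GRing.unit -> dvd #|W| c.
Proof.
move=> cW cU; have [->|c0] := eqVneq c 0; first exact: dvd0.
have [e [u uU cE]] := unif_decomp c0.
rewrite cE; apply/dvdX => //; rewrite leqNgt; apply/negP => eq.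
pose E : 'M[{fraction S}]_(#|W|, e) :=
  \matrix_(i, j) FracField.tofrac (a (enum_val i) (p ^+ j)).
have : kermx E != 0.
  rewrite -mxrank_eq0 mxrank_ker subn_eq0 -ltnNge.
  exact: leq_ltn_trans (rank_leq_col _) eq.
case/rowV0Pn => v /sub_kermxP vE v0.
have [d d0 dv] := common_denom (fun i => v 0 i).
pose w i := sval (cid (dv i)).
have wE i : FracField.tofrac (w i) = FracField.tofrac d * v 0 i.
  by rewrite /w; case: cid.
pose Phi x := \sum_i w i * a (enum_val i) x.
have PhiB x y : Phi (x - y) = Phi x - Phi y.
  by rewrite /Phi -sumrB; apply: eq_bigr => i _; rewrite rmorphB mulrBr.
have PhiZ r x : wild_fixed r -> Phi (r * x) = r * Phi x.
  move=> rW; rewrite /Phi mulr_sumr; apply: eq_bigr => i _.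
  by rewrite rmorphM rW ?enum_valP // mulrCA.
have Phi0 : Phi 0 = 0 by rewrite -{1}(subrr 0) PhiB subrr.
have PhiD x y : Phi (x + y) = Phi x + Phi y.
  by rewrite -{1}[y]opprK -[- y]sub0r PhiB PhiB Phi0 sub0r opprK.
have Phip i : (i < e)%N -> Phi (p ^+ i) = 0.
  move=> ie; apply/eqP; rewrite -(tofrac_eq0 (Phi _)) /Phi rmorph_sum /=.
  have /rowP/(_ (Ordinal ie)) := vE; rewrite !mxE.
  move/(congr1 (fun x => FracField.tofrac d * x)); rewrite mulr0 mulr_sumr => E0.
  apply/eqP; rewrite -[RHS]E0.
  by apply: eq_bigr => j _; rewrite tofracM wE !mxE mulrA.
have Phidvd n x : dvd n (Phi x).
  elim: n x => [|n IH] x; first by exists (Phi x); rewrite expr0 mulr1.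
  have [r rW [b bE]] := wild_expansion e x.
  have xE : x = c * (b / u) + \sum_(i < e) r i * p ^+ i.
    by rewrite cE mulrC mulrA divrK // -bE subrK.
  rewrite xE PhiD (big_morph Phi PhiD Phi0) big1 => [|i _]; last first.
    by rewrite PhiZ // Phip ?mulr0.
  rewrite addr0 PhiZ // -[n.+1]add1n; apply: dvdM; last exact: IH.
  exact/dvd1P.
pose cc g := if g \in W then w (enum_rank_in (group1 W) g) else 0.
have ccE x : \sum_g cc g * a g x = 0.
  transitivity (Phi x); last exact: unif_sep.
  rewrite (bigID [in W]) /= [X in _ + X]big1 ?addr0 => [|g /negPf gW]; last first.
    by rewrite /cc gW mul0r.
  rewrite big_enum_val; apply: eq_bigr => i _.
  by rewrite /cc enum_valP enum_valK_in.
case/eqP: v0; apply/rowP => i; rewrite mxE.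
have := @dedekind_independence S S gT (fun g => a g) cc (enum_val i)
  (fun g => rmorph1 (a g)) (fun g => rmorphM (a g)) ccE.
rewrite (big_pred1 (enum_val i)) => [|g]; last first.
  apply/asboolP/eqP => [Eg|-> //]; apply/eqP; rewrite eq_mulgV1; apply/eqP.
  by apply: a_faithful => x; rewrite ractME Eg ractKV.
rewrite /cc enum_valP enum_valK_in => /(congr1 (@FracField.tofrac S)).
move/eqP; rewrite tofrac0 wE mulf_eq0 tofrac_eq0 (negPf d0) /=.
by move/eqP.
Qed.

End WildFixed.

(** * Left ideals with two generators *)

Section TwoGenerated.
Variables (T : nzRingType) (y1 y2 : T).

Definition span2 : {pred T^o} := fun t => `[< exists c d : T, t = c * y1 + d * y2 >].

Lemma span2_closed : submod_closed span2.
Proof.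
split; first by apply/asboolP; exists 0, 0; rewrite !mul0r addr0.
move=> b _ _ /asboolP[c [d ->]] /asboolP[c' [d' ->]]; apply/asboolP.
exists (b * c + c'), (b * d + d'); rewrite /GRing.scale /= mulrDr !mulrDl.
by rewrite !mulrA addrACA.
Qed.

HB.instance Definition _ := GRing.isSubmodClosed.Build T T^o span2 span2_closed.

Record span2_type := Span2 { span2_val : T^o; span2_valP : span2_val \in span2 }.

HB.instance Definition _ := [isSub for span2_val].
HB.instance Definition _ := [Choice of span2_type by <:].
HB.instance Definition _ := [SubChoice_isSubLmodule of span2_type by <:].

Lemma span2_in c d : c * y1 + d * y2 \in span2.
Proof. by apply/asboolP; exists c, d. Qed.

Definition span2_map (v : T^o * T^o) : span2_type := Span2 (span2_in v.1 v.2).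

Lemma span2_map_linear : linear span2_map.
Proof.
move=> b u v; apply: val_inj; rewrite /= /GRing.scale /=.
by rewrite mulrDr !mulrDl !mulrA addrACA.
Qed.

HB.instance Definition _ := GRing.isLinear.Build T (T^o * T^o)%type span2_type _
  span2_map span2_map_linear.

(** Projectivity splits the map from pairs of coefficients onto the ideal; [r1] and [r2] are the
    coordinates of the splitting. Off the ideal they take a default value, so linearity is claimed
    only on it. *)
Lemma span2_dual_basis : left_hereditary T ->
  exists r1 r2 : T -> T, [/\ forall t, t \in span2 -> t = r1 t * y1 + r2 t * y2,
    forall c t, t \in span2 -> r1 (c * t) = c * r1 t
    & forall c t, t \in span2 -> r2 (c * t) = c * r2 t].
Proof.
move=> hT; have proj := hT span2_type val val_inj.
have [|r rP] := proj _ _ span2_map (@idfun span2_type).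
  move=> t; have /asboolP[c [d E]] := span2_valP t; exists (c, d).
  exact: val_inj.
have spanP t : t \in span2 -> exists u : span2_type, val u = t.
  by move=> tI; exists (Span2 tI).
pose s (t : T) : span2_type := insubd 0 (t : T^o).
have sK t : t \in span2 -> val (s t) = t by move=> tI; rewrite insubdK.
have sM c t : t \in span2 -> s (c * t) = c *: s t.
  move=> tI; have ctI : c * t \in span2.
    have [I0 cl] := span2_closed; rewrite -[c * t]addr0.
    exact: (cl c t 0).
  apply: val_inj; rewrite (sK _ ctI).
  transitivity (c *: val (s t)); first by rewrite (sK _ tI).
  by rewrite -linearZ.
exists (fun t => (r (s t)).1), (fun t => (r (s t)).2); split.
- by move=> t tI; have := congr1 val (rP (s t)); rewrite /= sK.
- by move=> c t tI; rewrite sM // linearZ.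
- by move=> c t tI; rewrite sM // linearZ.
Qed.

End TwoGenerated.

(** * The residue ring and conjugation by the uniformizer *)

Section ResidueRing.
Variables (S : dvrType) (gT : finGroupType) (a : ring_action gT S).
Variable f : cocycle a.

Local Notation k := (residue S).
Local Notation res := (@residue_map S).
Local Notation p := (unif S).
Local Notation chi := (tame_char a).

Lemma residue_cocycleP :
  is_cocycle (fun g => residue_act a g) (residue_cocycle f).
Proof.
split=> [g h|g|g h l]; rewrite /residue_cocycle.
- by apply: rmorph_unit; apply: cocycle_unit.
- by rewrite cocycle1l cocycle1r rmorph1.
- by rewrite res_act -!rmorphM cocycleE.
Qed.

Definition residue_fcocycle : cocycle (residue_act a) := Cocycle residue_cocycleP.
Local Notation fk := residue_fcocycle.

Definition reduce (x : crossed f) : crossed fk := crossed_map fk res x.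
Local Notation rho := reduce.

Let phi_act g s : res (a g s) = residue_act a g (res s).
Proof. by rewrite res_act. Qed.
Let phi_f g h : res (f g h) = fk g h. Proof. by []. Qed.

Lemma reduceE x g : rho x g = res (x g). Proof. exact: crossed_mapE. Qed.
Lemma reduceM x y : rho (x * y) = rho x * rho y.
Proof. exact: crossed_mapM. Qed.
Lemma reduceD x y : rho (x + y) = rho x + rho y.
Proof. exact: crossed_mapD. Qed.
Lemma reduceB x y : rho (x - y) = rho x - rho y.
Proof. exact: crossed_mapB. Qed.
Lemma reduce0 : rho 0 = 0. Proof. exact: crossed_map0. Qed.
Lemma reduce1 : rho 1 = 1. Proof. exact: crossed_map1. Qed.
Lemma reduceU g s : rho (crossed_U f g s) = crossed_U fk g (res s).
Proof. exact: crossed_mapU. Qed.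

Lemma reduce_restrict (W : {group gT}) x : rho (restrict W x) = restrict W (rho x).
Proof. exact: crossed_map_restrict. Qed.

Lemma reduce_onto (y : crossed fk) : exists x, rho x = y.
Proof.
exists [ffun g => repr (y g)]; apply/ffunP => g.
by rewrite reduceE ffunE residue_mapK.
Qed.

Lemma reduce_onto_supported (W : {group gT}) (y : crossed fk) :
  supported W y -> exists2 x, supported W x & rho x = y.
Proof.
move=> sy; have [x xE] := reduce_onto y; exists (restrict W x).
  exact: supported_restrict.
by rewrite reduce_restrict xE restrict_id.
Qed.

Definition Pi : crossed f := crossed_U f 1%g p.

(** Conjugation by [Pi], written on coefficients because [Pi] is not invertible in this ring;
    [rtwist] is what it induces on residues. *)
Definition twist (x : crossed f) : crossed f := [ffun g => x g * uratio a g].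
Definition untwist (x : crossed f) : crossed f := [ffun g => x g / uratio a g].
Definition rtwist (x : crossed fk) : crossed fk := [ffun g => x g * chi g].

Lemma mulPiE x g : (Pi * x) g = p * x g. Proof. exact: crossed_U1_mulE. Qed.

Lemma mulPi x : x * Pi = Pi * twist x.
Proof.
apply/ffunP => g; rewrite mulPiE crossed_mul_U1E ffunE ract_unif.
by rewrite mulrA mulrC.
Qed.

Lemma twistK x : twist (untwist x) = x.
Proof. by apply/ffunP => g; rewrite !ffunE divrK ?uratio_unit. Qed.

Lemma untwistK x : untwist (twist x) = x.
Proof. by apply/ffunP => g; rewrite !ffunE mulrK ?uratio_unit. Qed.

Lemma Pimul x : Pi * x = untwist x * Pi.
Proof. by rewrite mulPi twistK. Qed.

Lemma Pi_inj x y : Pi * x = Pi * y -> x = y.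
Proof.
move=> E; apply/ffunP => g; apply: (mulfI (unif_neq0 S)).
by rewrite -!mulPiE E.
Qed.

Lemma twistM x y : twist (x * y) = twist x * twist y.
Proof. by apply: Pi_inj; rewrite -mulPi mulrA -mulPi -!mulrA -mulPi. Qed.

Lemma untwistM x y : untwist (x * y) = untwist x * untwist y.
Proof. by rewrite -{1}[x]twistK -{1}[y]twistK -twistM untwistK. Qed.

Lemma supported_untwist (W : {group gT}) x : supported W x -> supported W (untwist x).
Proof. by move=> sx g gW; rewrite ffunE sx ?mul0r. Qed.

Lemma supportedPi (W : {group gT}) : supported W Pi.
Proof. exact: supportedU. Qed.

Lemma reduce_twist x : rho (twist x) = rtwist (rho x).
Proof. by apply/ffunP => g; rewrite reduceE !ffunE rmorphM. Qed.

Lemma reducePi : rho Pi = 0.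
Proof.
rewrite reduceU (_ : res p = 0) ?crossed_U0 //; apply/res_eq0/dvd1P.
exact: unif_nunit.
Qed.

Lemma reduce_eq0 x : rho x = 0 <-> exists y, x = Pi * y.
Proof.
split=> [x0|[y ->]]; last by rewrite reduceM reducePi mul0r.
have H g : exists b, x g = b * p.
  have /ffunP/(_ g) := x0; rewrite reduceE ffunE => /res_eq0/dvd1P/nunitP.
  by [].
exists [ffun g => sval (cid (H g))]; apply/ffunP => g; rewrite mulPiE ffunE mulrC.
by case: cid.
Qed.

Lemma rtwistM x y : rtwist (x * y) = rtwist x * rtwist y.
Proof.
have [x' <-] := reduce_onto x; have [y' <-] := reduce_onto y.
by rewrite -reduceM -!reduce_twist twistM reduceM.
Qed.

Lemma rtwistD x y : rtwist (x + y) = rtwist x + rtwist y.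
Proof. by apply/ffunP => g; rewrite !ffunE mulrDl. Qed.

Lemma rtwistU g s : rtwist (crossed_U fk g s) = crossed_U fk g (s * chi g).
Proof. by apply/ffunP => h; rewrite !ffunE; case: eqP => [-> //|_]; rewrite mul0r. Qed.

Lemma rtwist1 : rtwist 1 = 1.
Proof. by rewrite [LHS]rtwistU chi1 mulr1. Qed.

End ResidueRing.

(** * The residue ring of the wild inertia group *)

Section WildPart.
Variables (S : dvrType) (gT : finGroupType) (a : ring_action gT S).
Hypothesis a_faithful : forall g, a g =1 id -> g = 1%g.
Variable f : cocycle a.

Local Notation k := (residue S).
Local Notation res := (@residue_map S).
Local Notation p := (unif S).
Local Notation chi := (tame_char a).
Local Notation fk := (residue_fcocycle f).
Local Notation rho := (@reduce S gT a f).
Local Notation W := (wild_group a).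
Local Notation aug := (aug W).
Local Notation U := (crossed_U f).
Local Notation Uk := (crossed_U fk).
Local Notation Pi := (Pi f).

Lemma wild_act g : g \in W -> residue_act a g =1 id.
Proof. by move/wild_inertia/inertiaP. Qed.

Definition waugD := augD (wild_pnat a_faithful) : forall x y : crossed fk, aug (x + y) = aug x + aug y.
Definition waugB := augB (wild_pnat a_faithful) : forall x y : crossed fk, aug (x - y) = aug x - aug y.
Definition waugM := augM wild_act (wild_pnat a_faithful) (f := fk).

Lemma reduced_inv (x : crossed fk) : supported W x -> aug x != 0 ->
  exists y, [/\ supported W y, x * y = 1 & y * x = 1].
Proof.
move=> sx x0; apply: supported_inv => //.
exact: (aug_unit wild_act (wild_pnat a_faithful)).
Qed.

(** Units lift from the residue ring: the determinant of right multiplication reduces to the residue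
    determinant, and [S] is local. *)
Lemma wild_inv (x : crossed f) : supported W x -> aug (rho x) != 0 ->
  exists y, [/\ supported W y, x * y = 1 & y * x = 1].
Proof.
move=> sx x0; apply: supported_inv => //; rewrite unitmxE -res_neq0 -det_map_mx.
have H g s : res (a g s) = residue_act a g (res s) by rewrite res_act.
have <- := @map_rmul_crossed_map _ _ _ a _ f fk res H (fun _ _ => erefl) W x.
rewrite -unitfE -unitmxE; apply: (aug_unit wild_act (wild_pnat a_faithful)) => //.
exact: supported_crossed_map.
Qed.

Lemma aug_inv_neq0 (x y : crossed fk) : supported W x -> supported W y ->
  x * y = 1 -> aug x != 0.
Proof.
move=> sx sy xy; have := waugM sx sy; rewrite xy aug1 => E.
by apply/eqP => x0; move: E; rewrite x0 mul0r => /eqP; rewrite oner_eq0.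
Qed.

Lemma supported_reduce (x : crossed f) : supported W x -> supported W (rho x).
Proof. exact: supported_crossed_map. Qed.

Lemma reduce_untwist (x : crossed f) : supported W x -> rho (untwist x) = rho x.
Proof.
move=> sx; apply/ffunP => g; rewrite !reduceE ffunE.
have [gW|gW] := boolP (g \in W); last by rewrite sx ?mul0r.
rewrite rmorphM rmorphV ?uratio_unit //=.
by have [_] := wildP _ _ gW; rewrite /tame_char => ->; rewrite invr1 mulr1.
Qed.

Section Divide.
Hypothesis res_sep : residue_separable a.

(* The determinant of [y] lies in the fixed ring of [W], hence, being a
   non-unit, is divisible by the determinant of [Pi]. *)
Lemma wild_factor_Pi (y z u u' : crossed f) : supported W y -> supported W z ->
  supported W u -> supported W u' -> u * u' = 1 -> y * z = Pi * u ->
  aug (rho y) = 0 ->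
  rho y = 0 /\ exists2 c, supported W c & z * c = 1.
Proof.
move=> sy sz su su' uu' yz y0.
have dyU : \det (rmul_mx W y) \isn't a GRing.unit.
  apply/negP; rewrite -unitmxE => /(supported_inv sy)[c [sc yc _]].
  have := aug_inv_neq0 (supported_reduce sy) (supported_reduce sc).
  by rewrite -reduceM yc reduce1 y0 eqxx => /(_ erefl).
have [b bE] : dvd #|W| (\det (rmul_mx W y)).
  apply: wild_fixed_dvd => // g gW; exact: ract_det_rmul.
have zU : rmul_mx W z \in unitmx.
  have : \det (rmul_mx W y) * \det (rmul_mx W z)
       = \det (rmul_mx W Pi) * \det (rmul_mx W u).
    by rewrite -!det_mulmx -!rmul_mxM ?yz //; apply: supportedPi.
  have -> : rmul_mx W Pi = diag_mx (\row_i a (enum_val i) p).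
    apply/matrixP => i j; rewrite !mxE crossed_UE -eq_mulVg1 (inj_eq enum_val_inj).
    by case: eqP => [->|_]; rewrite ?mulVg ?cocycle1r ?mulr1 // rmorph0 mul0r.
  rewrite det_diag bE.
  under eq_bigr => i _ do rewrite mxE ract_unif.
  rewrite big_split /= prodr_const card_ord mulrAC [RHS]mulrAC.
  move/(mulIf (expf_neq0 _ (unif_neq0 S))) => E.
  have : b * \det (rmul_mx W z) \is a GRing.unit.
    rewrite E unitrM rpred_prod => [|i _]; last exact: uratio_unit.
    by have := unitmx_rmul su su' uu'; rewrite unitmxE.
  by rewrite unitrM unitmxE => /andP[].
have [c [sc zc cz]] := supported_inv sz zU.
split; last by exists c.
have -> : y = Pi * (u * c) by rewrite mulrA -yz -mulrA zc mulr1.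
by rewrite reduceM reducePi mul0r.
Qed.

End Divide.
End WildPart.

(** * Non-units over wild inertia obstruct heredity and maximality *)

Section WildDivision.
Variables (S : dvrType) (gT : finGroupType) (a : ring_action gT S).
Hypothesis a_faithful : forall g, a g =1 id -> g = 1%g.
Hypothesis res_sep : residue_separable a.
Variable f : cocycle a.

Local Notation k := (residue S).
Local Notation res := (@residue_map S).
Local Notation p := (unif S).
Local Notation chi := (tame_char a).
Local Notation fk := (residue_fcocycle f).
Local Notation rho := (@reduce S gT a f).
Local Notation W := (wild_group a).
Local Notation aug := (aug W).
Local Notation U := (crossed_U f).
Local Notation Uk := (crossed_U fk).
Local Notation Pi := (Pi f).

(** Then [aug] is injective on the residue ring of [W], which is thereby a field ([wdiv_inv]),
    purely inseparable over the residue field of [S] ([wdiv_expq]). *)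
Definition wild_division : Prop :=
  forall x : crossed fk, supported W x -> aug x = 0 -> x = 0.

(** For the left ideal generated by [Pi] and [y], projectivity gives [y = Z1 * Pi + Z2 * y] over
    [W]. If [Z2] has zero augmentation, [1 - Z2] is a unit and [y] is a left multiple of [Pi]. If
    [Z2] is a unit, applying [r2] to [Pi * y = untwist y * Pi] yields a factorization of [Pi * Z2],
    which [wild_factor_Pi] handles. *)
Lemma hereditary_wild_division : left_hereditary (crossed f) -> wild_division.
Proof.
move=> hT x0 sx0 aug0; have [y sy yE] := reduce_onto_supported sx0.
rewrite -yE in aug0 *.
have [r1 [r2 [rE r1M r2M]]] := span2_dual_basis Pi y hT.
have PiI : Pi \in span2 Pi y.
  by have := span2_in Pi y 1 0; rewrite mul1r mul0r addr0.
have yI : y \in span2 Pi y.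
  by have := span2_in Pi y 0 1; rewrite mul1r mul0r add0r.
pose Z1 := restrict W (r1 y); pose Z2 := restrict W (r2 y).
pose Q := restrict W (r2 Pi).
have yZ : y = Z1 * Pi + Z2 * y.
  rewrite -{1}[y](restrict_id sy) {1}(rE _ yI) restrictD.
  by rewrite !restrictMr //; apply: supportedPi.
have sZ2 : supported W Z2 by apply: supported_restrict.
have [Z0|Z0] := eqVneq (aug (rho Z2)) 0.
  have s1Z : supported W (1 - Z2) by apply: supportedB => //; apply: supported1.
  have [|c [sc _ cZ]] := wild_inv a_faithful s1Z.
    by rewrite reduceB reduce1 waugB // Z0 subr0 aug1 oner_eq0.
  have -> : y = c * Z1 * Pi.
    rewrite -mulrA -[Z1 * Pi](addrK (Z2 * y)) -yZ.
    by rewrite -{2}[y]mul1r -mulrBl mulrA cZ mul1r.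
  by rewrite reduceM reducePi mulr0.
have [c [sc Zc _]] := wild_inv a_faithful sZ2 Z0.
have E : untwist y * Q = Pi * Z2.
  have : r2 (Pi * y) = r2 (untwist y * Pi) by rewrite Pimul.
  rewrite r2M // r2M // => /(congr1 (restrict W)) /esym.
  by rewrite !restrictMl //; [apply: supportedPi | apply: supported_untwist].
have [] := wild_factor_Pi a_faithful res_sep _ _ _ _ Zc E.
- exact: supported_untwist.
- exact: supported_restrict.
- exact: sZ2.
- exact: sc.
- by rewrite reduce_untwist.
- by rewrite reduce_untwist.
Qed.

Lemma restrictJV (g : gT) (x : crossed f) :
  restrict W (Uinv f g * x * U g 1) = Uinv f g * restrict W x * U g 1.
Proof.
have := restrictJ g (Uinv f g * x * U g 1) (wild_normal a).
rewrite !mulrA mulUinv mul1r -mulrA mulUinv mulr1 => ->.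
by rewrite !mulrA mulUinvV mul1r -!mulrA mulUinvV mulr1.
Qed.

Lemma supportedJV (g : gT) (x : crossed fk) : supported W x ->
  supported W (Uinv fk g * x * Uk g 1).
Proof.
move=> sx h hW; rewrite crossed_mul_UE crossed_U_mulE sx ?rmorph0 ?mulr0 ?mul0r //.
apply: contra hW => /(wildJ g^-1); rewrite !invgK.
by rewrite !mulgA mulVg mul1g mulgKV.
Qed.

Lemma supportedJ (g : gT) (x : crossed fk) : supported W x ->
  supported W (Uk g 1 * x * Uinv fk g).
Proof.
move=> sx h hW; rewrite crossed_mul_UE crossed_U_mulE sx ?rmorph0 ?mulr0 ?mul0r //.
apply: contra hW; rewrite invgK => /(wildJ g).
by rewrite !mulgA mulgV mul1g mulgK.
Qed.

(** Among elements supported on [W], zero augmentation characterizes non-units, and conjugation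
    preserves these. *)
Lemma augJV_eq0 (g : gT) (x : crossed fk) : supported W x -> aug x = 0 ->
  aug (Uinv fk g * x * Uk g 1) = 0.
Proof.
move=> sx x0; apply/eqP; apply: contraT => nz.
have [y [sy xy yx]] := reduced_inv a_faithful (supportedJV g sx) nz.
have E : x * (Uk g 1 * y * Uinv fk g) = 1.
  have : Uk g 1 * (Uinv fk g * x * Uk g 1 * y) * Uinv fk g = 1.
    by rewrite xy mulr1 mulUinv.
  by rewrite !mulrA mulUinv mul1r.
have := aug_inv_neq0 a_faithful sx (supportedJ g sy) E.
by rewrite x0 eqxx.
Qed.

Lemma aug_reduceZ s (x : crossed f) : supported W x -> aug (rho x) = 0 ->
  aug (rho (U 1%g s * x)) = 0.
Proof.
move=> sx x0; rewrite reduceM waugM ?x0 ?mulr0 //; last exact: supported_reduce.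
by apply: supported_reduce; apply: supportedU.
Qed.

(* The preimage in [S^f*G] of the ideal generated by the radical of the
   residue ring of [W]. *)
Definition wild_radical (w : crossed f) : Prop :=
  forall g, aug (rho (restrict W (U g 1 * w))) = 0.

Lemma wild_radicalB x y : wild_radical x -> wild_radical y -> wild_radical (x - y).
Proof.
move=> Ix Iy g; rewrite mulrBr -[- _]mulN1r restrictD reduceD waugD // Ix add0r.
have -> : -1 = U 1%g (-1) :> crossed f.
  by apply/ffunP => h; rewrite crossed_oppE crossed_1E crossed_UE; case: eqP; rewrite ?oppr0.
rewrite restrictMl; last exact: supportedU.
by apply: aug_reduceZ => //; apply: supported_restrict.
Qed.

Lemma wild_radicalD x y : wild_radical x -> wild_radical y -> wild_radical (x + y).
Proof. by move=> Ix Iy g; rewrite mulrDr restrictD reduceD waugD // Ix Iy addr0. Qed.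

Lemma wild_radicalPi : wild_radical Pi.
Proof.
move=> g; rewrite reduce_restrict reduceM reducePi mulr0 restrict0.
exact: aug0.
Qed.

Lemma wild_radicalM x t : wild_radical x -> wild_radical (x * t).
Proof.
move=> Ix; rewrite [t]crossed_U_sum mulr_sumr.
apply: big_ind => [g|y z Iy Iz|h _].
- by rewrite mulr0 restrict0 reduce0 aug0.
- exact: wild_radicalD.
- move=> g; have -> : U h (t h) = U h 1 * U 1%g (a h^-1%g (t h)).
    by rewrite crossed_UU mulg1 mul1r cocycle1r mulr1 ractKV.
  rewrite !mulrA restrictMr; last exact: supportedU.
  set X := U g 1 * x.
  have -> : X * U h 1 = Uinv f h * (U h 1 * X) * U h 1.
    by rewrite !mulrA mulUinvV mul1r.
  rewrite restrictJV reduceM waugM; first last.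
  + by apply: supported_reduce; apply: supportedU.
  + rewrite !reduceM (_ : rho (Uinv f h) = Uinv fk h); last first.
      by rewrite reduceU rmorphV ?cocycle_unit.
    rewrite reduceU rmorph1; apply: supportedJV; apply: supported_reduce.
    exact: supported_restrict.
  + exact: a_faithful.
  rewrite !reduceM (_ : rho (Uinv f h) = Uinv fk h); last first.
    by rewrite reduceU rmorphV ?cocycle_unit.
  rewrite [rho (U h 1)]reduceU rmorph1 augJV_eq0 ?mul0r //.
    by apply: supported_reduce; apply: supported_restrict.
  rewrite /X mulrA crossed_UU crossed_U_scale -mulrA restrictMl; last exact: supportedU.
  by apply: aug_reduceZ => //; apply: supported_restrict.
Qed.

(** Choose [z] generating a left ideal of least dimension, the row space of [rmul_mx W z]. If
    [n * z] were nonzero it would generate the same ideal, so [z = c * n * z]; but [1 - c * n] is a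
    unit. *)
Lemma aug_annihilator : exists2 z : crossed fk, supported W z /\ z != 0 &
  forall n, supported W n -> aug n = 0 -> n * z = 0.
Proof.
have ex : exists r, `[< exists z : crossed fk, [/\ supported W z, z != 0 &
    \rank (rmul_mx W z) = r] >].
  exists (\rank (rmul_mx W (1 : crossed fk))); apply/asboolP; exists 1.
  by split; [apply: supported1 | apply: oner_neq0 |].
case: (ex_minnP ex) => r /asboolP[z [sz z0 zr]] rmin; exists z => // n sn n0.
apply/eqP; apply: contraT => nz0.
have sM : (rmul_mx W (n * z)%R <= rmul_mx W z)%MS by rewrite rmul_mxM // submxMl.
have : (rmul_mx W z <= rmul_mx W (n * z)%R)%MS.
  rewrite -(geq_leqif (mxrank_leqif_sup sM)) zr; apply: rmin; apply/asboolP.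
  by exists (n * z); split=> //; apply: supportedM.
move=> sM'; have : (coef_row W z <= rmul_mx W (n * z)%R)%MS.
  apply: submx_trans sM'; rewrite -[z]mul1r coef_rowM ?mul1r ?submxMl //.
  exact: supported1.
case/submxP => v vE; have [c sc cE] := coef_row_onto fk v.
have zE : z = c * n * z.
  apply: (coef_row_inj sz (supportedM (supportedM sc sn) sz)).
  by rewrite vE -cE -coef_rowM // mulrA.
have scn : supported W (1 - c * n).
  by apply: supportedB; [apply: supported1 | apply: supportedM].
have [|d [_ _ dE]] := reduced_inv a_faithful scn.
  by rewrite waugB // aug1 waugM // n0 mulr0 subr0 oner_eq0.
have : (1 - c * n) * z = 0 by rewrite mulrBl mul1r -zE subrr.
move/(congr1 (fun y => d * y)); rewrite mulrA dE mul1r mulr0 => z0'.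
by rewrite z0' eqxx in z0.
Qed.

(** In the fraction algebra this says that [Pi] inverse times [z] sends the wild radical into itself
    on the right. The quotient [v] stays in the radical: otherwise [wild_factor_Pi] would make [z]
    right invertible, and an invertible residue is not annihilated by a nonzero kernel. *)
Lemma wild_radical_multiplier : ~ wild_division ->
  exists2 z : crossed f, rho z != 0 &
    forall w, wild_radical w -> exists2 v, wild_radical v & untwist w * z = Pi * v.
Proof.
move=> nD; have [zk [szk zk0] ann] := aug_annihilator.
have [z sz zE] := reduce_onto_supported szk; exists z; first by rewrite zE.
have noinv : ~ exists2 c, supported W c & z * c = 1.
  move=> [c sc zc]; apply: nD => x sx x0.
  have : x * zk * rho c = 0 by rewrite ann ?mul0r.
  by rewrite -mulrA -zE -reduceM zc reduce1 mulr1.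
move=> w Iw.
have restrict_untwist x : restrict W (untwist x) = untwist (restrict W x).
  by apply/ffunP => g; rewrite !(restrictE, ffunE) fun_if; case: ifP; rewrite ?mul0r.
have y0 g : aug (rho (restrict W (U g 1 * untwist w))) = 0.
  have -> : U g 1 * untwist w = untwist (U g (uratio a g) * w).
    rewrite untwistM; congr (_ * _); apply/ffunP => h.
    by rewrite !ffunE; case: eqP => [->|_]; rewrite ?mul0r ?mulrV ?uratio_unit.
  rewrite restrict_untwist reduce_untwist; last exact: supported_restrict.
  rewrite crossed_U_scale -mulrA restrictMl; last exact: supportedU.
  by apply: aug_reduceZ => //; apply: supported_restrict.
have [v vE] : exists v, untwist w * z = Pi * v.
  apply/reduce_eq0; rewrite reduceM zE.
  have H g : restrict W (Uk g 1 * (rho (untwist w) * zk)) = 0.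
    rewrite mulrA restrictMr //; apply: ann; first exact: supported_restrict.
    by have := y0 g; rewrite reduce_restrict reduceM reduceU rmorph1.
  apply/ffunP => g; have /ffunP/(_ 1%g) := H g^-1%g.
  rewrite restrictE group1 crossed_U_mulE crossed_0E invgK mulg1 mul1r => /eqP.
  rewrite mulf_eq0 => /orP[/eqP E|]; last first.
    by have := cocycle_unit fk g^-1%g g; rewrite unitfE => /negPf ->.
  by rewrite -[LHS](ractKV (residue_act a) g) E rmorph0 crossed_0E.
exists v => // g.
(* Moving [U g 1] past [Pi] produces the coefficient [uratio a g]. *)
pose v0 := restrict W (U g (uratio a g) * v).
have v0E : restrict W (U g 1 * untwist w) * z = Pi * v0.
  rewrite -restrictMr // -mulrA vE -restrictMl; last exact: supportedPi.
  rewrite !mulrA mulPi; congr (restrict W (Pi * _ * v)).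
  by apply/ffunP => h; rewrite !ffunE; case: eqP => [->|_]; rewrite ?mul0r ?mul1r.
have sv0 : supported W v0 by apply: supported_restrict.
have v00 : aug (rho v0) = 0.
  apply/eqP; apply: contraT => nz; case: noinv.
  have [c [sc vc _]] := wild_inv a_faithful sv0 nz.
  have [_ [d sd zd]] := wild_factor_Pi a_faithful res_sep
    (supported_restrict _) sz sv0 sc vc v0E (y0 g).
  by exists d.
have -> : U g 1 = U 1%g (uratio a g)^-1 * U g (uratio a g).
  by rewrite crossed_UU mul1g ract1 cocycle1l mulr1 mulVr ?uratio_unit.
rewrite -mulrA restrictMl; last exact: supportedU.
by apply: aug_reduceZ.
Qed.

End WildDivision.

(** * Simplicity of the residue ring under conjugation by a uniformizer *)

Section TwistSimple.
Variables (B : nzRingType) (s s' : B -> B) (dim : (B -> Prop) -> nat) (d : nat).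
Hypotheses (sD : forall x y, s (x + y) = s x + s y).
Hypotheses (sM : forall x y, s (x * y) = s x * s y) (s1 : s 1 = 1).
Hypotheses (sK : cancel s s') (sK' : cancel s' s).
Hypothesis dim_eq : forall X Y, is_ideal X -> is_ideal Y ->
  (forall x, X x -> Y x) -> (dim Y <= dim X)%N -> forall y, Y y -> X y.
Hypothesis dim_max : forall X, is_ideal X -> (dim X <= d)%N.
Hypothesis s_simple : forall X x, is_ideal X -> (forall x, X x -> X (s x)) ->
  X x -> x != 0 -> X 1.

Let s0 : s 0 = 0.
Proof. by apply: (addIr (s 0)); rewrite -sD !add0r. Qed.

Definition is_minimal_ideal (C : B -> Prop) : Prop :=
  [/\ is_ideal C, exists2 x, C x & x != 0 &
   forall X x, is_ideal X -> (forall y, X y -> C y) -> X x -> x != 0 ->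
   forall y, C y -> X y].

Lemma minimal_ideal_exists : exists C, is_minimal_ideal C.
Proof.
have ex : exists n, `[< exists X, [/\ is_ideal X, exists2 x, X x & x != 0 & dim X = n] >].
  exists (dim (fun=> True)); apply/asboolP; exists (fun=> True); split=> //.
  by exists 1; rewrite ?oner_neq0.
case: (ex_minnP ex) => n /asboolP[C [iC nzC Cn]] nmin; exists C; split=> //.
move=> X x iX sub Xx x0; apply: dim_eq => //; rewrite Cn; apply: nmin.
by apply/asboolP; exists X; split=> //; exists x.
Qed.

Definition shift_ideal (C : B -> Prop) (x : B) : Prop := C (s' x).

Let s'D x y : s' (x + y) = s' x + s' y.
Proof. by apply: (can_inj sK); rewrite sK' sD !sK'. Qed.
Let s'M x y : s' (x * y) = s' x * s' y.
Proof. by apply: (can_inj sK); rewrite sK' sM !sK'. Qed.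
Let s'0 : s' 0 = 0.
Proof. by apply: (can_inj sK); rewrite sK' s0. Qed.

Lemma shift_is_ideal C : is_ideal C -> is_ideal (shift_ideal C).
Proof.
move=> [C0 CD CL CR]; split; rewrite /shift_ideal ?s'0 //.
- by move=> x y Cx Cy; rewrite s'D; apply: CD.
- by move=> b x Cx; rewrite s'M; apply: CL.
- by move=> b x Cx; rewrite s'M; apply: CR.
Qed.

Lemma shift_minimal C : is_minimal_ideal C -> is_minimal_ideal (shift_ideal C).
Proof.
move=> [iC [c Cc c0] minC]; split; first exact: shift_is_ideal.
  exists (s c); first by rewrite /shift_ideal sK.
  by apply: contraNneq c0 => E; rewrite -[c]sK E s'0.
move=> X x [X0 XD XL XR] sub Xx x0 y Cy; rewrite -[y]sK'.
apply: (minC (fun y => X (s y)) (s' x)); rewrite ?sK' //.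
- split; rewrite ?s0 //; first by move=> u v Xu Xv; rewrite sD; apply: XD.
    by move=> b u Xu; rewrite sM; apply: XL.
  by move=> b u Xu; rewrite sM; apply: XR.
- by move=> u Xu; have := sub _ Xu; rewrite /shift_ideal sK.
- by apply: contraNneq x0 => E; rewrite -[x]sK' E s0.
Qed.

Fixpoint sum_ideal (C : nat -> B -> Prop) (n : nat) (x : B) : Prop :=
  if n is m.+1 then exists y z, [/\ sum_ideal C m y, C m z & x = y + z] else x = 0.

Lemma sum_is_ideal (C : nat -> B -> Prop) n : (forall i, is_ideal (C i)) ->
  is_ideal (sum_ideal C n).
Proof.
move=> iC; elim: n => [|n [D0 DD DL DR]] /=.
  by split=> // [_ _ -> ->|b _ ->|b _ ->]; rewrite ?addr0 ?mulr0 ?mul0r.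
have [C0 CD CL CR] := iC n; split.
- by exists 0, 0; rewrite addr0.
- move=> _ _ [y [z [Dy Cz ->]]] [y' [z' [Dy' Cz' ->]]].
  by exists (y + y'), (z + z'); rewrite addrACA; split; [apply: DD | apply: CD |].
- move=> b _ [y [z [Dy Cz ->]]]; exists (b * y), (b * z).
  by rewrite mulrDr; split; [apply: DL | apply: CL |].
- move=> b _ [y [z [Dy Cz ->]]]; exists (y * b), (z * b).
  by rewrite mulrDl; split; [apply: DR | apply: CR |].
Qed.

Lemma sum_idealP (C : nat -> B -> Prop) n x : sum_ideal C n x ->
  exists2 c : nat -> B, (forall i, (i < n)%N -> C i (c i)) & x = \sum_(i < n) c i.
Proof.
elim: n x => [|n IH] x /=; first by move->; exists (fun=> 0); rewrite ?big_ord0.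
move=> [y [z [/IH [c Cc ->] Cz ->]]].
exists (fun i => if i == n then z else c i).
  move=> i; rewrite ltnS leq_eqVlt => /orP[/eqP ->|ltin]; first by rewrite eqxx.
  by rewrite ltn_eqF //; apply: Cc.
rewrite big_ord_recr /= eqxx; congr (_ + _); apply: eq_bigr => i _.
by rewrite ltn_eqF.
Qed.

Lemma sum_idealI (C : nat -> B -> Prop) n i x : (forall i, is_ideal (C i)) ->
  (i < n)%N -> C i x -> sum_ideal C n x.
Proof.
move=> iC; elim: n => // n IH; rewrite ltnS leq_eqVlt => /orP[/eqP ->|ltin] Cx /=.
  by exists 0, x; rewrite add0r; have [] := sum_is_ideal n iC.
by exists x, 0; rewrite addr0; split=> //; [apply: IH | have [] := iC n].
Qed.

(** Translates of a minimal ideal are added until the next one is absorbed. The sum is then stable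
    under [s], so it contains 1, and distinct translates multiply to zero; [e] is the component of 1
    in the first translate. *)
Lemma twist_simple_idempotents : exists r (e : B),
  [/\ (0 < r)%N, iter r s e = e, \sum_(i < r) iter i s e = 1,
   forall i j, (i < r)%N -> (j < r)%N ->
     iter i s e * iter j s e = if i == j then iter i s e else 0 &
   [/\ forall i, (i < r)%N -> iter i s e != 0,
   forall i b, (i < r)%N -> b * iter i s e = iter i s e * b &
   forall X x j, is_ideal X -> (j < r)%N -> X x -> x * iter j s e != 0 ->
      X (iter j s e)]].
Proof.
have [C0 minC0] := minimal_ideal_exists.
pose C i := iter i shift_ideal C0.
have minC i : is_minimal_ideal (C i) by elim: i => //= i; apply: shift_minimal.
have iC i : is_ideal (C i) by case: (minC i).
have sC i x : C i x -> C i.+1 (s x) by rewrite /= /shift_ideal sK.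
pose D := sum_ideal C.
have iD n : is_ideal (D n) by apply: sum_is_ideal.
have ex : exists n, `[< forall x, C n x -> D n x >].
  apply: contrapT => H.
  have {}H n : exists2 x, C n x & ~ D n x.
    apply: contrapT => Hn; apply: H; exists n; apply/asboolP => x Cx.
    by apply: contrapT => Dx; apply: Hn; exists x.
  suff le n : (n <= dim (D n))%N by have := leq_trans (le d.+1) (dim_max (iD _)); rewrite ltnn.
  elim: n => // n IH; apply: leq_ltn_trans IH _; rewrite ltnNge; apply/negP => le.
  have [x Cx Dx] := H n; apply: Dx; apply: (dim_eq (iD n) (iD n.+1)) => // [y Dy|].
    by exists y, 0; rewrite addr0; split=> //; have [] := iC n.
  exact: (sum_idealI iC (ltnSn n)).
case: (ex_minnP ex) => r /asboolP subr rmin.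
have D1 : D r 1.
  have [c Cc c0] : exists2 x, C r x & x != 0 by have [] := minC r.
  apply: (s_simple (iD r) _ (subr _ Cc) c0) => x /sum_idealP[c' Cc' ->].
  have [D0 DD _ _] := iD r.
  rewrite (big_morph s sD s0); apply: big_ind => // i _.
  have /sC : C i (c' i) by apply: Cc'.
  case: (ltnP i.+1 r) => [ltir|leri]; first exact: sum_idealI.
  have -> : i.+1 = r by apply/eqP; rewrite eqn_leq leri ltn_ord.
  exact: subr.
have [c Cc sum1] := sum_idealP D1.
(* A common nonzero element would, by minimality, put the translate [j] inside the sum of its
   predecessors, against the choice of [r] as the first such index. *)
have CI i j x : (i < j)%N -> (j < r)%N -> C i x -> C j x -> x = 0.
  move=> ij jr Cix Cjx; apply/eqP; apply: contraT => x0.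
  have [_ _ minj] := minC j; have [Cj0 CjD CjL CjR] := iC j.
  have [D0 DD DL DR] := iD j.
  suff : (r <= j)%N by rewrite leqNgt jr.
  apply: rmin; apply/asboolP => y Cy.
  have [] // := minj (fun y => C j y /\ D j y) x _ _ _ x0 y Cy.
  - split=> //; first by move=> u v [? ?] [? ?]; split; [apply: CjD | apply: DD].
      by move=> b u [? ?]; split; [apply: CjL | apply: DL].
    by move=> b u [? ?]; split; [apply: CjR | apply: DR].
  - by move=> u [].
  - by split=> //; apply: sum_idealI ij Cix.
have CI' i j x : i != j -> (i < r)%N -> (j < r)%N -> C i x -> C j x -> x = 0.
  rewrite neq_ltn => /orP[lt|lt] ir jr Ci Cj; first exact: (CI i j).
  exact: (CI j i).
have CM i j x y : i != j -> (i < r)%N -> (j < r)%N -> C i x -> C j y -> x * y = 0.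
  move=> ij ir jr Ci Cj; apply: (CI' i j) => //.
    by have [_ _ _ CR] := iC i; apply: CR.
  by have [_ _ CL _] := iC j; apply: CL.
have cl i x : (i < r)%N -> C i x -> c i * x = x.
  move=> ir Cx; rewrite -[RHS]mul1r sum1 mulr_suml (bigD1 (Ordinal ir)) //=.
  rewrite big1 ?addr0 // => j ji; apply: (CM j i) => //; exact: Cc.
have cr i x : (i < r)%N -> C i x -> x * c i = x.
  move=> ir Cx; rewrite -[RHS]mulr1 sum1 mulr_sumr (bigD1 (Ordinal ir)) //=.
  rewrite big1 ?addr0 // => j ji; apply: (CM i j) => //; last exact: Cc.
  by rewrite eq_sym.
have r0 : (0 < r)%N.
  rewrite lt0n; apply: contraTneq (oner_neq0 B) => r0; rewrite negbK.
  by rewrite sum1 r0 big_ord0.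
have cS i : (i.+1 < r)%N -> s (c i) = c i.+1.
  move=> ir; have Cs : C i.+1 (s (c i)) by apply/sC/Cc/ltnW.
  have C's : C i (s' (c i.+1)) by have := Cc _ ir; rewrite /= /shift_ideal.
  rewrite -[LHS](cl i.+1) // -{1}[c i.+1]sK' -sM cr ?sK' //; exact: ltnW.
have it i : (i < r)%N -> iter i s (c 0%N) = c i.
  by elim: i => // i IH ir; rewrite iterS IH ?cS // ltnW.
(* Applying [s] to the decomposition of 1 shifts every component but the last; cancelling them
   identifies the image of the last one. *)
have cyc : s (c r.-1) = c 0%N.
  have := congr1 s sum1; rewrite s1 (big_morph s sD s0) {1}sum1 => E.
  clear -E cS r0; case: r E cS r0 => // m E cS _.
  move: E; rewrite big_ord_recl big_ord_recr /= addrC.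
  rewrite (eq_bigr (fun i : 'I_m => s (c i))) => [/addIr -> //|i _].
  by rewrite /bump cS ?ltnS ?ltn_ord // leq0n add1n.
have itr : iter r s (c 0%N) = c 0%N by rewrite -{1}(prednK r0) iterS it // prednK.
exists r, (c 0%N); split=> //.
- by rewrite [RHS]sum1; apply: eq_bigr => i _; rewrite it.
- move=> i j ir jr; rewrite !it //; case: eqP => [<-|/eqP ij].
    by apply: cl => //; apply: Cc.
  by apply: (CM i j) => //; apply: Cc.
split.
- move=> i ir; rewrite it //; have [_ [x Cx x0] _] := minC i.
  by apply: contraNneq x0 => ci0; rewrite -(cl i x) // ci0 mul0r.
- move=> i b ir; rewrite it //; have [C0' CD CL CR] := iC i.
  have h1 : C i (b * c i) by apply/CL/Cc.
  have h2 : C i (c i * b) by apply/CR/Cc.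
  by rewrite -(cl i _ ir h1) mulrA (cr i _ ir h2).
- move=> X x j [X0 XD XL XR] jr Xx; rewrite it // => xc.
  have [Cj0 CjD CjL CjR] := iC j.
  have [_ _ minj] := minC j.
  have [] // := minj (fun y => C j y /\ X y) (x * c j) _ _ _ xc (c j) (Cc _ jr).
  + split=> //; first by move=> u v [? ?] [? ?]; split; [apply: CjD | apply: XD].
      by move=> b u [? ?]; split; [apply: CjL | apply: XL].
    by move=> b u [? ?]; split; [apply: CjR | apply: XR].
  + by move=> u [].
  + by split; [apply/CjL/Cc | apply: XR].
Qed.

End TwistSimple.

Lemma submod_vspace (k : fieldType) (V : vectType k) (X : V -> Prop) :
  X 0 -> (forall x y, X x -> X y -> X (x + y)) -> (forall c x, X x -> X (c *: x)) ->
  exists U : {vspace V}, forall x, x \in U <-> X x.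
Proof.
move=> X0 XD XZ.
pose P n := `[< exists2 U : {vspace V}, forall x, x \in U -> X x & \dim U = n >].
have exP : exists n, P n.
  exists 0%N; apply/asboolP; exists 0%VS; last by rewrite dimv0.
  by move=> x; rewrite memv0 => /eqP ->.
have maxP n : P n -> (n <= \dim {: V})%N.
  by move=> /asboolP[U _ <-]; apply: dimvS; apply: subvf.
case: (ex_maxnP exP maxP) => n /asboolP[U UX Un] nmax.
exists U => x; split; first exact: UX.
move=> Xx; have : U == (U + <[x]>)%VS.
  rewrite eqEdim addvSl Un; apply: nmax; apply/asboolP; exists (U + <[x]>)%VS => //.
  by move=> _ /memv_addP[u uU [w /vlineP[c ->] ->]]; apply: XD; [apply: UX | apply: XZ].
by move/eqP->; apply: (subvP (addvSr U <[x]>)); apply: memv_line.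
Qed.

Section ResidueIdempotents.
Variables (S : dvrType) (gT : finGroupType) (a : ring_action gT S).
Hypothesis a_faithful : forall g, a g =1 id -> g = 1%g.
Variable f : cocycle a.

Local Notation k := (residue S).
Local Notation ak := (residue_act a).
Local Notation chi := (tame_char a).
Local Notation fk := (residue_fcocycle f).
Local Notation B := (crossed fk).
Local Notation W := (wild_group a).
Local Notation aug := (aug W).
Local Notation U := (crossed_U fk).
Local Notation s := (@rtwist S gT a f).

Hypothesis wdiv : wild_division f.

Lemma wdiv_inv (x : B) : supported W x -> x != 0 ->
  exists y, [/\ supported W y, x * y = 1 & y * x = 1].
Proof.
move=> sx x0; apply: reduced_inv => //.
by apply: contraNneq x0 => /(wdiv sx) ->.
Qed.

(** On scalars the augmentation is the [#|W|]-th power, so both sides have the same augmentation,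
    which is now injective. *)
Lemma wdiv_expq (x : B) : supported W x -> x ^+ #|W| = U 1%g (aug x).
Proof.
move=> sx; apply/eqP; rewrite -subr_eq0; apply/eqP/wdiv.
  by apply: supportedB; [apply: supportedX | apply: supportedU].
rewrite waugB // [aug (U _ _)]augU // wtau1 mulr1.
suff -> : aug (x ^+ #|W|) = aug x ^+ #|W| by rewrite subrr.
elim: #|W| => [|n IH]; first by rewrite !expr0 aug1.
by rewrite !exprS waugM ?IH //; apply: supportedX.
Qed.

(** Take [x] in [X] of least support, translated so that 1 is in the support. Its commutator with a
    scalar [t] and the difference [s x - x] both lose the coefficient at 1, so they vanish unless
    [X] contains 1. The first confines the support to inertia, the second to the kernel of [chi];
    then [x] lives over [W] and is a unit. *)
Lemma rtwist_simple (X : B -> Prop) x : is_ideal X -> (forall y, X y -> X (s y)) ->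
  X x -> x != 0 -> X 1.
Proof.
move=> [X0 XD XL XR] Xs; have [n] := ubnP #|[set g | x g != 0]|.
elim: n x => // n IH x; rewrite ltnS => xn Xx x0.
have [g xg] : exists g, x g != 0.
  apply: contrapT => H; case/eqP: x0; apply/ffunP => g; rewrite crossed_0E.
  by apply: contrapT => /eqP xg; apply: H; exists g.
wlog g1 : x g xn Xx x0 xg / g = 1%g.
  move=> wl; pose y := x * U g^-1%g 1.
  have yE h : (y h == 0) = (x (h * g)%g == 0).
    by rewrite crossed_mul_UE invgK rmorph1 mulr1 mulf_eq0
      (negPf (_ : fk _ _ != 0)) ?orbF // -unitfE cocycle_unit.
  apply: (wl y 1%g) => //; last by rewrite yE mul1g.
  - apply: leq_trans xn; rewrite -(card_imset _ (mulIg g)).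
    apply: subset_leq_card; apply/fintype.subsetP => _ /imsetP[h hy ->].
    by move: hy; rewrite !inE yE.
  - exact: XR.
  - by apply/eqP => y0; have := yE 1%g; rewrite y0 crossed_0E eqxx mul1g (negPf xg).
rewrite {g}g1 in xg.
have small (y : B) : X y -> (forall h, x h = 0 -> y h = 0) -> y 1%g = 0 -> y = 0 \/ X 1.
  move=> Xy sub y1; have [->|y0] := eqVneq y 0; [by left|right].
  apply: (IH y) => //; apply: leq_trans xn; apply: proper_card; apply/properP; split.
    apply/fintype.subsetP => h; rewrite !inE; apply: contraNneq => /sub ->.
    by [].
  by exists 1%g; rewrite !inE // y1 eqxx.
have XN y : X y -> X (- y) by move=> Xy; rewrite -mulN1r; apply: XL.
have H1 h : x h != 0 -> X 1 \/ h \in inertia a.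
  move=> xh; have [X1|X1] := pselect (X 1); [by left|right].
  apply/inertiaP => t.
  have [|||y0|//] := small (x * U 1%g t + - (U 1%g t * x)).
  - by apply: XD; [apply: XR | apply/XN/XL].
  - move=> l xl; rewrite crossed_subE crossed_mul_U1E crossed_U1_mulE xl.
    by rewrite mul0r mulr0 subrr.
  - by rewrite crossed_subE crossed_mul_U1E crossed_U1_mulE ract1 mulrC subrr.
  have /ffunP/(_ h) := y0; rewrite crossed_subE crossed_mul_U1E crossed_U1_mulE.
  rewrite [t * _]mulrC -mulrBr crossed_0E => /eqP.
  by rewrite mulf_eq0 (negPf xh) subr_eq0 => /eqP.
have H2 h : x h != 0 -> X 1 \/ chi h = 1.
  move=> xh; have [X1|X1] := pselect (X 1); [by left|right].
  have [|||y0|//] := small (s x + - x).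
  - by apply: XD; [apply: Xs | apply: XN].
  - by move=> l xl; rewrite crossed_subE ffunE xl mul0r subrr.
  - by rewrite crossed_subE ffunE chi1 mulr1 subrr.
  have /ffunP/(_ h) := y0; rewrite crossed_subE ffunE crossed_0E.
  rewrite -{2}[x h]mulr1 -mulrBr => /eqP.
  by rewrite mulf_eq0 (negPf xh) subr_eq0 => /eqP.
have [//|X1] := pselect (X 1).
have sx : supported W x.
  move=> h; apply: contraNeq => xh; apply/wildP.
  by split; [case: (H1 _ xh) | case: (H2 _ xh)].
have [y [_ _ yx]] := wdiv_inv sx x0.
by rewrite -yx; apply: XL.
Qed.

Definition runtwist (x : B) : B := [ffun g => x g / chi g].

Lemma rtwistK : cancel s runtwist.
Proof. by move=> x; apply/ffunP => g; rewrite !ffunE mulfK ?chi_neq0. Qed.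
Lemma runtwistK : cancel runtwist s.
Proof. by move=> x; apply/ffunP => g; rewrite !ffunE divfK ?chi_neq0. Qed.

Lemma residue_idempotents : exists r (e : B),
  [/\ (0 < r)%N, iter r s e = e, \sum_(i < r) iter i s e = 1,
   forall i j, (i < r)%N -> (j < r)%N ->
     iter i s e * iter j s e = if i == j then iter i s e else 0 &
   [/\ forall i, (i < r)%N -> iter i s e != 0,
   forall i b, (i < r)%N -> b * iter i s e = iter i s e * b &
   forall X x j, is_ideal X -> (j < r)%N -> X x -> x * iter j s e != 0 ->
      X (iter j s e)]].
Proof.
pose V : vectType k := {ffun gT -> k^o}.
have vs (X : B -> Prop) : is_ideal X ->
    exists U : {vspace V}, forall x, x \in U <-> X x.
  move=> [X0 XD XL _]; apply: submod_vspace => // c x /(XL (U 1%g c)).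
  congr X; apply/ffunP => g; rewrite crossed_U1_mulE.
  by rewrite !ffunE.
pose sp (X : B -> Prop) : {vspace V} :=
  if pselect (is_ideal X) is left iX then sval (cid (vs X iX)) else 0%VS.
have spP X x : is_ideal X -> (x \in sp X <-> X x).
  by move=> iX; rewrite /sp; case: pselect => // iX'; case: cid.
apply: (@twist_simple_idempotents B s runtwist (fun X => \dim (sp X)) (\dim {: V})).
- exact: rtwistD.
- exact: rtwistM.
- exact: rtwist1.
- exact: rtwistK.
- exact: runtwistK.
- move=> X Y iX iY sub le y /(spP _ _ iY) Yy; apply/(spP _ _ iX).
  suff -> : sp X = sp Y by [].
  apply/eqP; rewrite eqEdim le andbT; apply/subvP => x /(spP _ _ iX) Xx.
  by apply/(spP _ _ iY)/sub.
- by move=> X iX; apply: dimvS; apply: subvf.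
- exact: rtwist_simple.
Qed.

End ResidueIdempotents.

Lemma mulr_swap (R : nzRingType) (u x u' x' : R) :
  u' * x = x * u' -> u * x * (u' * x') = u * u' * (x * x').
Proof. by move=> E; rewrite !mulrA -[u * x * u']mulrA -E mulrA. Qed.

Lemma mulr_conj (R : nzRingType) (u z z' x : R) :
  u * z = z' * u -> u * x = x * u -> u * (z * x) = z' * x * u.
Proof. by move=> E1 E2; rewrite mulrA E1 -mulrA E2 mulrA. Qed.

Lemma cocycle_of_assoc (R : nzRingType) (x y z xy yz xyz c1 c2 c3 c3' c4 : R) :
  x * y = c1 * xy -> xy * z = c2 * xyz -> y * z = c3 * yz -> x * c3 = c3' * x ->
  x * yz = c4 * xyz -> c3' * c4 * xyz = c1 * c2 * xyz.
Proof.
move=> E1 E2 E3 E4 E5.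
by rewrite -mulrA -E5 mulrA -E4 -mulrA -E3 mulrA E1 -mulrA E2 mulrA.
Qed.

Lemma coboundary_cancel (F : fieldType) (x y z w : F) :
  x != 0 -> y != 0 -> z != 0 -> w = x^-1 * y^-1 * z^-1^-1 * (x * y * w / z).
Proof.
move=> x0 y0 z0; rewrite invrK -invfM -[x * y * w / z]mulrA mulrACA.
by rewrite mulVf ?mulf_neq0 // mul1r mulrC divfK.
Qed.

Lemma coboundary_cancelV (F : fieldType) (x y z w : F) :
  x != 0 -> y != 0 -> x^-1 * y^-1 * (x * y * z * w) = w * z.
Proof.
by move=> x0 y0; rewrite -invfM -[x * y * z * w]mulrA mulKf ?mulf_neq0 // mulrC.
Qed.

Lemma comm_cancel (R : nzRingType) (w w' u : R) :
  w' * w = 1 -> w * (w * u) = w * u * w -> w * u = u * w.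
Proof.
move=> w'w /(congr1 (fun y => w' * y)).
by rewrite !mulrA w'w !mul1r.
Qed.

(** * Idempotents and the conductor *)

Section Conductor.
Variables (S : dvrType) (gT : finGroupType) (a : ring_action gT S).
Hypothesis a_faithful : forall g, a g =1 id -> g = 1%g.
Variable f : cocycle a.

Local Notation k := (residue S).
Local Notation ak := (residue_act a).
Local Notation chi := (tame_char a).
Local Notation fk := (residue_fcocycle f).
Local Notation B := (crossed fk).
Local Notation W := (wild_group a).
Local Notation aug := (aug W).
Local Notation U := (crossed_U fk).
Local Notation s := (@rtwist S gT a f).

Hypothesis wdiv : wild_division f.
Variables (r : nat) (e : B).
Hypothesis r_gt0 : (0 < r)%N.
Hypothesis e_cyc : iter r s e = e.
Hypothesis e_sum : \sum_(i < r) iter i s e = 1.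
Hypothesis e_orth : forall i j, (i < r)%N -> (j < r)%N ->
  iter i s e * iter j s e = if i == j then iter i s e else 0.
Hypothesis e_neq0 : forall i, (i < r)%N -> iter i s e != 0.
Hypothesis e_central : forall i b, (i < r)%N -> b * iter i s e = iter i s e * b.
Hypothesis e_simple : forall X x j, is_ideal X -> (j < r)%N -> X x ->
  x * iter j s e != 0 -> X (iter j s e).

Lemma iter_rtwistE i g : iter i s e g = e g * chi g ^+ i.
Proof.
elim: i => [|i IH]; first by rewrite expr0 mulr1.
by rewrite iterS ffunE IH -mulrA -exprSr.
Qed.

Lemma e1E : r%:R * e 1%g = 1.
Proof.
have /ffunP/(_ 1%g) := e_sum; rewrite crossed_sumE crossed_1E eqxx.
under eq_bigr => i _ do rewrite iter_rtwistE chi1 expr1n mulr1.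
by rewrite sumr_const card_ord mulr_natl.
Qed.

Lemma r_neq0 : r%:R != 0 :> k.
Proof. by apply: contraTneq (oner_neq0 k) => r0; rewrite -e1E r0 mul0r eqxx. Qed.

Lemma e_inertia g : e g != 0 -> g \in inertia a.
Proof.
move=> eg; apply/inertiaP => y; have := e_central (U 1%g y) r_gt0.
move=> /ffunP/(_ g); rewrite crossed_U1_mulE crossed_mul_U1E mulrC => /(mulfI eg).
by [].
Qed.

Lemma e_chi g : e g != 0 -> chi g ^+ r = 1.
Proof.
move=> eg; have /ffunP/(_ g) := e_cyc; rewrite iter_rtwistE => E.
by apply: (mulfI eg); rewrite E mulr1.
Qed.

(** The Fourier transform along the cycle of idempotents. For an [r]-th root of unity [z] it is [r]
    times the part of [e] on which [chi] equals [z] ([fourierE]), while orthogonality makes it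
    multiplicative in [z] ([fourierM]). *)
Definition fourier (z : k) : B := \sum_(i < r) U 1%g (z ^- i) * iter i s e.
Local Notation v := fourier.

Lemma fourierE z g : z ^+ r = 1 ->
  v z g = if chi g == z then r%:R * e g else 0.
Proof.
move=> zr; have z0 : z != 0.
  by apply: contraTneq (oner_neq0 k) => z0; rewrite -zr z0 expr0n gtn_eqF ?eqxx.
rewrite crossed_sumE.
transitivity (e g * \sum_(i < r) (chi g / z) ^+ i).
  rewrite mulr_sumr; apply: eq_bigr => i _.
  by rewrite crossed_U1_mulE iter_rtwistE exprMn exprVn mulrCA [z ^- i * _]mulrC.
have [->|eg] := eqVneq (e g) 0; first by rewrite mul0r mulr0 if_same.
case: eqP => [->|/eqP ne].
  rewrite divff //; under eq_bigr => i _ do rewrite expr1n.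
  by rewrite sumr_const card_ord mulrC.
have : (chi g / z) ^+ r - 1 = 0.
  by rewrite exprMn exprVn zr (e_chi eg) invr1 mulr1 subrr.
rewrite subrX1 => /eqP; rewrite mulf_eq0 subr_eq0 => /orP[/eqP E|/eqP ->].
  by case/eqP: ne; rewrite -[RHS]mul1r -E divfK.
by rewrite mulr0.
Qed.

Lemma U1_central y i : (i < r)%N -> U 1%g y * iter i s e = iter i s e * U 1%g y.
Proof. exact: e_central. Qed.

Lemma fourierM z z' : v z * v z' = v (z * z').
Proof.
rewrite mulr_suml; apply: eq_bigr => i _.
rewrite mulr_sumr (bigD1 i) //= [X in _ + X]big1 ?addr0 => [|j ji].
  rewrite (mulr_swap _ _ (U1_central _ (ltn_ord i))) (e_orth (ltn_ord i) (ltn_ord i)).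
  by rewrite eqxx crossed_U1K exprMn invfM.
have ij : (i == j :> nat) = false by apply/negbTE; rewrite eq_sym.
rewrite (mulr_swap _ _ (U1_central _ (ltn_ord i))) (e_orth (ltn_ord i) (ltn_ord j)).
by rewrite ij mulr0.
Qed.

Lemma fourier1 : v 1 = 1.
Proof.
rewrite -[RHS]e_sum; apply: eq_bigr => i _.
by rewrite expr1n invr1 mul1r.
Qed.

Lemma fourierX z n : v z ^+ n = v (z ^+ n).
Proof.
elim: n => [|n IH]; first by rewrite !expr0 fourier1.
rewrite (exprS z n) -fourierM -IH.
exact: (exprS (v z) n).
Qed.

Lemma fourier_conj h z : U h 1 * v z = v (ak h z) * U h 1.
Proof.
rewrite mulr_sumr mulr_suml; apply: eq_bigr => i _.
apply: mulr_conj (e_central _ (ltn_ord i)).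
rewrite !crossed_UU mulg1 mul1g !mul1r rmorph1.
by rewrite mulr1 cocycle1l cocycle1r !mulr1 fmorphV rmorphXn.
Qed.

Lemma fourier_comm z (y : B) : (forall g, g \notin inertia a -> y g = 0) ->
  y * v z = v z * y.
Proof.
move=> sy; rewrite mulr_sumr mulr_suml; apply: eq_bigr => i _.
apply: mulr_conj (e_central _ (ltn_ord i)).
apply/ffunP => g; rewrite crossed_U1_mulE crossed_mul_U1E mulrC.
have [/inertiaP gI|/sy ->] := boolP (g \in inertia a); first by rewrite gI.
by rewrite !mulr0.
Qed.

Lemma wild_coprime : coprime r #|W|.
Proof.
rewrite coprime_sym; apply: (@pnat_coprime [pchar k]); first exact: wild_pnat.
apply/pnatP => // l lp lr; rewrite !inE lp /=.
apply: contraNneq r_neq0 => l0; have /dvdnP[c ->] := lr.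
by rewrite natrM l0 mulr0.
Qed.

Lemma crossed_UX g n : exists2 c, c != 0 & U g 1 ^+ n = U (g ^+ n)%g c.
Proof.
elim: n => [|n [c c0 IH]]; first by exists 1; rewrite ?oner_neq0 ?expr0 ?expg0.
exists (ak g c * fk g (g ^+ n)%g); last by rewrite exprS IH crossed_UU expgS mul1r.
by rewrite mulf_neq0 ?fmorph_eq0 // -unitfE cocycle_unit.
Qed.

(* [fourier (chi g)] is a [W]-translate of a homogeneous element [U_g0] with
   [g0] of order prime to the characteristic; the [W]-factor has both its r-th
   and its [#|W|]-th powers in the residue field, hence is a scalar. *)
Lemma fourier_homogeneous g h : e g != 0 -> e h != 0 -> chi g = chi h -> g = h.
Proof.
move=> eg eh gh; pose z := chi g; have zr : z ^+ r = 1 by apply: e_chi.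
(* With [m] congruent to 1 modulo [r] and to 0 modulo the order of [W], the power [g ^+ m] keeps the
   character value of [g] and has order dividing [r]. *)
pose m := chinese r #|W| 1 0.
have m1 : m = 1 %[mod r] by apply: chinese_modl; apply: wild_coprime.
have mW : (#|W| %| m)%N.
  by rewrite /dvdn (chinese_modr wild_coprime) mod0n.
have gI := e_inertia eg.
pose g0 := (g ^+ m)%g.
have g0I : g0 \in inertia a by apply: groupX.
have chi0 : chi g0 = z.
  rewrite chiX_inertia // (divn_eq m r) m1 -/z exprD mulnC exprM zr expr1n mul1r.
  have [r1|r1] := leqP r 1; last by rewrite modn_small.
  have r1' : r = 1%N by apply/eqP; rewrite eqn_leq r1.
  by rewrite r1' modn1 expr0 -zr r1' expr1.
have g0r : (g0 ^+ r)%g = 1%g.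
  rewrite -expgM mulnC expgM; have /dvdnP[c ->] := mW.
  rewrite mulnC expgM; have gW : (g ^+ r)%g \in W.
    by apply/wildP; rewrite groupX // chiX_inertia // -/z zr.
  by rewrite expg_cardG // expg1n.
have [c c0 Ur] := crossed_UX g0 r; rewrite g0r in Ur.
pose w := v z * Uinv fk g0.
have sw : supported W w.
  move=> l lW; rewrite crossed_mul_UE invgK fourierE //.
  case: eqP => [E|_]; last by rewrite !mul0r.
  have [->|el] := eqVneq (e (l * g0)%g) 0; first by rewrite mulr0 !mul0r.
  case/negP: lW; apply/wildP.
  have lI : l \in inertia a by rewrite -(groupMr _ g0I) e_inertia.
  split=> //; apply: (mulIf (chi_neq0 a g0)).
  by rewrite -chiM_inertia // E mul1r chi0.
have vE : v z = w * U g0 1 by rewrite -mulrA mulUinvV mulr1.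
have vr : v z ^+ r = 1 by rewrite fourierX zr fourier1.
have w0 : w != 0.
  apply: contraTneq (oner_neq0 B) => w0; rewrite -vr vE w0 mul0r.
  by rewrite expr0n gtn_eqF ?eqxx.
have [w' [sw' ww' w'w]] := wdiv_inv a_faithful wdiv sw w0.
have swI l : l \notin inertia a -> w l = 0.
  by move=> lI; apply: sw; apply: contra lI => /wildP[].
have comm : GRing.comm w (U g0 1).
  by apply: (comm_cancel w'w); rewrite -vE; apply: fourier_comm.
have wr : w ^+ r = U 1%g c^-1.
  have : w ^+ r * U 1%g c = 1 by rewrite -Ur -exprMn_comm // -vE.
  move/(congr1 (fun y => y * U 1%g c^-1)).
  by rewrite -mulrA crossed_U1K divff // mul1r [w ^+ r * 1]mulr1.
have U1X y n : U 1%g y ^+ n = U 1%g (y ^+ n).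
  by elim: n => [|n IH]; rewrite ?expr0 // !exprS IH crossed_U1K.
have [d wE] : exists d, w = U 1%g d.
  have wq : w ^+ #|W| = U 1%g (aug w) by apply: wdiv_expq.
  have aw : aug w != 0 by apply: contraNneq w0 => /(wdiv sw) ->.
  have := wild_coprime; rewrite /coprime.
  case: (egcdnP #|W| r_gt0) => u t E _ /eqP gc.
  rewrite gc in E.
  exists ((aug w ^+ t)^-1 * (c^-1) ^+ u).
  have : w ^+ (u * r) = w ^+ (t * #|W|) * w by rewrite E exprD expr1.
  rewrite mulnC exprM wr [(t * _)%N]mulnC exprM wq !U1X.
  move/(congr1 (fun y => U 1%g (aug w ^+ t)^-1 * y)).
  rewrite mulrA !crossed_U1K mulVf ?expf_neq0 // => ->.
  by rewrite [U 1%g 1 * w]mul1r.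
have vg0 l : v z l != 0 -> l = g0.
  rewrite vE wE crossed_UU mul1g crossed_UE; case: (l =P g0) => // _.
  by rewrite eqxx.
have vn l : e l != 0 -> chi l = z -> v z l != 0.
  by move=> el cl; rewrite fourierE // cl eqxx mulf_neq0 ?r_neq0.
by transitivity g0; [|symmetry]; apply: vg0; apply: vn.
Qed.

(** The future conductor: a normal subgroup on which [chi] is injective, and the largest one in the
    inertia group from which the class is inflated. *)
Definition esupp : {set gT} := [set g | e g != 0].

Lemma fourierU g : e g != 0 -> v (chi g) = U g (r%:R * e g).
Proof.
move=> eg; apply/ffunP => h; rewrite fourierE ?e_chi // crossed_UE.
have [->|hg] := eqVneq h g; first by rewrite eqxx.
case: eqP => // E; have [->|eh] := eqVneq (e h) 0; first by rewrite mulr0.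
by case/eqP: hg; apply: fourier_homogeneous.
Qed.

Lemma fourier_supp z g : z ^+ r = 1 -> v z g != 0 -> e g != 0.
Proof.
move=> zr; rewrite fourierE //; case: (chi g =P z) => [_|_]; last by rewrite eqxx.
by apply: contraNneq => ->; rewrite mulr0.
Qed.

Lemma re_neq0 g : e g != 0 -> r%:R * e g != 0.
Proof. by move=> eg; rewrite mulf_neq0 ?r_neq0. Qed.

Lemma residue_cocycle_neq0 g h : fk g h != 0.
Proof. by rewrite -unitfE cocycle_unit. Qed.

Lemma esupp_group_set : group_set esupp.
Proof.
apply/group_setP; split=> [|g h]; rewrite !inE.
  by apply: contraTneq (oner_neq0 k) => E; rewrite -e1E E mulr0 eqxx.
move=> eg eh; apply: (@fourier_supp (chi g * chi h)).
  by rewrite exprMn !e_chi // mulr1.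
rewrite -fourierM !fourierU // crossed_UU crossed_UE eqxx.
rewrite mulf_neq0 ?residue_cocycle_neq0 // mulf_neq0 ?re_neq0 // fmorph_eq0.
exact: re_neq0.
Qed.
Canonical esupp_group := Group esupp_group_set.
Local Notation N := esupp_group.

Lemma esuppP g : reflect (e g != 0) (g \in N).
Proof. by rewrite inE; apply: idP. Qed.

Lemma esuppJ g h : g \in N -> (h * g * h^-1)%g \in N.
Proof.
move=> /esuppP eg; apply/esuppP; apply: (@fourier_supp (ak h (chi g))).
  by rewrite -rmorphXn e_chi // rmorph1.
have /ffunP/(_ (h * g)%g) := fourier_conj h (chi g).
rewrite fourierU // crossed_UU crossed_UE eqxx crossed_mul_UE.
move=> E; apply/eqP => v0; move: E; rewrite v0 !mul0r => /eqP; apply/negP.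
by rewrite mul1r mulf_neq0 ?residue_cocycle_neq0 // fmorph_eq0 re_neq0.
Qed.

Lemma esupp_normal : (N <| [set: gT])%g.
Proof.
rewrite /normal subsetT; apply/fintype.subsetP => h _; rewrite inE.
apply/fintype.subsetP => _ /imsetP[g gN ->].
by have := esuppJ h^-1 gN; rewrite invgK conjgE mulgA.
Qed.

(** The character embeds the support into the [r]-th roots of unity. Conversely, its [#|N|]-th power
    is trivial there, so [s] iterated [#|N|] times fixes [e]; orthogonality forbids this for an
    exponent below [r]. *)
Lemma card_esupp : #|N| = r.
Proof.
apply/eqP; rewrite eqn_leq; apply/andP; split.
  rewrite cardE -(size_map chi); apply: max_unity_roots => //.
    apply/allP => _ /mapP[g gN ->]; rewrite unity_rootE e_chi //.
    by move: gN; rewrite mem_enum => /esuppP.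
  rewrite map_inj_in_uniq ?enum_uniq // => g h; rewrite !mem_enum.
  by move=> /esuppP eg /esuppP eh; apply: fourier_homogeneous.
rewrite leqNgt; apply/negP => lt.
have eE : iter #|N| s e = e.
  apply/ffunP => g; rewrite iter_rtwistE; have [->|eg] := eqVneq (e g) 0; first by rewrite mul0r.
  rewrite -chiX_inertia ?e_inertia // expg_cardG ?chi1 ?mulr1 //.
  exact/esuppP.
have := e_orth lt r_gt0; rewrite eE /= gtn_eqF ?cardG_gt0 // => e0.
have := e_orth r_gt0 r_gt0; rewrite eqxx /= e0 => E.
by have := e_neq0 r_gt0; rewrite /= -E eqxx.
Qed.

Lemma U1_inj g d y y' : d != 0 -> U 1%g y * U g d = U 1%g y' * U g d -> y = y'.
Proof.
move=> d0 /ffunP/(_ g); rewrite !crossed_U1_mulE crossed_UE eqxx.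
exact: mulIf.
Qed.

(** The units [v (chi n)] are multiples of [U n 1] and multiplicative in [n], so they split the
    cocycle on [N]. Combined with coset representatives they give a rescaled basis [V] with
    [V (g * n) = V g * v (chi n)], whose cocycle [F] depends only on cosets of [N]. *)
Lemma esupp_inflated : inflated_from f N.
Proof.
pose t g : gT := fingroup.repr (coset N g).
have nN g : g \in 'N(N)%g by rewrite (fintype.subsetP (normal_norm esupp_normal)) ?inE.
have tE g : coset N (t g) = coset N g by rewrite /t coset_reprK.
have tN g : ((t g)^-1 * g)%g \in N.
  apply: coset_idr; first by rewrite groupM ?groupV ?nN.
  by rewrite morphM ?groupV ?nN //= morphV ?nN //= tE mulVg.
have tMn g n : n \in N -> t (g * n)%g = t g.
  by move=> nN'; rewrite /t coset_kerr.
pose V g : B := U (t g) 1 * v (chi ((t g)^-1 * g)%g).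
pose d g : k := ak (t g) (r%:R * e ((t g)^-1 * g)%g) * fk (t g) ((t g)^-1 * g)%g.
have VE g : V g = U g (d g).
  rewrite /V fourierU; last exact/esuppP/tN.
  by rewrite crossed_UU mulKVg mul1r /d.
have d0 g : d g != 0 by rewrite mulf_neq0 ?residue_cocycle_neq0 // fmorph_eq0 re_neq0 //; apply/esuppP/tN.
have VM g n : n \in N -> V (g * n)%g = V g * v (chi n).
  move=> nN'; rewrite /V (tMn g n nN') (mulgA (t g)^-1%g g n).
  have gI : ((t g)^-1 * g)%g \in inertia a by apply/e_inertia/esuppP/tN.
  rewrite (chiM_inertia n gI) -(fourierM (chi ((t g)^-1 * g)%g)).
  exact: (mulrA (U (t g) 1)).
have U1V g y y' : U 1%g y * V g = U 1%g y' * V g -> y = y'.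
  by rewrite VE; apply: U1_inj.
pose F g h := d g * ak g (d h) * fk g h / d (g * h)%g.
have VV g h : V g * V h = U 1%g (F g h) * V (g * h)%g.
  by rewrite !VE !crossed_UU mul1g ract1 cocycle1l mulr1 divfK.
have V1 : V 1%g = 1.
  have t1 : t 1%g = 1%g by rewrite /t coset_id ?repr_coset1.
  by rewrite /V t1 mulg1 invg1 chi1 fourier1 mulr1.
have d1 : d 1%g = 1.
  by have /ffunP/(_ 1%g) := V1; rewrite VE crossed_UE crossed_1E eqxx.
have Fr g h n : n \in N -> F g (h * n)%g = F g h.
  move=> nN'; apply: (U1V (g * (h * n))%g); rewrite -VV (VM h n nN').
  rewrite (mulrA (V g) (V h)) (VV g h) -(mulrA (U 1%g (F g h))).
  by rewrite -(VM (g * h)%g n nN') mulgA.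
have VJ n h : n \in N -> v (chi n) * V h = V h * v (chi (h^-1 * n * h)%g).
  move=> nN'; rewrite VE crossed_U_scale -(mulrA (U 1%g (d h))).
  have := fourier_conj h (chi (h^-1 * n * h)%g).
  have nI : n \in inertia a by apply/e_inertia/esuppP.
  have -> : chi (h^-1 * n * h)%g = ak h^-1%g (chi n) by rewrite -chiJ ?invgK.
  rewrite ractKV => ->; rewrite (mulrA (v _)) (mulrA (U 1%g _)); congr (_ * _).
  apply: esym; apply: fourier_comm => g gI; rewrite crossed_UE; case: eqP => // E.
  by rewrite E group1 in gI.
have Fl g h n : n \in N -> F (g * n)%g h = F g h.
  move=> nN'; have nJ : (h^-1 * n * h)%g \in N.
    by have := esuppJ h^-1 nN'; rewrite invgK.
  apply: (U1V (g * n * h)%g); rewrite -VV (VM g n nN').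
  rewrite -(mulrA (V g)) (VJ n h nN') (mulrA (V g) (V h)) (VV g h).
  rewrite -(mulrA (U 1%g (F g h))) -(VM _ _ nJ).
  by rewrite !mulgA mulgK.
have FE g h : F g h = F (t g) (t h).
  by rewrite -[in LHS](mulKVg (t g) g) -[in LHS](mulKVg (t h) h) Fl ?Fr ?tN.
have Fneq0 g h : F g h != 0.
  by rewrite mulf_neq0 ?invr_eq0 // mulf_neq0 ?residue_cocycle_neq0 // mulf_neq0 // fmorph_eq0.
have Fcocycle g h l : ak g (F h l) * F g (h * l)%g = F g h * F (g * h)%g l.
  have VU y : V g * U 1%g y = U 1%g (ak g y) * V g.
    by rewrite VE !crossed_UU mulg1 mul1g cocycle1l cocycle1r !mulr1 ract1 mulrC.
  apply: (U1V (g * h * l)%g).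
  rewrite -(crossed_U1K fk (ak g (F h l)) (F g (h * l)%g)).
  rewrite -(crossed_U1K fk (F g h) (F (g * h)%g l)).
  apply: (cocycle_of_assoc (VV g h) (VV (g * h)%g l) (VV h l) (VU (F h l))).
  by rewrite -mulgA; apply: VV.
exists (fun x y => F (fingroup.repr x) (fingroup.repr y)); split.
  split=> [x y|x|x y z].
  - by rewrite unitfE Fneq0.
  - have F1l h : F 1%g h = 1.
      by rewrite /F d1 mul1g cocycle1l ract1 !mul1r mulr1 divff.
    have F1r h : F h 1%g = 1.
      by rewrite /F d1 mulg1 cocycle1r rmorph1 !mulr1 divff.
    by rewrite repr_coset1.
  - rewrite /coset_act.
    have E (x' y' : coset_of N) : fingroup.repr (x' * y')%g
        = t (fingroup.repr x' * fingroup.repr y')%g.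
      by rewrite /t morphM ?nN //= !coset_reprK.
    have tt (x' : coset_of N) : t (fingroup.repr x') = fingroup.repr x'.
      by rewrite /t coset_reprK.
    rewrite !E -{2}[fingroup.repr x]tt -{3}[fingroup.repr z]tt -!FE.
    exact: Fcocycle.
exists (fun g => (d g)^-1); split=> [g|g h]; first by rewrite unitfE invr_eq0.
rewrite -/(t g) -/(t h) -FE /F fmorphV.
have -> : residue_cocycle f g h = fk g h by [].
by apply: coboundary_cancel; rewrite ?fmorph_eq0.
Qed.

(** Inflation gives a basis [V] that is multiplicative on [K], and the sum [eps] of [V] over [K] is
    central with [eps * eps = #|K|%:R * eps]. On each simple factor [eps] is therefore zero or
    [#|K|%:R], so it is a combination of the translates of [e]. Its support, which contains [K],
    then lies in that of [e]. *)
Lemma inflated_sub_esupp (K : {group gT}) : K \subset inertia a ->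
  (K <| [set: gT])%g -> inflated_from f K -> K \subset N.
Proof.
move=> KI nK [f' [[f'u f'1 _] [c [cU cE]]]].
have c0 g : c g != 0 by rewrite -unitfE cU.
pose V g : B := U g (c g)^-1.
have VV g h : V g * V h = U 1%g (f' (coset K g) (coset K h)) * V (g * h)%g.
  rewrite !crossed_UU mul1g cocycle1l mulr1 ract1; congr (U _ _).
  by rewrite [fk g h]cE fmorphV coboundary_cancelV ?fmorph_eq0.
pose eps : B := \sum_(h in K) V h.
have cK h : h \in K -> coset K h = 1%g by apply: coset_id.
have VKl g h : h \in K -> V h * V g = V (h * g)%g.
  by move=> hK; rewrite VV cK // (f'1 _).1 mul1r.
have VKr g h : h \in K -> V g * V h = V (g * h)%g.
  by move=> hK; rewrite VV (cK h) // (f'1 _).2 mul1r.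
have Veps g : V g * eps = eps * V g.
  rewrite mulr_sumr mulr_suml.
  rewrite (eq_bigr (fun h => V (g * h)%g)) => [|h hK]; last exact: VKr.
  rewrite [RHS](eq_bigr (fun h => V (h * g)%g)) => [|h hK]; last exact: VKl.
  rewrite [RHS](reindex_inj (conjg_inj g^-1%g)) /=; apply: eq_big => h.
    by rewrite memJ_norm // (fintype.subsetP (normal_norm nK)) // inE.
  by rewrite conjgE invgK -!mulgA mulVg mulg1.
have eps_central b : b * eps = eps * b.
  have -> : b = \sum_g U 1%g (b g * c g) * V g.
    rewrite {1}[b]crossed_U_sum; apply: eq_bigr => g _.
    by rewrite crossed_UU mul1g cocycle1l mulr1 ract1 mulfK.
  rewrite mulr_sumr mulr_suml; apply: eq_bigr => g _.
  apply: esym; apply: mulr_conj (esym (Veps g)).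
  rewrite mulr_suml mulr_sumr; apply: eq_bigr => h hK.
  rewrite !crossed_UU mulg1 mul1g cocycle1l cocycle1r !mulr1 ract1.
  by have /inertiaP -> := fintype.subsetP KI _ hK; rewrite mulrC.
have eps2 : eps * eps = #|K|%:R * eps.
  rewrite mulr_suml mulr_natl -sumr_const; apply: eq_bigr => h hK.
  rewrite mulr_sumr [RHS](reindex_inj (mulgI h)) /=.
  apply: eq_big => [g|g gK]; first by rewrite groupMl.
  exact: VKr.
have epsE i : (i < r)%N ->
    eps * iter i s e = 0 \/ eps * iter i s e = #|K|%:R * iter i s e.
  move=> ir; have [->|nz] := eqVneq (eps * iter i s e) 0; [by left|right].
  have iX : is_ideal (fun y : B => exists b, y = b * eps).
    split=> [|_ _ [b ->] [b' ->]|b _ [b' ->]|b _ [b' ->]].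
    - by exists 0; rewrite mul0r.
    - by exists (b + b'); rewrite mulrDl.
    - by exists (b * b'); rewrite mulrA.
    - by exists (b' * b); rewrite -(mulrA b' eps b) -(eps_central b) mulrA.
  have [b bE] := e_simple iX ir (ex_intro _ 1 (esym (mul1r eps))) nz.
  by rewrite {1}bE -(eps_central (b * eps)) -(mulrA b) eps2 !mulr_natl mulrnAr -bE.
apply/fintype.subsetP => l lK; apply/esuppP.
have epsl : eps l != 0.
  rewrite crossed_sumE (bigD1 l) //= big1 ?addr0 => [|h /andP[_ hl]].
    by rewrite crossed_UE eqxx invr_eq0.
  by rewrite crossed_UE eq_sym (negPf hl).
apply: contraNneq epsl => el.
rewrite -[eps]mulr1 -e_sum mulr_sumr crossed_sumE big1 // => i _.
case: (epsE i (ltn_ord i)) => ->; first exact: crossed_0E.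
have -> : #|K|%:R = U 1%g #|K|%:R.
  elim: #|K| => [|n IH]; first by rewrite crossed_U0.
  by rewrite -addn1 !natrD crossed_UD IH.
by rewrite crossed_U1_mulE iter_rtwistE el mul0r mulr0.
Qed.

Lemma card_conductor (H : {group gT}) : is_conductor f H -> #|H| = r.
Proof.
move=> /maxgroupP[/and3P[HI nH /asboolP infH] maxH].
have HN : H \subset N by apply: inflated_sub_esupp.
rewrite -card_esupp; congr #|pred_of_set _|; apply/esym/(maxH N) => //.
apply/and3P; split; last exact/asboolP/esupp_inflated.
- by apply/fintype.subsetP => g /esuppP; apply: e_inertia.
- exact: esupp_normal.
Qed.

End Conductor.

Lemma mem_setP (T : Type) (M : classical_sets.set T) x : x \in M <-> M x.
Proof. by split=> [/classical_sets.set_mem|/classical_sets.mem_set]. Qed.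

(** * Fixed ring and orders *)

Section FixedRing.
Variables (S : dvrType) (gT : finGroupType) (a : ring_action gT S).
Hypothesis a_faithful : forall g, a g =1 id -> g = 1%g.

Local Notation fr := (@FracField.tofrac S).
Local Notation p := (unif S).

Definition fixed (s : S) : Prop := forall g, a g s = s.

Lemma fixed0 : fixed 0. Proof. by move=> g; rewrite rmorph0. Qed.
Lemma fixed1 : fixed 1. Proof. by move=> g; rewrite rmorph1. Qed.
Definition gtrace (s : S) : S := \sum_g a g s.
Lemma gtrace_fixed s : fixed (gtrace s).
Proof.
move=> h; rewrite /gtrace rmorph_sum /= [RHS](reindex_inj (mulgI h)) /=.
by apply: eq_bigr => g _; rewrite ractME.
Qed.

Lemma gtraceB s t : gtrace (s - t) = gtrace s - gtrace t.
Proof. by rewrite /gtrace -sumrB; apply: eq_bigr => g _; rewrite rmorphB. Qed.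

Lemma gtraceZ r s : fixed r -> gtrace (r * s) = r * gtrace s.
Proof.
by move=> fr'; rewrite mulr_sumr; apply: eq_bigr => g _; rewrite rmorphM fr'.
Qed.

Definition gnorm (s : S) : S := \prod_g a g s.
Lemma gnorm_fixed s : fixed (gnorm s).
Proof.
move=> h; rewrite /gnorm rmorph_prod /= [RHS](reindex_inj (mulgI h)) /=.
by apply: eq_bigr => g _; rewrite ractME.
Qed.
Lemma gnorm_neq0 s : s != 0 -> gnorm s != 0.
Proof. by move=> s0; apply/prodf_neq0 => g _; apply: ract_neq0. Qed.
Lemma gnorm_dvd s : exists b, gnorm s = b * s.
Proof.
by exists (\prod_(g | g != 1%g) a g s); rewrite /gnorm (bigD1 1%g) //= ract1 mulrC.
Qed.

(** Nondegeneracy of the trace form. A family for which the matrix of conjugates has largest rank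
    must have full column rank, since any linear relation between columns is broken by one more
    element, by independence of automorphisms. *)
Lemma trace_separating : exists m (y : 'I_m -> S),
  forall x, (forall i, gtrace (y i * x) = 0) -> x = 0.
Proof.
pose n := #|gT|.
pose M m (y : 'I_m -> S) : 'M[{fraction S}]_(m, n) :=
  \matrix_(i, j) fr (a (enum_val j) (y i)).
pose P r := `[< exists m (y : 'I_m -> S), \rank (M m y) = r >].
have exP : exists r, P r.
  by exists (\rank (M 0%N (fun=> 0))); apply/asboolP; exists 0%N, (fun=> 0).
have maxP r : P r -> (r <= n)%N by move=> /asboolP[m [y <-]]; apply: rank_leq_col.
case: (ex_maxnP exP maxP) => r /asboolP[m [y yr]] rmax.
have full : row_full (M m y).
  rewrite /row_full eqn_leq rank_leq_col leqNgt; apply/negP => lt.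
  have : kermx (M m y)^T != 0.
    by rewrite -mxrank_eq0 mxrank_ker mxrank_tr subn_eq0 -ltnNge.
  case/rowV0Pn => v /sub_kermxP vM v0.
  pose c (g : gT) := v 0 (enum_rank g).
  have [y0 y0P] : exists y0, \sum_g c g * fr (a g y0) != 0.
    apply: contrapT => H; case/eqP: v0; apply/rowP => j; rewrite mxE.
    have cE x : \sum_g c g * fr (a g x) = 0.
      by apply: contrapT => /eqP nz; apply: H; exists x.
    have := @dedekind_independence S _ gT (fun g x => fr (a g x)) c (enum_val j)
      (fun g => etrans (congr1 fr (rmorph1 (a g))) (tofrac1 _))
      (fun g x y => etrans (congr1 fr (rmorphM (a g) x y)) (tofracM _ _)) cE.
    rewrite (big_pred1 (enum_val j)) => [|g]; first by rewrite /c enum_valK.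
    apply/asboolP/eqP => [Eg|-> //]; apply/eqP; rewrite eq_mulgV1; apply/eqP.
    apply: a_faithful => x; rewrite ractME.
    have /eqP := Eg (a (enum_val j)^-1%g x); rewrite tofrac_eq => /eqP ->.
    by rewrite ractKV.
  pose y' (i : 'I_(m + 1)) := match split i with inl i => y i | inr _ => y0 end.
  pose w : 'rV_n := \row_j fr (a (enum_val j) y0).
  have ME : M (m + 1)%N y' = col_mx (M m y) w.
    by apply/matrixP => i j; rewrite !mxE /y'; case: split => ?; rewrite !mxE.
  have sub : (M m y <= M (m + 1)%N y')%MS by rewrite ME -addsmxE addsmxSl.
  have : (M (m + 1)%N y' <= M m y)%MS.
    rewrite -(geq_leqif (mxrank_leqif_sup sub)) yr; apply: rmax.
    by apply/asboolP; exists (m + 1)%N, y'.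
  rewrite ME col_mx_sub => /andP[_ /submxP[D wD]].
  case/eqP: y0P.
  have : w *m v^T = 0.
    by rewrite wD -mulmxA -[M m y]trmxK -trmx_mul vM trmx0 mulmx0.
  move/matrixP/(_ 0 0); rewrite !mxE => E.
  transitivity (\sum_j w 0 j * v^T j 0); last exact: E.
  rewrite (reindex _ (onW_bij _ (@enum_val_bij gT))) /=.
  by apply: eq_bigr => j _; rewrite !mxE /c enum_valK mulrC.
exists m, y => x xP.
have [D MD] := row_fullP full.
pose w : 'cV_n := \col_j fr (a (enum_val j) x).
have Mw : M m y *m w = 0.
  apply/matrixP => i j; rewrite !mxE.
  transitivity (fr (gtrace (y i * x))); last by rewrite xP tofrac0.
  rewrite /gtrace rmorph_sum /= [RHS](reindex _ (onW_bij _ (@enum_val_bij gT))) /=.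
  by apply: eq_bigr => l _; rewrite !mxE rmorphM tofracM.
have : w = 0 by rewrite -[w]mul1mx -MD -mulmxA Mw mulmx0.
move/matrixP/(_ (enum_rank 1%g) 0); rewrite !mxE enum_rankK ract1 => /eqP.
by rewrite tofrac_eq0 => /eqP.
Qed.

Lemma fixed_quotient (b c : S) : fixed b -> fixed c -> b != 0 ->
  (exists t, c = t * b) -> exists2 t, fixed t & c = t * b.
Proof.
move=> fb fc b0 [t tE]; exists t => // g; apply: (mulIf b0).
by rewrite -{1}(fb g) -rmorphM -tE fc.
Qed.

(** At one coordinate, a value of least valuation divides all the others, and the quotient is fixed
    because both terms are; subtracting multiples removes that coordinate. The induction is on the
    number of coordinates that are not identically zero. *)
Lemma fixed_noetherian (I : finType) (X : (I -> S) -> Prop) :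
  X (fun=> 0) -> (forall x y, X x -> X y -> X (fun i => x i - y i)) ->
  (forall r x, fixed r -> X x -> X (fun i => r * x i)) ->
  (forall x i, X x -> fixed (x i)) ->
  exists m (e : nat -> I -> S), (forall j, (j < m)%N -> X (e j)) /\
    forall x, X x -> exists2 c : nat -> S, (forall j, fixed (c j)) &
      forall i, x i = \sum_(j < m) c j * e j i.
Proof.
have [n] := ubnP #|[set i | `[< exists2 x, X x & x i != 0 >]]|.
elim: n X => // n IH X; rewrite ltnS => Xn X0 XB XZ XF.
have [[i0 [x1 Xx1 x1i0]]|H] :=
  pselect (exists i, exists2 x, X x & x i != 0); last first.
  exists 0%N, (fun _ _ => 0); split=> // x Xx; exists (fun=> 0); first by move=> _; apply: fixed0.
  move=> i; rewrite big_ord0; apply: contrapT => /eqP xi; apply: H.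
  by exists i, x.
have ex : exists m, `[< exists x, [/\ X x, x i0 != 0 & dvd m (x i0)] /\ ~ dvd m.+1 (x i0) >].
  have [m [u uU uE]] := unif_decomp x1i0; exists m; apply/asboolP; exists x1.
  by split; [split=> //; rewrite uE; apply/dvdX | rewrite uE => /dvdX; rewrite uU ltnn => /(_ isT)].
case: (ex_minnP ex) => m /asboolP[x0 [[Xx0 x0i0 x0m] x0m']] mmin.
have quo x : X x -> exists2 t, fixed t & x i0 = t * x0 i0.
  move=> Xx; apply: fixed_quotient => //; [exact: XF|exact: XF|].
  have [->|xi0] := eqVneq (x i0) 0; first by exists 0; rewrite mul0r.
  have [l [u uU uE]] := unif_decomp xi0.
  have ml : (m <= l)%N.
    apply: mmin; apply/asboolP; exists x.
    by split; [split=> //; rewrite uE; apply/dvdX | rewrite uE => /dvdX; rewrite uU ltnn => /(_ isT)].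
  have [m' [u0 u0U u0E]] := unif_decomp x0i0.
  have m'm : m' = m.
    apply/eqP; rewrite eqn_leq; apply/andP; split.
      by rewrite leqNgt; apply/negP => lt; apply: x0m'; rewrite u0E; apply/dvdX.
    by move: x0m; rewrite u0E => /dvdX; apply.
  exists (u / u0 * p ^+ (l - m)); rewrite uE u0E m'm.
  by rewrite mulrACA divrK // -exprD subnK.
pose X' x := X x /\ x i0 = 0.
have [|||||m' [e [Xe eP]]] := IH X'.
- apply: leq_trans Xn; apply: proper_card; apply/properP; split.
    apply/fintype.subsetP => i; rewrite !inE => /asboolP[x [Xx _] xi].
    by apply/asboolP; exists x.
  exists i0; rewrite !inE; first by apply/asboolP; exists x1.
  by apply/asboolP => -[x [_ ->]]; rewrite eqxx.
- by [].
- by move=> x y [Xx x0'] [Xy y0']; split; [apply: XB | rewrite x0' y0' subrr].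
- by move=> r x fr' [Xx x0']; split; [apply: XZ | rewrite x0' mulr0].
- by move=> x i [Xx _]; apply: XF.
exists m'.+1, (fun j => if j == m' then x0 else e j); split.
  move=> j; rewrite ltnS leq_eqVlt => /orP[/eqP ->|jm]; first by rewrite eqxx.
  by rewrite ltn_eqF //; case: (Xe j jm).
move=> x Xx; have [t ft tE] := quo x Xx.
have X'x : X' (fun i => x i - t * x0 i).
  by split; [apply: XB => //; apply: XZ | rewrite tE subrr].
have [c fc cE] := eP _ X'x.
exists (fun j => if j == m' then t else c j); first by move=> j; case: eqP.
move=> i; rewrite big_ord_recr /= eqxx -[LHS](subrK (t * x0 i)) cE.
by congr (_ + _); apply: eq_bigr => j _; rewrite ltn_eqF.
Qed.

End FixedRing.

(** * Orders as bounded subrings *)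

Section Orders.
Variables (S : dvrType) (gT : finGroupType) (a : ring_action gT S).
Hypothesis a_faithful : forall g, a g =1 id -> g = 1%g.
Variable f : cocycle a.

Local Notation fr := (@FracField.tofrac S).
Local Notation p := (unif S).
Local Notation fF := (fraction_cocycle f).
Local Notation A := (crossed_fraction f).
Local Notation T := (crossed_order f).

Definition embed (x : crossed f) : A := crossed_map fF fr x.
Local Notation emb := embed.

Let phi_act g s : fr (a g s) = fraction_act a g (fr s).
Proof. by rewrite /= fraction_act_tofrac. Qed.

Lemma embedE x g : emb x g = fr (x g). Proof. exact: crossed_mapE. Qed.
Lemma embedM x y : emb (x * y) = emb x * emb y. Proof. exact: crossed_mapM. Qed.
Lemma embedB x y : emb (x - y) = emb x - emb y. Proof. exact: crossed_mapB. Qed.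
Lemma embed1 : emb 1 = 1. Proof. exact: crossed_map1. Qed.
Lemma embedU g s : emb (crossed_U f g s) = crossed_U fF g (fr s).
Proof. exact: crossed_mapU. Qed.

Lemma embed_inj : injective emb.
Proof.
move=> x y E; apply/ffunP => g; have /ffunP/(_ g) := E; rewrite !embedE => /eqP.
by rewrite tofrac_eq => /eqP.
Qed.

Lemma crossed_orderP (x : A) : T x <-> exists y, x = emb y.
Proof.
split=> [[y yP]|[y ->]]; exists y; last by move=> g; apply: embedE.
by apply/ffunP => g; rewrite yP embedE.
Qed.

Definition piA : A := emb (Pi f).
Definition piAV : A := crossed_U fF 1%g (fr p)^-1.

Lemma fr_unif_neq0 : fr p != 0. Proof. by rewrite tofrac_eq0 unif_neq0. Qed.

Lemma piAK : piA * piAV = 1.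
Proof. by rewrite /piA embedU crossed_U1K divff ?fr_unif_neq0. Qed.
Lemma piAVK : piAV * piA = 1.
Proof. by rewrite /piA embedU crossed_U1K mulVf ?fr_unif_neq0. Qed.

Lemma crossed_order1 : T 1.
Proof. by apply/crossed_orderP; exists 1; rewrite embed1. Qed.
Lemma crossed_orderB x y : T x -> T y -> T (x - y).
Proof.
move=> /crossed_orderP[x' ->] /crossed_orderP[y' ->]; apply/crossed_orderP.
by exists (x' - y'); rewrite embedB.
Qed.
Lemma crossed_orderM x y : T x -> T y -> T (x * y).
Proof.
move=> /crossed_orderP[x' ->] /crossed_orderP[y' ->]; apply/crossed_orderP.
by exists (x' * y'); rewrite embedM.
Qed.
Lemma crossed_order_pi : T piA.
Proof. by apply/crossed_orderP; exists (Pi f). Qed.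

Lemma piXE n : piA ^+ n = crossed_U fF 1%g (fr (p ^+ n)).
Proof.
elim: n => [|n IH]; first by rewrite !expr0 tofrac1.
by rewrite exprS IH /piA embedU crossed_U1K -tofracM -exprS.
Qed.

Lemma crossed_order_bound x : exists n, T (piA ^+ n * x).
Proof.
have [d d0 dP] := common_denom (fun g => x g).
have [n [u uU dE]] := unif_decomp d0.
exists n, [ffun g => u^-1 * sval (cid (dP g))] => g.
rewrite piXE crossed_U1_mulE ffunE; case: cid => s /= sE.
by rewrite tofracM -sE dE mulrA -tofracM mulKr.
Qed.

Local Notation sc := (crossed_scalar f).

Lemma scalarE c (x : A) g : (sc c * x) g = c * x g.
Proof. exact: crossed_U1_mulE. Qed.

Definition bounded (M : A -> Prop) : Prop := exists n, forall x, M x -> T (piA ^+ n * x).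

(** A fixed common denominator [d], followed by traces against the separating family, embeds [M]
    into vectors over the fixed ring. Injectivity of this embedding transports generators back to
    [M]. *)
Lemma bounded_fg (M : A -> Prop) : M 0 -> (forall x y, M x -> M y -> M (x - y)) ->
  (forall r x, fixed a r -> M x -> M (sc (fr r) * x)) -> bounded M ->
  exists (n : nat) (e : 'I_n -> A), forall x,
    M x <-> exists c : 'I_n -> S, (forall i, fixed_ring a (c i)) /\
      x = \sum_i sc (fr (c i)) * e i.
Proof.
move=> M0 MB MZ [n Mn]; have [m [y yP]] := trace_separating a_faithful.
have MD x z : M x -> M z -> M (x + z).
  by move=> Mx Mz; rewrite -[z]opprK; apply: (MB) => //; rewrite -sub0r; apply: (MB).
pose d := gnorm a (p ^+ n).
have d0 : d != 0 by apply: gnorm_neq0; rewrite expf_neq0 ?unif_neq0.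
have dP x : M x -> exists s : gT -> S, forall g, fr d * x g = fr (s g).
  move=> /Mn[z zE]; have [b bE] := gnorm_dvd a (p ^+ n).
  exists (fun g => b * z g) => g; rewrite /d bE !tofracM -zE.
  by rewrite piXE crossed_U1_mulE mulrA.
pose X (v : gT * 'I_m -> S) := exists2 x, M x & exists2 s : gT -> S,
  forall g, fr d * x g = fr (s g) & forall g i, v (g, i) = gtrace a (y i * s g).
have [||||l [e [Xe eP]]] := @fixed_noetherian S gT a _ X.
- exists 0 => //; exists (fun=> 0) => [g|g i]; first by rewrite crossed_0E mulr0 tofrac0.
  by rewrite mulr0 /gtrace big1 // => h _; rewrite rmorph0.
- move=> v w [x Mx [s sE vE]] [x' Mx' [s' sE' vE']]; exists (x - x'); first exact: MB.
  exists (fun g => s g - s' g) => [g|g i].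
    by rewrite crossed_subE mulrBr sE sE' tofracB.
  by rewrite vE vE' -gtraceB mulrBr.
- move=> r v fr' [x Mx [s sE vE]]; exists (sc (fr r) * x); first exact: MZ.
  exists (fun g => r * s g) => [g|g i].
    by rewrite scalarE mulrCA sE tofracM.
  by rewrite vE -gtraceZ // mulrCA.
- move=> v [g i] [x Mx [s sE vE]]; rewrite vE; exact: gtrace_fixed.
pose w (i : 'I_l) := cid2 (Xe i (ltn_ord i)).
pose m' i := s2val (w i); have Mm' i : M (m' i) := s2valP (w i).
pose s' i := s2val (cid2 (s2valP' (w i))).
have s'E i g : fr d * m' i g = fr (s' i g) := s2valP (cid2 (s2valP' (w i))) g.
have eE (i : 'I_l) (g : gT) (j : 'I_m) : e i (g, j) = gtrace a (y j * s' i g)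
  := s2valP' (cid2 (s2valP' (w i))) g j.
exists l, m' => x; split=> [Mx|[c [fc ->]]]; last first.
  by apply: big_ind => // i _; apply: MZ => //; apply: fc.
have [s sE] := dP x Mx.
have Xx : X (fun gi => gtrace a (y gi.2 * s gi.1)) by exists x => //; exists s.
have [c fc cE] := eP _ Xx.
exists (fun i : 'I_l => c i); split=> [i|]; first exact: fc.
apply/ffunP => g; rewrite crossed_sumE.
have sc' : s g = \sum_(i < l) c i * s' i g.
  apply/eqP; rewrite -subr_eq0; apply/eqP/yP => i.
  rewrite mulrBr gtraceB (cE (g, i)) mulr_sumr.
  have gD : {morph gtrace a : u v / u + v >-> u + v}.
    by move=> u v; rewrite /gtrace -big_split; apply: eq_bigr => h _; rewrite rmorphD.
  have g0 : gtrace a 0 = 0 by rewrite /gtrace big1 // => h _; rewrite rmorph0.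
  rewrite (big_morph _ gD g0) -sumrB big1 // => j _.
  by rewrite eE [y i * (c j * _)]mulrCA (gtraceZ _ (fc j)) subrr.
apply: (mulfI (_ : fr d != 0)); first by rewrite tofrac_eq0.
rewrite sE sc' rmorph_sum mulr_sumr /=; apply: eq_bigr => i _.
by rewrite scalarE mulrCA s'E tofracM.
Qed.

(** Above [T], spanning over the fraction field is automatic, since norms clear denominators by
    fixed elements. *)
Lemma is_order_overP (M : set A) : (forall x, T x -> M x) ->
  is_order M <-> [/\ forall x y, M x -> M y -> M (x - y),
    forall x y, M x -> M y -> M (x * y) & bounded M].
Proof.
move=> TM; split.
  move=> [[_ MB MM] [n [e eP]] _]; split.
  - by move=> x y /mem_setP Mx /mem_setP My; apply/mem_setP/MB.
  - by move=> x y /mem_setP Mx /mem_setP My; apply/mem_setP/MM.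
  have Tfr s : T (sc (fr s)).
    by apply/crossed_orderP; exists (crossed_U f 1%g s); rewrite embedU.
  have [N NP] : exists N, forall i, T (piA ^+ N * e i).
    have ex i : exists N, T (piA ^+ N * e i) by apply: crossed_order_bound.
    exists (\sum_i sval (cid (ex i)))%N => i.
    rewrite (bigD1 i) //= addnC exprD -mulrA; apply: crossed_orderM.
      by rewrite piXE; apply: Tfr.
    by case: (cid (ex i)).
  exists N => x /eP[c [_ ->]]; rewrite mulr_sumr.
  apply: (big_ind (fun x => T x)) => [|u v Tu Tv|i _].
  - by rewrite -(subrr 1); apply: crossed_orderB; apply: crossed_order1.
  - rewrite -[v]opprK; apply: crossed_orderB => //; rewrite -sub0r.
    apply: crossed_orderB => //.
    by rewrite -(subrr 1); apply: crossed_orderB; apply: crossed_order1.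
  - rewrite mulrA piXE [_ * sc _](_ : _ = sc (fr (c i)) * piA ^+ N); last first.
      by rewrite piXE !crossed_U1K mulrC.
    by rewrite -mulrA; apply: crossed_orderM.
move=> [MB MM Mbd].
have Tfr s : T (sc (fr s)).
  by apply/crossed_orderP; exists (crossed_U f 1%g s); rewrite embedU.
split.
- split; first by apply/mem_setP/TM/crossed_order1.
    by move=> x y /mem_setP Mx /mem_setP My; apply/mem_setP/MB.
  by move=> x y /mem_setP Mx /mem_setP My; apply/mem_setP/MM.
- apply: bounded_fg => //.
    by rewrite -(subrr 1); apply: MB; apply/TM/crossed_order1.
  by move=> r x _ Mx; apply: MM => //; apply/TM.
- move=> x; have [d d0 dP] := common_denom (fun g => x g).
  have [b bE] := gnorm_dvd a d.
  pose z : crossed f := [ffun g => b * sval (cid (dP g))].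
  exists 1%N, (fun=> 1), (fun=> gnorm a d), (fun=> emb z); split.
    move=> _; split; [exact: fixed1|exact: gnorm_fixed|exact: gnorm_neq0|].
    by apply/TM/crossed_orderP; exists z.
  rewrite big_ord1; apply/ffunP => g; rewrite scalarE embedE ffunE.
  case: cid => s /= sE.
  have -> : fr (b * s) = fr (gnorm a d) * x g by rewrite tofracM -sE mulrA -tofracM -bE.
  by rewrite tofrac1 mul1r mulKf // tofrac_eq0 gnorm_neq0.
Qed.

End Orders.

(** * Lifting over a noncommutative valuation ring and averaging *)

Section LocalExtension.
Variables (T : nzRingType) (T0 : T -> Prop) (p : T) (n : nat).
Variables (phi : nat -> T -> T) (J : finType) (w w' : J -> T) (m : T -> J -> J -> T).
Hypotheses (T0_1 : T0 1) (T0B : forall x y, T0 x -> T0 y -> T0 (x - y)).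
Hypotheses (T0M : forall x y, T0 x -> T0 y -> T0 (x * y)) (T0p : T0 p).
Hypothesis T0val : forall t, T0 t -> t != 0 ->
  exists l u u', [/\ T0 u, T0 u', u' * u = 1 & t = u * p ^+ l].
Hypothesis T0reg : forall t l, T0 t -> t * p ^+ l = 0 -> t = 0.
Hypothesis phiB : forall i x y, phi i (x - y) = phi i x - phi i y.
Hypothesis phiT0 : forall i x, T0 (phi i x).
Hypothesis phiZ : forall i t x, T0 t -> phi i (t * x) = t * phi i x.
Hypothesis phi_inj : forall x, (forall i, (i < n)%N -> phi i x = 0) -> x = 0.
Hypothesis ww' : \sum_j w j * w' j = 1.
Hypothesis mT0 : forall t i j, T0 (m t i j).
Hypothesis w'm : forall t j, w' j * t = \sum_i m t j i * w' i.
Hypothesis wm : forall t i, t * w i = \sum_j w j * m t j i.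

Let T0_0 : T0 0. Proof. by rewrite -(subrr 1); apply: T0B. Qed.
Let T0X l : T0 (p ^+ l).
Proof. by elim: l => [|l IH]; rewrite ?expr0 // exprS; apply: T0M. Qed.

Section Lift.
Variables (I M N : lmodType T) (i : {linear I -> T^o}).
Variables (pi : {linear M -> N}) (q : {linear I -> N}).
Hypotheses (i_inj : injective i) (pi_onto : forall y, exists x, pi x = y).

Let iZ s x : i (s *: x) = (s : T) * i x. Proof. exact: linearZ. Qed.
Let iB x y : i (x - y) = (i x : T) - i y. Proof. exact: linearB. Qed.

(** The values of coordinate [k] on [X] form a left ideal generated by one power of [p]. An element
    [x0] with that value splits off: its image can be lifted freely, and the remainder has one
    nonzero coordinate fewer. [X] is a predicate because the remainder is a module over [T0]
    only. *)
Lemma submodule_lift k (X : I -> Prop) : (k <= n)%N -> X 0 ->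
  (forall x y, X x -> X y -> X (x - y)) ->
  (forall t x, T0 t -> X x -> X (t *: x)) ->
  (forall x j, X x -> (k <= j < n)%N -> phi j (i x) = 0) ->
  exists r : I -> M, [/\ forall x y, X x -> X y -> r (x - y) = r x - r y,
    forall t x, T0 t -> X x -> r (t *: x) = t *: r x
    & forall x, X x -> pi (r x) = q x].
Proof.
elim: k X => [|k IH] X kn X0 XB XZ Xphi.
  have X00 x : X x -> x = 0.
    move=> Xx; apply: i_inj; rewrite linear0; apply: phi_inj => j jn.
    exact: Xphi.
  exists (fun=> 0); split=> [x y _ _|t x _ _|x /X00 ->]; rewrite ?subr0 ?scaler0 //.
  by rewrite !linear0.
have [[x1 Xx1 x1k]|H] := pselect (exists2 x, X x & phi k (i x) != 0); last first.
  apply: IH => //; first exact: ltnW.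
  move=> x j Xx /andP[]; rewrite leq_eqVlt => /orP[/eqP <- _|kj jn]; last first.
    by apply: Xphi; rewrite ?kj.
  by apply: contrapT => /eqP nz; apply: H; exists x.
have norm x : X x -> phi k (i x) != 0 -> exists l u u', [/\ T0 u, T0 u', u' * u = 1,
    phi k (i x) = u * p ^+ l & phi k (i (u' *: x)) = p ^+ l].
  move=> Xx nz; have [l [u [u' [Tu Tu' u'u E]]]] := T0val (phiT0 k (i x)) nz.
  exists l, u, u'; split=> //.
  by rewrite iZ phiZ // E mulrA u'u mul1r.
have ex : exists l, `[< exists2 x, X x & phi k (i x) = p ^+ l >].
  have [l [u [u' [_ Tu' _ _ E]]]] := norm _ Xx1 x1k.
  by exists l; apply/asboolP; exists (u' *: x1) => //; apply: XZ.
case: (ex_minnP ex) => l /asboolP[x0 Xx0 x0l] lmin.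
have quo x : exists t, X x -> T0 t /\ phi k (i x) = t * p ^+ l.
  have [Xx|nX] := pselect (X x); last by exists 0.
  have [E|nz] := eqVneq (phi k (i x)) 0; first by exists 0 => _; rewrite mul0r.
  have [l' [u [u' [Tu Tu' _ E E']]]] := norm _ Xx nz.
  have ll' : (l <= l')%N.
    by apply: lmin; apply/asboolP; exists (u' *: x) => //; apply: XZ.
  exists (u * p ^+ (l' - l)) => _; split; first exact: T0M.
  by rewrite -mulrA -exprD subnK.
pose t x := sval (cid (quo x)).
have tP x : X x -> T0 (t x) /\ phi k (i x) = t x * p ^+ l.
  by rewrite /t; case: cid.
have tuniq x s : X x -> T0 s -> phi k (i x) = s * p ^+ l -> t x = s.
  move=> Xx Ts E; have [Tt E'] := tP x Xx; apply/eqP; rewrite -subr_eq0; apply/eqP.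
  by apply: (@T0reg _ l); [apply: T0B | rewrite mulrBl -E -E' subrr].
have phiix x y : phi k (i (x - y)) = phi k (i x) - phi k (i y) by rewrite iB phiB.
have phiiz s x : T0 s -> phi k (i (s *: x)) = s * phi k (i x).
  by move=> Ts; rewrite iZ phiZ.
have tB x y : X x -> X y -> t (x - y) = t x - t y.
  move=> Xx Xy; have [Tx Ex] := tP x Xx; have [Ty Ey] := tP y Xy.
  by apply: tuniq; [apply: XB | apply: T0B | rewrite phiix Ex Ey mulrBl].
have tZ s x : T0 s -> X x -> t (s *: x) = s * t x.
  move=> Ts Xx; have [Tx Ex] := tP x Xx.
  by apply: tuniq; [apply: XZ | apply: T0M | rewrite phiiz // Ex mulrA].
pose X' x := X x /\ phi k (i x) = 0.
have [||||r' [r'B r'Z r'q]] := IH X' (ltnW kn).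
- by split=> //; rewrite -(subrr 0) phiix subrr.
- by move=> x y [Xx Ex] [Xy Ey]; split; [apply: XB | rewrite phiix Ex Ey subrr].
- by move=> s x Ts [Xx Ex]; split; [apply: XZ | rewrite phiiz // Ex mulr0].
- move=> x j [Xx Ex] /andP[]; rewrite leq_eqVlt => /orP[/eqP <- //|kj jn].
  by apply: Xphi; rewrite ?kj.
have [m0 m0E] := pi_onto (q x0).
pose x' x := x - t x *: x0.
have X'x' x : X x -> X' (x' x).
  move=> Xx; have [Tx Ex] := tP x Xx.
  by split; [apply: XB => //; apply: XZ | rewrite phiix phiiz // Ex x0l subrr].
exists (fun x => t x *: m0 + r' (x' x)); split.
- move=> x y Xx Xy; have E : x' (x - y) = x' x - x' y.
    by rewrite /x' tB // scalerBl !opprD opprK addrACA.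
  by rewrite tB // E r'B ?scalerBl ?opprD 1?addrACA //; apply: X'x'.
- move=> s x Ts Xx; rewrite tZ // scalerDr scalerA -r'Z //; last exact: X'x'.
  by rewrite /x' tZ // scalerBr scalerA.
- move=> x Xx; rewrite linearD linearZ /= m0E r'q; last exact: X'x'.
  by rewrite /x' linearB linearZ /= addrC subrK.
Qed.

End Lift.

(** The lift [r0] is linear over [T0] only, and is averaged to [r]. The matrices [m] express that
    the sum of the tensors of [w j] with [w' j] over [T0] commutes with [T], making [r] linear over
    [T]; [ww'] keeps it a lift of [q]. *)
Lemma local_extension_hereditary : left_hereditary T.
Proof.
move=> I i i_inj M N pi q pi_onto.
have [||||r0 [r0B r0Z r0q]] := @submodule_lift I M N i pi q i_inj pi_onto n
  (fun=> True) (leqnn n) => //.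
  by move=> x j _ /andP[nj jn]; rewrite leqNgt jn in nj.
have r0D x y : r0 (x + y) = r0 x + r0 y.
  have r00 : r0 0 = 0 by rewrite -(subrr 0) r0B // subrr.
  by rewrite -{1}[y]opprK r0B // -[- y]sub0r r0B // r00 sub0r opprK.
pose r x := \sum_j w j *: r0 (w' j *: x).
have rlin : linear r.
  move=> t x y; rewrite /r scaler_sumr.
  transitivity (\sum_j (w j *: r0 (w' j *: (t *: x)) + w j *: r0 (w' j *: y))).
    by apply: eq_bigr => j _; rewrite scalerDr r0D scalerDr.
  rewrite big_split /=; congr (_ + _).
  transitivity (\sum_j \sum_l w j *: (m t j l *: r0 (w' l *: x))).
    apply: eq_bigr => j _; rewrite scalerA w'm scaler_suml.
    have r00 : r0 0 = 0 by rewrite -(subrr 0) r0B // subrr.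
    rewrite (big_morph r0 r0D r00) scaler_sumr; apply: eq_bigr => l _.
    by rewrite -scalerA r0Z.
  rewrite exchange_big; apply: eq_bigr => l _ /=.
  rewrite scalerA wm scaler_suml; apply: eq_bigr => j _.
  by rewrite scalerA.
pose rL := HB.pack_for {linear I -> M} r (GRing.isLinear.Build _ _ _ _ r rlin).
exists rL => x; rewrite /= /r linear_sum.
transitivity (\sum_j (w j * w' j) *: q x); last by rewrite -scaler_suml ww' scale1r.
by apply: eq_bigr => j _; rewrite linearZ /= r0q // linearZ /= scalerA.
Qed.

End LocalExtension.

(** * Sufficient condition for heredity *)

Section WildDivisionHereditary.
Variables (S : dvrType) (gT : finGroupType) (a : ring_action gT S).
Hypothesis a_faithful : forall g, a g =1 id -> g = 1%g.
Hypothesis res_sep : residue_separable a.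
Variable f : cocycle a.

Local Notation k := (residue S).
Local Notation res := (@residue_map S).
Local Notation p := (unif S).
Local Notation chi := (tame_char a).
Local Notation ak := (residue_act a).
Local Notation W := (wild_group a).
Local Notation T := (crossed f).
Local Notation U := (crossed_U f).
Local Notation Pi := (Pi f).

Lemma wild_coset_repr g :
  exists2 h, h \in W & fingroup.repr (coset W g) = (g * h)%g.
Proof.
have nW x : x \in 'N(W)%g by rewrite (fintype.subsetP (normal_norm (wild_normal a))) ?inE.
exists (g^-1 * fingroup.repr (coset W g))%g; last by rewrite mulKVg.
apply: coset_idr; first by rewrite groupM ?groupV ?nW.
by rewrite morphM ?groupV ?nW //= morphV ?nW //= coset_reprK mulVg.
Qed.

(** Let [l] be the residue characteristic. A [g] in the inertia group whose [l]-th power lies in [W]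
    has [chi g ^+ l = 1], so [(chi g - 1) ^+ l] vanishes and [g] is already in [W]. *)
Lemma tame_index_neq0 :
  (#|[set q : coset_of W | fingroup.repr q \in inertia a]|)%:R != 0 :> k.
Proof.
have nW x : x \in 'N(W)%g by rewrite (fintype.subsetP (normal_norm (wild_normal a))) ?inE.
have -> : [set q : coset_of W | fingroup.repr q \in inertia a] = (inertia_group a / W)%g.
  apply/setP => q; rewrite inE; apply/idP/idP => [qI|].
    by rewrite -(coset_reprK q); apply: mem_quotient.
  case/morphimP => g _ gI ->; rewrite /=; have [h hW ->] := wild_coset_repr g.
  by rewrite groupM // wild_inertia.
apply/negP => E; have [l lk] := natf0_pchar (cardG_gt0 _) E.
have lp := pcharf_prime lk.
have [q qI ql] : {q | q \in (inertia_group a / W)%g & #[q]%g = l}.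
  by apply: Cauchy => //; rewrite (dvdn_pcharf lk).
case/morphimP: qI => g _ gI qE.
have gl : (g ^+ l)%g \in W.
  apply: coset_idr => //; rewrite morphX ?nW //= -qE -ql.
  exact: expg_order.
have chi1 : chi g = 1.
  have [_] := wildP _ _ gl; rewrite chiX_inertia // => E1.
  have : (chi g - 1) ^+ l = 0.
    apply: (addIr 1); rewrite add0r -{2}(expr1n _ l) -exprDn_pchar ?pnatE //.
    by rewrite subrK.
  by move/eqP; rewrite expf_eq0 subr_eq0 => /andP[_ /eqP].
have gW : g \in W by apply/wildP.
by move: lp; rewrite -ql qE /= coset_id // order1.
Qed.

(** On residues the identity occurs among the coset actions as often as the previous lemma counts,
    so independence gives [y] with nonzero trace. It lifts to a [W]-invariant, whose trace is a
    fixed unit by which one may divide. *)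
Lemma casimir_constant : exists2 c : S, wild_fixed a c &
  \sum_(q : coset_of W) a (fingroup.repr q) c = 1.
Proof.
pose tr c := \sum_(q : coset_of W) a (fingroup.repr q) c.
have [y y0] : exists y : k, \sum_(q : coset_of W) ak (fingroup.repr q) y != 0.
  apply: contrapT => H; case/negP: tame_index_neq0; apply/eqP.
  have := @dedekind_independence k k _ (fun q : coset_of W => ak (fingroup.repr q))
    (fun=> 1) (coset W 1) (fun q => rmorph1 _) (fun q => rmorphM _).
  have E x : \sum_(q : coset_of W) 1 * ak (fingroup.repr q) x = 0.
    under eq_bigr => q _ do rewrite mul1r.
    by apply: contrapT => /eqP nz; apply: H; exists x.
  move/(_ E); rewrite sumr_const => E0; rewrite -[RHS]E0; congr _%:R.
  apply: eq_card => q.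
  rewrite inE unfold_in; apply/inertiaP/asboolP => [qI x|qE x].
    by rewrite qI coset_id // repr_coset1 ract1.
  by rewrite qE coset_id // repr_coset1 ract1.
have [c cW cy] := wild_fixed_res a_faithful res_sep y.
have trU : tr c \is a GRing.unit.
  rewrite -res_neq0 rmorph_sum /=; apply: contraNneq y0 => E.
  by rewrite -[X in _ == X]E -cy; apply/eqP/eq_bigr => q _; rewrite res_act.
have trF g : a g (tr c) = tr c.
  have nW x : x \in 'N(W)%g by rewrite (fintype.subsetP (normal_norm (wild_normal a))) ?inE.
  rewrite /tr rmorph_sum /= [RHS](reindex_inj (mulgI (coset W g))) /=.
  apply: eq_bigr => q _; rewrite -ractME.
  transitivity (a (fingroup.repr (coset W (g * fingroup.repr q)%g)) c).
    by have [h hW ->] := wild_coset_repr (g * fingroup.repr q)%g; rewrite [RHS]ractME (cW h hW).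
  congr (a (fingroup.repr _) c).
  by rewrite morphM ?nW //= coset_reprK.
exists (c / tr c) => [g gW|]; first by rewrite rmorphM rmorphV // cW // trF.
under eq_bigr => q _ do rewrite rmorphM rmorphV // trF.
by rewrite -mulr_suml divrr.
Qed.

Hypothesis wdiv : wild_division f.

Lemma iter_untwistM l (t : T) : Pi ^+ l * t = iter l (@untwist S gT a f) t * Pi ^+ l.
Proof.
elim: l t => [|l IH] t; first by rewrite !expr0 mul1r mulr1.
by rewrite exprSr -mulrA Pimul mulrA IH -mulrA -exprSr -iterSr.
Qed.

Lemma PiX_inj l (t : T) : Pi ^+ l * t = 0 -> t = 0.
Proof.
elim: l t => [|l IH] t; first by rewrite expr0 mul1r.
by rewrite exprSr -mulrA => /IH E; apply: (@Pi_inj _ _ _ f); rewrite E mulr0.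
Qed.

(** [Pi] is divided out as long as the residue vanishes, at most [m] times; a nonzero residue is a
    unit, and units lift. *)
Lemma wild_valuation (t : T) : supported W t -> t != 0 -> exists l u u',
  [/\ supported W u, supported W u', u * u' = 1, u' * u = 1 & t = Pi ^+ l * u].
Proof.
move=> st t0; have [g [m Hm]] : exists g m, ~ dvd m (t g).
  apply: contrapT => H; case/eqP: t0; apply/ffunP => g; rewrite crossed_0E.
  apply: unif_sep => n; apply: contrapT => Hn; apply: H; by exists g, n.
elim: m t st {t0} Hm => [|m IH] t st Hm; first by case: Hm; exists (t g); rewrite expr0 mulr1.
have [/reduce_eq0[t1 tE]|nz] := eqVneq (reduce t) 0.
  have st1 : supported W t1.
    move=> h hW; have := st h hW; rewrite tE mulPiE => /eqP.
    by rewrite mulf_eq0 (negPf (unif_neq0 S)) => /eqP.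
  have [|l [u [u' [su su' uu' u'u E]]]] := IH t1 st1.
    apply: contra_not Hm => -[b bE]; exists b; rewrite tE mulPiE bE.
    by rewrite exprS mulrCA.
  by exists l.+1, u, u'; split=> //; rewrite tE E mulrA -exprS.
have anz : aug W (reduce t) != 0.
  by apply: contraNneq nz => /(wdiv (supported_reduce st)) ->.
have [u' [su' uu' u'u]] := wild_inv a_faithful st anz.
by exists 0%N, t, u'; rewrite expr0 mul1r.
Qed.

Lemma iter_untwist1 l : iter l (@untwist S gT a f) 1 = 1.
Proof.
elim: l => // l IH; rewrite iterS IH.
by apply/ffunP => g; rewrite !ffunE; case: eqP => [->|_]; rewrite ?uratio1 ?divr1 ?mul0r.
Qed.

Lemma iter_untwist_mul l (x y : T) :
  iter l (@untwist S gT a f) (x * y) = iter l (@untwist S gT a f) x * iter l (@untwist S gT a f) y.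
Proof. by elim: l => // l IH; rewrite !iterS IH untwistM. Qed.

Lemma supported_iter_untwist l (x : T) : supported W x ->
  supported W (iter l (@untwist S gT a f) x).
Proof. by move=> sx; elim: l => // l IH; rewrite iterS; apply: supported_untwist. Qed.

Local Notation g_ q := (fingroup.repr (q : coset_of W)).

Lemma mem_coset_repr (q : coset_of W) x :
  ((g_ q)^-1 * x \in W)%g = (coset W x == q).
Proof.
have nW y : y \in 'N(W)%g by rewrite (fintype.subsetP (normal_norm (wild_normal a))) ?inE.
apply/idP/eqP => [H|<-].
  by rewrite -[x](mulKVg (g_ q)) coset_kerr // coset_reprK.
have [h hW ->] := wild_coset_repr x.
by rewrite invMg -mulgA mulVg mulg1 groupV.
Qed.

Lemma restrict_left_cosets (x : T) :
  x = \sum_(q : coset_of W) U (g_ q) 1 * restrict W (Uinv f (g_ q) * x).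
Proof.
apply/ffunP => h; rewrite crossed_sumE (bigD1 (coset W h)) //= big1 ?addr0.
  rewrite crossed_U_mulE restrictE mem_coset_repr eqxx.
  have : U (g_ (coset W h)) 1 * (Uinv f (g_ (coset W h)) * x) = x.
    by rewrite mulrA mulUinv mul1r.
  by move=> /ffunP/(_ h); rewrite crossed_U_mulE => ->.
move=> q qh; rewrite crossed_U_mulE restrictE mem_coset_repr eq_sym (negPf qh).
by rewrite rmorph0 mulr0 mul0r.
Qed.

Lemma restrict_right_cosets (x : T) :
  x = \sum_(q : coset_of W) restrict W (x * U (g_ q) 1) * Uinv f (g_ q).
Proof.
have nW y : y \in 'N(W)%g by rewrite (fintype.subsetP (normal_norm (wild_normal a))) ?inE.
have memV (q : coset_of W) h : (h * g_ q \in W)%g = (coset W h^-1%g == q).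
  rewrite -mem_coset_repr -[RHS]groupV !invMg !invgK.
  by [].
apply/ffunP => h; rewrite crossed_sumE (bigD1 (coset W h^-1%g)) //= big1 ?addr0.
  rewrite crossed_mul_UE invgK restrictE memV eqxx.
  have : x * U (g_ (coset W h^-1%g)) 1 * Uinv f (g_ (coset W h^-1%g)) = x.
    by rewrite -mulrA mulUinv mulr1.
  by move=> /ffunP/(_ h); rewrite /Uinv [LHS]crossed_mul_UE invgK => ->.
move=> q qh; rewrite crossed_mul_UE invgK restrictE memV eq_sym (negPf qh).
by rewrite !mul0r.
Qed.

Lemma mulPiX_inj l (t : T) : t * Pi ^+ l = 0 -> t = 0.
Proof.
elim: l t => [|l IH] t; first by rewrite expr0 mulr1.
rewrite exprS mulrA => /IH; rewrite mulPi => E.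
have E' : twist t = 0 by apply: (@Pi_inj _ _ _ f); rewrite E mulr0.
by rewrite -[t]untwistK E'; apply/ffunP => g; rewrite !ffunE mul0r.
Qed.

Lemma converse_expr (R : nzRingType) (x : R) l : ((x : R^c) ^+ l : R^c) = x ^+ l :> R.
Proof. by elim: l => // l IH; rewrite exprSr [RHS]exprS -IH. Qed.

Lemma restrictB (x y : T) : restrict W (x - y) = restrict W x - restrict W y.
Proof.
apply/ffunP => g; rewrite !restrictE !crossed_subE !restrictE.
by case: ifP; rewrite ?subr0.
Qed.

Lemma restrict_translates_l (x : T) :
  (forall i, (i < #|gT|)%N -> restrict W (x * U (nth 1%g (enum gT) i) 1) = 0) -> x = 0.
Proof.
move=> H; apply/ffunP => h; rewrite crossed_0E.
have hE : nth 1%g (enum gT) (index h^-1%g (enum gT)) = h^-1%g by rewrite nth_index ?mem_enum.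
have := H (index h^-1%g (enum gT)); rewrite cardE index_mem mem_enum => /(_ isT).
rewrite hE => /ffunP/(_ 1%g); rewrite restrictE group1 crossed_mul_UE.
rewrite invgK mul1g rmorph1 mulr1 crossed_0E => /eqP.
rewrite mulf_eq0 => /orP[/eqP //|/eqP E].
by have := cocycle_unit f h h^-1%g; rewrite E unitr0.
Qed.

Lemma restrict_translates_r (x : T) :
  (forall i, (i < #|gT|)%N -> restrict W (U (nth 1%g (enum gT) i) 1 * x) = 0) -> x = 0.
Proof.
move=> H; apply/ffunP => h; rewrite crossed_0E.
have hE : nth 1%g (enum gT) (index h^-1%g (enum gT)) = h^-1%g by rewrite nth_index ?mem_enum.
have := H (index h^-1%g (enum gT)); rewrite cardE index_mem mem_enum => /(_ isT).
rewrite hE => /ffunP/(_ 1%g); rewrite restrictE group1 crossed_U_mulE.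
rewrite invgK mulg1 mul1r crossed_0E => /eqP.
rewrite mulf_eq0 => /orP[/eqP E|/eqP E].
  by rewrite -[LHS](ractKV a h) E rmorph0.
by have := cocycle_unit f h^-1%g h; rewrite E unitr0.
Qed.

Lemma wild_fixed_comm c (x : T) : wild_fixed a c -> supported W x ->
  U 1%g c * x = x * U 1%g c.
Proof.
move=> cW sx; apply/ffunP => g; rewrite crossed_U1_mulE crossed_mul_U1E mulrC.
have [gW|gW] := boolP (g \in W); first by rewrite (cW g gW).
by rewrite sx ?mul0r.
Qed.

Lemma wild_division_hereditary : hereditary T.
Proof.
have [c cW c1] := casimir_constant.
(* Since [c] is [W]-invariant it commutes with the crossed product of [W], so inserting it respects
   the coset relations, and its trace 1 normalizes the sum. *)
pose w (q : coset_of W) : T := U (g_ q) 1 * U 1%g c.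
pose w' (q : coset_of W) : T := Uinv f (g_ q).
pose m (t : T) (q q' : coset_of W) : T := restrict W (Uinv f (g_ q) * t * U (g_ q') 1).
have ww' : \sum_q w q * w' q = 1.
  transitivity (\sum_q U 1%g (a (g_ q) c)).
    apply: eq_bigr => q _; rewrite /w /w'.
    have -> : U (g_ q) 1 * U 1%g c = U 1%g (a (g_ q) c) * U (g_ q) 1.
      by rewrite !crossed_UU mulg1 mul1g cocycle1l cocycle1r rmorph1 !mulr1 mul1r.
    by rewrite -mulrA mulUinv mulr1.
  apply/ffunP => g; rewrite crossed_sumE crossed_1E.
  under eq_bigr => q _ do rewrite crossed_UE.
  by case: (g =P 1%g) => _; [exact: c1 | rewrite big1].
have mT0 t i j : supported W (m t i j) by apply: supported_restrict.
have w'm t j : w' j * t = \sum_i m t j i * w' i by apply: restrict_right_cosets.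
have wm t i : t * w i = \sum_j w j * m t j i.
  rewrite /w mulrA {1}[t * U (g_ i) 1]restrict_left_cosets mulr_suml.
  apply: eq_bigr => j _; rewrite -mulrA -[RHS]mulrA; congr (_ * _).
  by rewrite /m -[_ * t * _]mulrA wild_fixed_comm //; apply: supported_restrict.
split.
  apply: (@local_extension_hereditary _ (@supported _ _ _ f W) Pi #|gT|
    (fun i x => restrict W (x * U (nth 1%g (enum gT) i) 1)) _ w w' m) => //.
  - exact: supported1.
  - by move=> x y; apply: supportedB.
  - by move=> x y; apply: supportedM.
  - exact: supportedPi.
  - move=> t st t0; have [l [u [u' [su su' uu' u'u ->]]]] := wild_valuation st t0.
    exists l, (iter l (@untwist S gT a f) u), (iter l (@untwist S gT a f) u').
    rewrite -iter_untwistM -iter_untwist_mul u'u iter_untwist1.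
    by split=> //; apply: supported_iter_untwist.
  - by move=> t l _; apply: mulPiX_inj.
  - by move=> i x y; rewrite mulrBl restrictB.
  - by move=> i x; apply: supported_restrict.
  - by move=> i t x st; rewrite -mulrA restrictMl.
  - exact: restrict_translates_l.
(* On the other side [w] and [w'] trade places, and the factorization with [Pi ^+ l] on the left is
   read directly in the converse ring. *)
pose Tc : nzRingType := (T^c)%type.
apply: (@local_extension_hereditary Tc (@supported _ _ _ f W) Pi #|gT|
    (fun i x => restrict W (U (nth 1%g (enum gT) i) 1 * (x : T))) _ w' w
    (fun t i j => m t j i)).
- exact: supported1.
- by move=> x y; apply: supportedB.
- by move=> x y sx sy; apply: supportedM.
- exact: supportedPi.
- move=> t st t0; have [l [u [u' [su su' uu' u'u ->]]]] := wild_valuation st t0.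
  by exists l, u, u'; split=> //; rewrite converse_expr.
- by move=> t l _; rewrite converse_expr => /PiX_inj.
- move=> i x y; pose u : T := U (nth 1%g (enum gT) i) 1.
  exact: etrans (congr1 (restrict W) (mulrBr u (x : T) (y : T))) (restrictB _ _).
- by move=> i x; apply: supported_restrict.
- move=> i t x st; pose u : T := U (nth 1%g (enum gT) i) 1.
  exact: etrans (congr1 (restrict W) (mulrA u (x : T) (t : T))) (restrictMr _ st).
- exact: restrict_translates_r.
- exact: ww'.
- by move=> t i j; apply: mT0.
- exact: wm.
- exact: w'm.
Qed.

End WildDivisionHereditary.

(** * Counting the maximal orders *)

Section MaximalOrders.
Variables (S : dvrType) (gT : finGroupType) (a : ring_action gT S).
Hypothesis a_faithful : forall g, a g =1 id -> g = 1%g.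
Hypothesis res_sep : residue_separable a.
Variable f : cocycle a.

Local Notation fk := (residue_fcocycle f).
Local Notation A := (crossed_fraction f).
Local Notation B := (crossed fk).
Local Notation T := (crossed_order f).
Local Notation p := (piA f).
Local Notation q := (piAV f).
Local Notation s := (@rtwist S gT a f).
Local Notation emb := (@embed S gT a f).

Lemma emb_conj (w : crossed f) : emb w * q = q * emb (untwist w).
Proof.
have := congr1 emb (Pimul w); rewrite !embedM -/p => E.
have := congr1 (fun x => q * x * q) E.
by rewrite mulrA piAVK mul1r -!mulrA piAK mulr1.
Qed.

Lemma emb_conj' (w : crossed f) : q * emb w * p = emb (twist w).
Proof. by rewrite -mulrA -embedM mulPi embedM mulrA -/p piAVK mul1r. Qed.

(** [N] is the right order of the wild radical, bounded because the radical contains [Pi]. It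
    contains [q * emb z], which lies outside [T] since [z] has nonzero residue. *)
Lemma maximal_wild_division : is_maximal_order T -> wild_division f.
Proof.
move=> [ordT maxT]; apply: contrapT => nD.
have [z z0 zP] := wild_radical_multiplier a_faithful res_sep nD.
pose N : set A := fun x => forall w, wild_radical w ->
  exists2 v, wild_radical v & emb w * x = emb v.
have TN x : T x -> N x.
  move=> /crossed_orderP[t ->] w Iw; exists (w * t); first exact: wild_radicalM.
  by rewrite embedM.
have ordN : is_order N.
  apply/is_order_overP => //; split.
  - move=> x y Nx Ny w Iw; have [v Iv vE] := Nx w Iw; have [v' Iv' v'E] := Ny w Iw.
    by exists (v - v'); [apply: wild_radicalB | rewrite mulrBr vE v'E embedB].
  - move=> x y Nx Ny w Iw; have [v Iv vE] := Nx w Iw; have [v' Iv' v'E] := Ny v Iv.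
    by exists v' => //; rewrite mulrA vE.
  - exists 1%N => x Nx; have [v _ vE] := Nx _ (wild_radicalPi f).
    by rewrite expr1 vE; apply/crossed_orderP; exists v.
have NT := maxT N ordN TN.
have : N (q * emb z).
  move=> w Iw; have [v Iv vE] := zP w Iw; exists v => //.
  by rewrite mulrA emb_conj -mulrA -embedM vE embedM mulrA piAVK mul1r.
rewrite NT => /crossed_orderP[y yE]; case/eqP: z0; apply/reduce_eq0; exists y.
by apply: embed_inj; rewrite embedM -yE mulrA piAK mul1r.
Qed.

(** Reduction on the embedded copy of [T], made total on [A] with default value 0. *)
Definition reduceA (x : A) : B :=
  if pselect (exists y, x = emb y) is left H then reduce (sval (cid H)) else 0.

Lemma reduceAE y : reduceA (emb y) = reduce y.
Proof.
rewrite /reduceA; case: pselect => [H|[]]; last by exists y.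
by case: cid => z /= /embed_inj ->.
Qed.

Lemma overring_orderP (M : set A) :
  is_order M /\ (forall x, T x -> M x) <-> overring T p M.
Proof.
split=> [[ordM TM]|[TM MB MM Mb]].
  by have [MB MM Mb] := (is_order_overP a_faithful TM).1 ordM.
by split=> //; apply/is_order_overP.
Qed.

Lemma maximal_order_overP (M : set A) :
  is_maximal_order M /\ (forall x, T x -> M x) <-> max_overring T p M.
Proof.
split=> [[[ordM maxM] TM]|[ovM maxM]].
  split; first exact/overring_orderP.
  move=> N ovN MN x Nx; have [ordN _] := (overring_orderP N).2 ovN.
  by rewrite -(maxM N ordN MN).
have [ordM TM] := (overring_orderP M).2 ovM; split=> //; split=> // N ordN MN.
apply/seteqP; split=> //; apply: maxM => //; apply/overring_orderP; split=> //.
by move=> x /TM /MN.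
Qed.

Let TJ x : T x -> T (q * x * p).
Proof. by move=> /crossed_orderP[y ->]; rewrite emb_conj'; apply/crossed_orderP; eexists. Qed.
Let rho1 : reduceA 1 = 1.
Proof. by rewrite -(embed1 f) reduceAE reduce1. Qed.
Let rhoB x y : T x -> T y -> reduceA (x - y) = reduceA x - reduceA y.
Proof.
move=> /crossed_orderP[x' ->] /crossed_orderP[y' ->].
by rewrite -embedB !reduceAE reduceB.
Qed.
Let rhoM x y : T x -> T y -> reduceA (x * y) = reduceA x * reduceA y.
Proof.
move=> /crossed_orderP[x' ->] /crossed_orderP[y' ->].
by rewrite -embedM !reduceAE reduceM.
Qed.
Let rho_onto b : exists2 x, T x & reduceA x = b.
Proof.
have [y yE] := reduce_onto b; exists (emb y); last by rewrite reduceAE.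
by apply/crossed_orderP; exists y.
Qed.
Let rho_ker x : T x -> reduceA x = 0 <-> T (q * x).
Proof.
move=> /crossed_orderP[y ->]; rewrite reduceAE reduce_eq0 crossed_orderP.
split=> -[z zE]; exists z.
  by rewrite zE embedM mulrA piAVK mul1r.
by apply: embed_inj; rewrite embedM -zE mulrA piAK mul1r.
Qed.
Let rhoJ x : T x -> reduceA (q * x * p) = s (reduceA x).
Proof. by move=> /crossed_orderP[y ->]; rewrite emb_conj' !reduceAE reduce_twist. Qed.

Section Idempotents.
Variables (r : nat) (e : B).
Hypothesis r_gt0 : (0 < r)%N.
Hypothesis e_cyc : iter r s e = e.
Hypothesis e_sum : \sum_(i < r) iter i s e = 1.
Hypothesis e_orth : forall i j, (i < r)%N -> (j < r)%N ->
  iter i s e * iter j s e = if i == j then iter i s e else 0.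
Hypothesis e_neq0 : forall i, (i < r)%N -> iter i s e != 0.
Hypothesis e_central : forall i b, (i < r)%N -> b * iter i s e = iter i s e * b.
Hypothesis e_simple : forall X x j, is_ideal X -> (j < r)%N -> X x ->
  x * iter j s e != 0 -> X (iter j s e).

Local Notation E := (fun i => iter i s e).
Definition max_order (j : nat) : set A := colon_order T reduceA E j.

Lemma e_trans i j : (i < r)%N -> (j < r)%N ->
  exists2 k, (k < r)%N & iter k s (iter i s e) = iter j s e.
Proof.
move=> ir jr; have [ij|ji] := leqP i j.
  exists (j - i)%N; first exact: leq_ltn_trans (leq_subr _ _) jr.
  by rewrite -iterD subnK.
have ijr : (i <= j + r)%N by rewrite (leq_trans (ltnW ir)) ?leq_addl.
exists (j + r - i)%N; first by rewrite ltn_subLR ?ltn_add2r.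
by rewrite -iterD subnK // iterD e_cyc.
Qed.

Let e_idem i : (i < r)%N -> E i * E i = E i.
Proof. by move=> ir; rewrite e_orth // eqxx. Qed.
Let e_orth' i j : (i < r)%N -> (j < r)%N -> i != j -> E i * E j = 0.
Proof. by move=> ir jr ij; rewrite e_orth // (negPf ij). Qed.

Lemma max_order_overringP (M : set A) : overring T p M ->
  max_overring T p M <-> exists2 j, (j < r)%N & forall x, M x <-> max_order j x.
Proof.
apply: (max_overringP (crossed_order1 f) (@crossed_orderB _ _ _ f)
  (@crossed_orderM _ _ _ f) (crossed_order_pi f) (piAK f) (piAVK f) TJ rho1 rhoB
  rhoM rho_onto rho_ker rhoJ (@crossed_order_bound _ _ _ f) e_sum e_idem e_neq0
  e_central e_trans e_simple e_orth').
Qed.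

Lemma max_order_overring j : (j < r)%N -> overring T p (max_order j).
Proof.
apply: (colon_order_overring (crossed_order1 f) (@crossed_orderB _ _ _ f)
  (@crossed_orderM _ _ _ f) (crossed_order_pi f) (piAK f) (piAVK f) TJ rhoB
  rhoM rho_onto rho_ker rhoJ (@crossed_order_bound _ _ _ f) e_sum e_idem e_neq0
  e_central e_trans e_simple).
Qed.

Lemma max_order_inj i j : (i < r)%N -> (j < r)%N -> max_order i = max_order j -> i = j.
Proof.
move=> ir jr Eij; apply: (colon_order_inj (crossed_order1 f) (@crossed_orderM _ _ _ f)
  rhoM rho_onto rho_ker e_idem e_neq0 e_central ir jr).
  by move=> x; rewrite -/(max_order i x) Eij.
by move=> k kr ki; apply: e_orth'; rewrite // eq_sym.
Qed.

Lemma maximal_orders_overE : maximal_orders_over f = (max_order @` `I_r)%classic.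
Proof.
apply/seteqP; split=> [M HM|_ [j jr <-]].
  have maxM := (maximal_order_overP M).1 HM.
  have [j jr jM] := (max_order_overringP (proj1 maxM)).1 maxM.
  by exists j => //; apply/seteqP; split=> x; apply jM.
apply/maximal_order_overP/max_order_overringP; first exact: max_order_overring.
by exists j.
Qed.

Lemma maximal_orders_over_card : (maximal_orders_over f #= `I_r)%card.
Proof.
rewrite maximal_orders_overE; apply: inj_card_eq => i j /set_mem ir /set_mem jr.
exact: max_order_inj.
Qed.

(** A maximal [T] equals each of the [r] distinct maximal orders above it. Conversely, [r = 1]
    forces [e = 1], so I_0 is all of [T] and every colon set collapses to [T]. *)
Lemma crossed_order_maximal : is_maximal_order T <-> r = 1%N.
Proof.
split=> [maxT|r1].
  have eqT j : (j < r)%N -> max_order j = T.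
    move=> jr; have [[ordM maxM] TM] : maximal_orders_over f (max_order j).
      by rewrite maximal_orders_overE; exists j.
    by apply: (proj2 maxT).
  apply/eqP; rewrite eqn_leq r_gt0 andbT leqNgt; apply/negP => r2.
  by have := @max_order_inj 0 1 r_gt0 r2; rewrite !eqT // => /(_ erefl).
have e1 : e = 1 by have := e_sum; rewrite r1 big_ord1.
suff ET : max_order 0%N = T.
  have : maximal_orders_over f (max_order 0%N).
    by rewrite maximal_orders_overE; exists 0%N.
  by rewrite ET => -[].
apply/seteqP; split=> x; last by exists 0%N.
move=> [n]; elim: n x => // n IH x /= Kx; apply: IH.
rewrite -[x]mulr1; apply: Kx; first exact: crossed_order1.
by rewrite e1 mulr1.
Qed.

End Idempotents.
End MaximalOrders.

Local Open Scope card_scope.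

Theorem theoremB (S : dvrType) (gT : finGroupType) (a : ring_action gT S)
    (a_faithful : forall g, a g =1 id -> g = 1%g)
    (res_sep : residue_separable a)
    (f : cocycle a) (H : {group gT}) (H_conductor : is_conductor f H) :
  (hereditary (crossed f) -> maximal_orders_over f #= `I_#|H|) /\
  (is_maximal_order (crossed_order f) <->
     hereditary (crossed f) /\ H :=: 1%g).
Proof.
have div_case : wild_division f -> (maximal_orders_over f #= `I_#|H|)%card /\
    (is_maximal_order (crossed_order f) <-> #|H| = 1%N).
  move=> wdiv; have [r [e [r0 e_cyc e_sum e_orth [e_neq0 e_central e_simple]]]] :=
    residue_idempotents a_faithful wdiv.
  have -> : #|H| = r.
    exact: (card_conductor a_faithful wdiv r0 e_cyc e_sum e_orth e_neq0 e_central e_simple).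
  split; [exact: (maximal_orders_over_card a_faithful e_cyc)|].
  exact: (crossed_order_maximal a_faithful r0 e_cyc).
have her_div : hereditary (crossed f) -> wild_division f.
  by move=> [hT _]; apply: hereditary_wild_division.
split; first by move/her_div/div_case => [].
split=> [maxT|[hT H1]].
  (* Heredity is a conclusion here: maximality gives the condition on wild inertia, and that
     condition implies heredity. *)
  have wdiv := maximal_wild_division a_faithful res_sep maxT.
  split; first exact: wild_division_hereditary.
  by apply: card1_trivg; apply/(div_case wdiv).2.
by apply/(div_case (her_div hT)).2; rewrite H1 cards1.
Qed.
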